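(* Let $H$ be a real or complex Hilbert space and let $A,B$ be positive invertible bounded linear operators on $H$. Then $$L(\mathcal Q_A,\mathcal Q_B)=\mathcal Q_{L(A,B)},$$ where $$L(A,B):=\int_0^1A\sharp_tB\,dt=A^{1/2}F\big(A^{-1/2}BA^{-1/2}\big)A^{1/2},$$ with $F(x)=\frac{x-1}{\log x}$ for $x>0$, $x\neq1$, and $F(1)=1$. That is, $L(A,B)$ is the operator logarithmic mean of $A$ and $B$.
   Context: For a bounded linear operator $A$ on $H$, $\mathcal Q_A(x)=\frac12\langle Ax,x\rangle$, $x\in H$. For positive invertible $A,B$ and $t\in[0,1]$, $A\sharp_tB=A^{1/2}\big(A^{-1/2}BA^{-1/2}\big)^tA^{1/2}$. Functional means (with $E=H$, and $E^*$ identified with $H$ through the inner product): $\Gamma_0(H)$ is the set of convex lower semi-continuous proper functionals $f:H\to\mathbb R\cup\{+\infty\}$; $f^*(x^* )=\sup_{x\in H}\{\Re e\langle x^*,x\rangle-f(x)\}$. For $f,g\in\Gamma_0(H)$ and $\lambda\in(0,1)$: $f!_\lambda g=\big((1-\lambda)f^*+\lambda g^*\big)^*$, $f\sharp_\lambda g=\frac{\sin(\pi\lambda)}{\pi}\int_0^1\frac{t^{\lambda-1}}{(1-t)^\lambda}\,f!_tg\,dt$ (point-wise integral), with $f\sharp_0g=f$, $f\sharp_1g=g$. The logarithmic mean of $f$ and $g$ is $L(f,g)=\int_0^1f\sharp_tg\,dt$ (point-wise). *)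

(* Defs.v *)
From HB Require Import structures.
From mathcomp Require Import all_boot all_order all_algebra.
From mathcomp Require Import sesquilinear complex.
From mathcomp Require Import all_classical all_reals all_analysis.
Set Implicit Arguments.
Unset Strict Implicit.
Unset Printing Implicit Defensive.
Import Order.TTheory GRing.Theory Num.Theory.
Import numFieldNormedType.Exports.
Local Open Scope classical_set_scope.
Local Open Scope ring_scope.

Inductive scalar_kind := RealScalars | ComplexScalars.

Section Scalars.
Context (R : realType).

Definition scalar_field (k : scalar_kind) : numFieldType :=
  match k with RealScalars => R | ComplexScalars => complex R end.

Definition sconj (k : scalar_kind) : scalar_field k -> scalar_field k :=
  match k with RealScalars => idfun | ComplexScalars => @conjc R end.

Definition sre (k : scalar_kind) : scalar_field k -> R :=
  match k with RealScalars => idfun | ComplexScalars => @complex.Re R end.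

Definition of_real (k : scalar_kind) : R -> scalar_field k :=
  match k with RealScalars => idfun | ComplexScalars => real_complex R end.

End Scalars.
Arguments sconj {R k}.
Arguments sre {R k}.
Arguments of_real {R k}.

Section Operators.
Context (R : realType) (k : scalar_kind).
Context (H : completeNormedModType (scalar_field R k)).
Implicit Types A B S T : H -> H.

Definition op_norm_le A (c : R) : Prop :=
  forall x, `|A x| <= of_real c * `|x|.

Definition bounded_operator A : Prop :=
  linear A /\ exists c : R, op_norm_le A c.

Definition invertible_operator A : Prop :=
  exists S, [/\ bounded_operator S, cancel A S & cancel S A].

Definition spectrum A : set (scalar_field R k) :=
  [set l | ~ invertible_operator (fun x => A x - l *: x)].

Definition poly_op (p : {poly R}) A : H -> H :=
  fun x => \sum_(i < size p) of_real p`_i *: iter i A x.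

(* Continuous functional calculus of a self-adjoint operator A (whose spectrum
   is real): f(A) is the operator-norm limit of p_n(A), for real polynomials
   p_n converging to f uniformly on the spectrum of A. *)
Definition is_cfc (f : R -> R) A S : Prop :=
  exists2 p : nat -> {poly R},
    forall e : R, 0 < e -> \forall n \near \oo,
      forall r : R, spectrum A (of_real r) -> `|(p n).[r] - f r| <= e &
    forall e : R, 0 < e -> \forall n \near \oo,
      op_norm_le (poly_op (p n) A \- S) e.

Definition cfc (f : R -> R) A : H -> H := xget (fun=> 0) (is_cfc f A).

Definition op_pow A (t : R) : H -> H := cfc (fun x => x `^ t) A.

Definition op_geom_mean (t : R) A B : H -> H :=
  op_pow A 2^-1 \o
    op_pow (op_pow A (- 2^-1) \o B \o op_pow A (- 2^-1)) t \o
  op_pow A 2^-1.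

(* Riemann integral in the operator norm; c i is the tag of the i-th
   subinterval of the partition a = s_0 < ... < s_n = b. *)
Definition is_op_integral (T : R -> H -> H) (a b : R) S : Prop :=
  forall e : R, 0 < e -> exists2 d : R, 0 < d &
    forall (s : seq R) (c : nat -> R), itv_partition a b s ->
      (forall i, (i < size s)%N ->
        nth b (a :: s) i <= c i <= nth b s i /\
        nth b s i - nth b (a :: s) i < d) ->
      op_norm_le
        (fun x => \sum_(i < size s)
            of_real (nth b s i - nth b (a :: s) i) *: T (c i) x - S x) e.

Definition op_integral (T : R -> H -> H) (a b : R) : H -> H :=
  xget (fun=> 0) (is_op_integral T a b).

Definition op_log_mean A B : H -> H :=
  op_integral (fun t => op_geom_mean t A B) 0 1.

Definition log_mean_fun (x : R) : R := if x == 1 then 1 else (x - 1) / ln x.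

End Operators.

Section HilbertSpace.
Context (R : realType) (k : scalar_kind).
Context (H : completeNormedModType (scalar_field R k)).
Context (dot : {dot H for (@sconj R k)}).

(* The norm of the Banach space H comes from the inner product dot, which is
   linear in its first argument. *)
Definition is_hilbert : Prop := forall x : H, dot x x = `|x| ^+ 2.

Definition positive_operator (A : H -> H) : Prop :=
  [/\ bounded_operator A, forall x y, dot (A x) y = dot x (A y) &
      forall x, 0 <= dot (A x) x].

(* sre only changes the type here when A is self-adjoint, since then
   dot (A x) x is real. *)
Definition quad (A : H -> H) : H -> \bar R :=
  fun x => (2^-1 * sre (dot (A x) x))%:E.

Local Open Scope ereal_scope.

Definition fenchel_conj (f : H -> \bar R) : H -> \bar R :=
  fun y => ereal_sup [set (sre (dot y x))%:E - f x | x in [set: H]].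

Definition harm_mean (l : R) (f g : H -> \bar R) : H -> \bar R :=
  fenchel_conj (fun y => (1 - l)%:E * fenchel_conj f y + l%:E * fenchel_conj g y).

Definition geom_mean (l : R) (f g : H -> \bar R) : H -> \bar R :=
  fun x =>
    if l == 0%R then f x else if l == 1%R then g x else
    (sin (pi * l) / pi)%:E *
    \int[@lebesgue_measure R]_(t in `]0%R, 1%R[)
      ((t `^ (l - 1) / (1 - t) `^ l)%:E * harm_mean t f g x).

Definition log_mean (f g : H -> \bar R) : H -> \bar R :=
  fun x => \int[@lebesgue_measure R]_(t in `[0%R, 1%R]) geom_mean t f g x.

End HilbertSpace.

(* Main.v *)
(** Put P = A^(1/2), Q = A^(-1/2) and T = Q B Q, so that A = P P and B = P T P.
    Legendre duality for quadratic functionals (completing the square) gives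
    Q_A !_t Q_B = Q_(P h_t(T) P) with h_t(x) = x / ((1 - t) x + t). For z = P x,
    the map f |-> <f(T) z, z> is a positive functional of f; Bernstein
    polynomials approximate it by finite sums of point evaluations with positive
    weights, uniformly over functions with a common Lipschitz constant, so it
    commutes with integrals in t. The scalar identities
      sin(pi l)/pi * int_0^1 t^(l-1) (1-t)^(-l) h_t(x) dt = x^l  and
      int_0^1 x^t dt = (x - 1) / ln x
    then give Q_A #_l Q_B = Q_(P T^l P) and the theorem. The first one reduces to
    Euler's reflection formula, proved by Herglotz' trick in a threefold version.

    The functional calculus of the statement only constrains polynomials on the
    spectrum, so its uniqueness needs |p(T)| <= sup |p| over the spectrum, which
    follows from: p >= 0 on the spectrum implies p(T) >= 0. *)

Require Import Defs.
From mathcomp Require Import all_boot all_order all_algebra.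
From mathcomp Require Import sesquilinear complex.
From mathcomp Require Import all_classical all_reals all_analysis.
From mathcomp Require Import measurable_realfun.
From mathcomp Require Import ring lra.
Import Order.TTheory GRing.Theory Num.Theory.
Import numFieldNormedType.Exports.
Local Open Scope classical_set_scope.
Local Open Scope ring_scope.

Set Implicit Arguments.
Unset Strict Implicit.
Unset Printing Implicit Defensive.

(** [cfc] and [op_integral] are choice operators: they return some value meeting a specification, if
    there is one. Every use of them therefore needs existence (Bernstein approximation and
    completeness for [cfc], explicit Riemann sum estimates for [op_integral]) and uniqueness, and
    operator identities are obtained by showing that both sides meet the same specification. One
    discretization of the form of T has to serve x^t, h_t and F at the same time; hence all of them
    are given the single Lipschitz constant (1 + 1/c)^2 on an interval [c, M] with c > 0 that
    contains the real spectrum of T. Only real polynomials and real spectral points enter, so real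
    and complex scalars are handled together through the real part of the inner product.

    Herglotz' trick uses three terms because pi / sin(pi x) changes sign under x -> x + 1: an
    alternating sum over an odd number of shifts is compatible with that sign, whereas halving the
    argument would bring in tangent and cotangent. *)

Lemma le_of_eq (R : realType) (x y : R) : x = y -> x <= y.
Proof. by move->. Qed.

(** * Bernstein approximation *)

Section Bernstein.
Context {R : realType}.

(** The Bernstein basis polynomial C(n, j) u^j (1 - u)^(n - j), given by the recursion on the last
    of n Bernoulli trials rather than by binomials, so that its moments follow by induction. *)
Fixpoint bern (u : {poly R}) (n j : nat) : {poly R} :=
  if n is n'.+1 then
    (if j is j'.+1 then u * bern u n' j' else 0) + (1 - u) * bern u n' j
  else (j == 0%N)%:R.

Lemma bern_small u n j : (n < j)%N -> bern u n j = 0.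
Proof.
elim: n j => [|n IHn] [|j] //= nj.
by rewrite !IHn ?mulr0 ?addr0 //; exact: ltnW.
Qed.

(** Conditioning on the last trial: a success shifts the argument of [g], a failure keeps it. The
    three moments below are instances. *)
Lemma bern_sumS u n (g : nat -> {poly R}) :
  \sum_(j < n.+2) bern u n.+1 j * g j =
  u * (\sum_(j < n.+1) bern u n j * g j.+1) + (1 - u) * (\sum_(j < n.+1) bern u n j * g j).
Proof.
under eq_bigr do rewrite /= mulrDl.
rewrite big_split /=; congr (_ + _).
  rewrite big_ord_recl mul0r add0r mulr_sumr.
  by apply: eq_bigr => j _; rewrite /= mulrA.
rewrite big_ord_recr /= bern_small // mulr0 mul0r addr0 mulr_sumr.
by apply: eq_bigr => j _; rewrite mulrA.
Qed.

Lemma bern_sum0 u n : \sum_(j < n.+1) bern u n j = 1.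
Proof.
elim: n => [|n IHn]; first by rewrite big_ord1.
have := bern_sumS u n (fun=> 1).
rewrite (eq_bigr (fun j : 'I_n.+2 => bern u n.+1 j)) => [|j _]; last by rewrite mulr1.
rewrite (eq_bigr (fun j : 'I_n.+1 => bern u n j)) => [->|j _]; last by rewrite mulr1.
by rewrite IHn; ring.
Qed.

Lemma bern_sum1 u n : \sum_(j < n.+1) bern u n j * j%:R = n%:R * u.
Proof.
elim: n => [|n IHn]; first by rewrite big_ord1 mulr0 mul0r.
rewrite (bern_sumS u n (fun j => j%:R)) IHn.
rewrite (eq_bigr (fun j : 'I_n.+1 => bern u n j + bern u n j * j%:R)) => [|j _].
  by rewrite big_split /= bern_sum0 IHn; ring.
by rewrite -natr1; ring.
Qed.

(** Binomial variance n u (1 - u) plus the squared mean; the variance is what yields the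
    approximation rate. *)
Lemma bern_sum2 u n :
  \sum_(j < n.+1) bern u n j * j%:R ^+ 2 = n%:R * u * (1 - u) + (n%:R * u) ^+ 2.
Proof.
elim: n => [|n IHn]; first by rewrite big_ord1 expr0n /= mulr0 mul0r; ring.
rewrite (bern_sumS u n (fun j => j%:R ^+ 2)) IHn.
rewrite (eq_bigr (fun j : 'I_n.+1 => bern u n j + 2 * (bern u n j * j%:R) + bern u n j * j%:R ^+ 2)) => [|j _].
  by rewrite !big_split /= -mulr_sumr bern_sum0 bern_sum1 IHn -natr1; ring.
by rewrite -natr1; ring.
Qed.

Lemma bern_ge0 (u : {poly R}) n j r : 0 <= u.[r] <= 1 -> 0 <= (bern u n j).[r].
Proof.
move=> /andP[u0 u1]; elim: n j => [|n IHn] j /=.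
  by case: eqP => _; rewrite ?hornerC // horner0.
by case: j => [|j]; rewrite !hornerE ?addr_ge0 ?mulr_ge0 ?subr_ge0 // IHn.
Qed.

(* The Bernstein operator: one finite positive partition of unity
   approximates all functions with a given Lipschitz constant at once. *)
Lemma bernstein_discretization (c M e : R) : c < M -> 0 < e ->
  exists n (xs : nat -> R) (b : nat -> {poly R}),
  [/\ forall j, (j < n)%N -> c <= xs j <= M,
      forall j r, c <= r <= M -> 0 <= (b j).[r],
      \sum_(j < n) b j = 1 &
      forall (f : R -> R) L, 0 <= L ->
        (forall r s, c <= r <= M -> c <= s <= M -> `|f r - f s| <= L * `|r - s|) ->
        forall r, c <= r <= M -> `|(\sum_(j < n) f (xs j) *: b j).[r] - f r| <= L * e].
Proof.
move=> cM e0; have Mc0 : 0 < M - c by rewrite subr_gt0.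
(* The binomial mean deviates by at most the order of (M - c) / sqrt n, so n >= (M - c)^2 / e^2 is
   the required size. *)
pose n := (Num.truncn ((M - c) ^+ 2 / e ^+ 2)).+1.
have nbig : (M - c) ^+ 2 / e ^+ 2 <= n%:R by apply/ltW; exact: truncnS_gt.
have n0 : 0 < n%:R :> R by rewrite ltr0n.
pose u : {poly R} := (M - c)^-1 *: ('X - c%:P).
have uE r : u.[r] = (r - c) / (M - c) by rewrite /u !hornerE mulrC.
have u01 r : c <= r <= M -> 0 <= u.[r] <= 1.
  by move=> /andP[h1 h2]; rewrite uE divr_ge0 ?subr_ge0 ?(ltW cM) //= ler_pdivrMr // mul1r lerD2r.
pose xs (j : nat) := c + (M - c) * (j%:R / n%:R).
have xsI j : (j < n.+1)%N -> c <= xs j <= M.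
  move=> jn; have h0 : 0 <= j%:R / n%:R :> R by rewrite divr_ge0.
  have h1 : j%:R / n%:R <= 1 :> R by rewrite ler_pdivrMr // mul1r ler_nat -ltnS.
  by rewrite /xs; apply/andP; split; nra.
exists n.+1, xs, (bern u n); split=> //.
- by move=> j r /u01; exact: bern_ge0.
- exact: bern_sum0.
move=> f L L0 Lf r rI; have := u01 r rI; set v := u.[r] => /andP[v0 v1].
pose b j := (bern u n j).[r].
have b0 j : 0 <= b j by apply: bern_ge0; exact: u01.
have S0 : \sum_(j < n.+1) b j = 1 by have := congr1 (horner^~ r) (bern_sum0 u n); rewrite horner_sum hornerC.
have hn (m : nat) : (m%:R : {poly R}).[r] = m%:R by rewrite -[m%:R]polyC_natr hornerC.
have S1 : \sum_(j < n.+1) b j * j%:R = n%:R * v.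
  have := congr1 (horner^~ r) (bern_sum1 u n); rewrite horner_sum hornerM hn -/v => <-.
  by apply: eq_bigr => j _; rewrite hornerM hn.
have S2 : \sum_(j < n.+1) b j * j%:R ^+ 2 = n%:R * v * (1 - v) + (n%:R * v) ^+ 2.
  have := congr1 (horner^~ r) (bern_sum2 u n); rewrite horner_sum.
  rewrite !(hornerD, hornerM, hornerN, hornerC, hn) -/v -expr2 => <-.
  by apply: eq_bigr => j _; rewrite !hornerM !hn.
have rE : r = c + (M - c) * v by rewrite /v uE mulrC mulfVK ?gt_eqF //; ring.
rewrite horner_sum -[f r]mul1r -S0 mulr_suml -sumrB.
apply: le_trans (ler_norm_sum _ _ _) _.
(* The inequality d <= e/2 + d^2/(2e) trades the absolute deviation for its square, whose mean is
   known from the moments. *)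
apply: (@le_trans _ _ (\sum_(j < n.+1) L * (b j * (e / 2 + (2 * e)^-1 * (r - xs j) ^+ 2)))).
  apply: ler_sum => j _; rewrite hornerZ mulrC -mulrBr normrM ger0_norm; last exact: b0.
  rewrite mulrCA; apply: ler_wpM2l; first exact: b0.
  apply: le_trans (Lf _ _ (xsI j (ltn_ord j)) rI) _; apply: ler_wpM2l => //.
  rewrite distrC -[(r - xs j) ^+ 2]real_normK ?num_real //; set d := `|_|.
  have -> : e / 2 + (2 * e)^-1 * d ^+ 2 = d + (2 * e)^-1 * (d - e) ^+ 2.
    by field; rewrite gt_eqF.
  by rewrite lerDl mulr_ge0 ?sqr_ge0 // invr_ge0 mulr_ge0 // ltW.
rewrite -mulr_sumr; apply: ler_wpM2l => //.
rewrite (eq_bigr (fun j : 'I_n.+1 => (e / 2 + (2 * e)^-1 * (M - c) ^+ 2 * v ^+ 2) * b j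
   + (- (2 * e)^-1 * (M - c) ^+ 2 * 2 * v / n%:R) * (b j * j%:R)
   + ((2 * e)^-1 * (M - c) ^+ 2 / n%:R ^+ 2) * (b j * j%:R ^+ 2))); last first.
  by move=> j _; rewrite rE /xs; field; rewrite !gt_eqF.
rewrite !big_split /= -!mulr_sumr S0 S1 S2.
have -> : (e / 2 + (2 * e)^-1 * (M - c) ^+ 2 * v ^+ 2) * 1 +
  - (2 * e)^-1 * (M - c) ^+ 2 * 2 * v / n%:R * (n%:R * v) +
  (2 * e)^-1 * (M - c) ^+ 2 / n%:R ^+ 2 *
  (n%:R * v * (1 - v) + (n%:R * v) ^+ 2) =
  e / 2 + (2 * e)^-1 * ((M - c) ^+ 2 / n%:R) * (v * (1 - v)).
  by field; rewrite !gt_eqF.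
have h1 : (M - c) ^+ 2 / n%:R <= e ^+ 2.
  by rewrite ler_pdivrMr // mulrC -ler_pdivrMr ?exprn_gt0.
have h2 : (2 * e)^-1 * ((M - c) ^+ 2 / n%:R) <= e / 2.
  rewrite ler_pdivrMl ?mulr_gt0 //; apply: le_trans h1 _.
  by apply: le_of_eq; field.
have h3 : 0 <= (2 * e)^-1 * ((M - c) ^+ 2 / n%:R).
  by rewrite mulr_ge0 ?invr_ge0 ?divr_ge0 ?sqr_ge0 ?mulr_ge0 ?ltW // ?ltr0n.
by nra.
Qed.

End Bernstein.

(** * Euler's reflection formula *)

Section HalfLineIntegral.
Context {R : realType}.
Local Notation mu := (@lebesgue_measure R).

Lemma is_derive_continuous (f : R -> R) (x d : R) : is_derive x 1 f d -> {for x, continuous f}.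
Proof. by move=> [df _]; apply/differentiable_continuous/derivable1_diffP. Qed.

Lemma is_derive_expRM (l x : R) : is_derive x 1 (fun u => expR (l * u)) (l * expR (l * x)).
Proof.
have d1 : is_derive x 1 (fun u : R => l * u) l.
  by apply: is_derive_eq; rewrite /GRing.scale /= mulr1.
by have := is_derive1_comp (is_derive_expR _) d1; rewrite /= mulrC.
Qed.

Lemma continuous_expRM (l : R) : continuous (fun u : R => expR (l * u)).
Proof. by move=> x; exact: is_derive_continuous (is_derive_expRM l x). Qed.

Lemma cvgy_expRNM (l : R) : 0 < l -> expR (- l * u) @[u --> +oo] --> 0.
Proof.
move=> l0.
have -> : (fun u => expR (- l * u)) = (fun x => expR (- x)) \o (fun u => l * u).
  by apply/funext => u /=; rewrite mulNr.
apply: (@cvg_comp _ _ _ _ _ _ (pinfty_nbhs R)); last exact: cvgr_expR.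
exact: gt0_cvgMry.
Qed.

Lemma integral_expRN (l : R) : 0 < l ->
  (\int[mu]_(u in `[0%R, +oo[) (expR (- l * u))%:E = (l^-1)%:E)%E.
Proof.
move=> l0; pose F (u : R) : R := - l^-1 * expR (- l * u).
have dF (x : R) : is_derive x 1 F (expR (- l * x)).
  have := is_derive_expRM (- l) x => h.
  by apply: is_derive_eq; rewrite /GRing.scale /=; field; rewrite gt_eqF.
rewrite (@ge0_continuous_FTC2y _ _ F 0 0) //.
- by rewrite /F mulr0 expR0 mulr1 -EFinB sub0r opprK.
- by apply: continuous_subspaceT; exact: continuous_expRM.
- by rewrite -(mulr0 (- l^-1)); apply: cvgM; [exact: cvg_cst | exact: cvgy_expRNM].
- by apply: cvg_at_right_filter; exact: is_derive_continuous (dF 0).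
- by move=> x _; rewrite derive1E; case: (dF x).
Qed.

Definition half_kernel (l u : R) : R := expR (- l * u) / (1 + expR (- u)).

Lemma half_kernel_ge0 l u : 0 <= half_kernel l u.
Proof. by rewrite divr_ge0 ?addr_ge0 ?expR_ge0. Qed.

Lemma continuous_half_kernel l : continuous (half_kernel l).
Proof.
move=> x; apply: cvgM; first exact: continuous_expRM.
apply: cvgV; first by rewrite gt_eqF // addr_gt0 ?expR_gt0.
apply: cvgD; first exact: cvg_cst.
apply: (@continuous_comp _ _ _ (@GRing.opp R) expR); first exact: opp_continuous.
exact: continuous_expR.
Qed.

Lemma measurable_half_kernel (D : set R) l : measurable_fun D (EFin \o half_kernel l).
Proof.
apply/measurable_EFinP; apply: measurable_funTS.
by apply: continuous_measurable_fun; exact: continuous_half_kernel.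
Qed.

(** For l > 0 this is Nielsen's beta function, the sum of (-1)^n / (l + n) over n >= 0. Its values
    at l and 1 - l together give the alternating pole expansion of pi / sin(pi l). *)
Definition half_integral (l : R) : R :=
  fine (\int[mu]_(u in `[0%R, +oo[) (half_kernel l u)%:E)%E.

(** The two kernels add up to e^(-l u), since the factor 1 + e^(-u) cancels. The extended real form
    comes before the real one because finiteness of both integrals is read off from it. *)
Lemma half_integral_rec_ereal l : 0 < l ->
  (\int[mu]_(u in `[0%R, +oo[) (half_kernel l u)%:E +
   \int[mu]_(u in `[0%R, +oo[) (half_kernel (l + 1) u)%:E = (l^-1)%:E)%E.
Proof.
move=> l0; rewrite -ge0_integralD //.
- rewrite -(integral_expRN l0); apply: eq_integral => u _; rewrite -EFinD; congr EFin.
  have E : expR (- (l + 1) * u) = expR (- l * u) * expR (- u).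
    by rewrite -expRD; congr expR; ring.
  by rewrite /half_kernel E; field; rewrite gt_eqF // addr_gt0 ?expR_gt0.
- by move=> u _; rewrite lee_fin half_kernel_ge0.
- exact: measurable_half_kernel.
- by move=> u _; rewrite lee_fin half_kernel_ge0.
- exact: measurable_half_kernel.
Qed.

Lemma half_integral_EFin l : 0 < l ->
  (\int[mu]_(u in `[0%R, +oo[) (half_kernel l u)%:E = (half_integral l)%:E)%E.
Proof.
move=> l0; rewrite /half_integral fineK //.
have h0 m : (0 <= \int[mu]_(u in `[0%R, +oo[) (half_kernel m u)%:E)%E.
  by apply: integral_ge0 => u _; rewrite lee_fin half_kernel_ge0.
rewrite ge0_fin_numE //; apply: (@le_lt_trans _ _ (l^-1)%:E); last by rewrite ltry.
by rewrite -half_integral_rec_ereal // leeDl.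
Qed.

Lemma half_integral_ge0 l : 0 <= half_integral l.
Proof. by apply/fine_ge0/integral_ge0 => u _; rewrite lee_fin half_kernel_ge0. Qed.

Lemma half_integral_rec l : 0 < l -> half_integral l + half_integral (l + 1) = l^-1.
Proof.
move=> l0; have := half_integral_rec_ereal l0.
by rewrite !half_integral_EFin ?addr_gt0 // -EFinD => -[].
Qed.

Lemma half_integral_le l m : 0 < l -> l <= m -> half_integral m <= half_integral l.
Proof.
move=> l0 lm; have m0 := lt_le_trans l0 lm.
rewrite -lee_fin -!half_integral_EFin //; apply: ge0_le_integral => //.
- by move=> u _; rewrite lee_fin half_kernel_ge0.
- exact: measurable_half_kernel.
- exact: measurable_half_kernel.
- move=> u /=; rewrite in_itv /= andbT => u0; rewrite lee_fin ler_pM2r.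
    by rewrite ler_expR !mulNr lerN2 ler_wpM2r.
  by rewrite invr_gt0 addr_gt0 ?expR_gt0.
Qed.

(** After the recurrence, the difference of the two sides is a difference of shifted values, whose
    sign is known by monotonicity. *)
Lemma half_integral_sub l m : 0 < l -> l <= m ->
  half_integral l - half_integral m <= l^-1 - m^-1.
Proof.
move=> l0 lm; have m0 := lt_le_trans l0 lm.
rewrite -!half_integral_rec //.
have : half_integral (m + 1) <= half_integral (l + 1) by rewrite half_integral_le ?addr_gt0 // lerD2r.
by move=> h; rewrite opprD addrACA lerDl subr_ge0.
Qed.

(* Both sides satisfy the same recurrence under a shift by 3 and tend to 0. *)
Lemma half_integral_triple l : 0 < l ->
  half_integral (l / 3) - half_integral ((l + 1) / 3) + half_integral ((l + 2) / 3)
  = 3 * half_integral l.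
Proof.
pose Q x := half_integral (x / 3) - half_integral ((x + 1) / 3) + half_integral ((x + 2) / 3)
  - 3 * half_integral x.
have Q3 x : 0 < x -> Q (x + 3) = - Q x.
  move=> x0; rewrite /Q.
  have x1 : 0 < x + 1 by lra. have x2 : 0 < x + 2 by lra.
  have e0 : (x + 3) / 3 = x / 3 + 1 by field.
  have e1 : (x + 3 + 1) / 3 = (x + 1) / 3 + 1 by field.
  have e2 : (x + 3 + 2) / 3 = (x + 2) / 3 + 1 by field.
  rewrite e0 e1 e2.
  have d3 (y : R) : 0 < y -> 0 < y / 3 by move=> y0; rewrite divr_gt0.
  have := half_integral_rec (d3 _ x0); have := half_integral_rec (d3 _ x1).
  have := half_integral_rec (d3 _ x2).
  have := half_integral_rec x0; have := half_integral_rec x1; have := half_integral_rec x2.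
  rewrite !invf_div.
  have -> : x + 1 + 1 = x + 2 by ring.
  have -> : x + 2 + 1 = x + 3 by ring.
  have -> : 3 / x = 3 * x^-1 by [].
  have -> : 3 / (x + 1) = 3 * (x + 1)^-1 by [].
  have -> : 3 / (x + 2) = 3 * (x + 2)^-1 by [].
  move: x^-1 (x + 1)^-1 (x + 2)^-1 (half_integral _) (half_integral _) (half_integral _)
    (half_integral _) (half_integral _) (half_integral _) (half_integral _) (half_integral _)
    (half_integral _) (half_integral _) => *.
  lra.
have Qn x n : 0 < x -> `|Q x| = `|Q (x + 3 * n%:R)|.
  move=> x0; elim: n => [|n ->]; first by rewrite mulr0 addr0.
  rewrite -[n.+1%:R]natr1 mulrDr mulr1 addrA Q3 ?normrN //.
  by rewrite ltr_wpDr // mulr_ge0.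
(* Each of the four terms of [Q x] is at most 3 / x in absolute value. *)
have Qb x : 0 < x -> `|Q x| <= 12 / x.
  move=> x0; have hb y : 0 < y -> half_integral y <= y^-1.
    by move=> y0; have := half_integral_rec y0; have := half_integral_ge0 (y + 1); lra.
  have h0 := half_integral_ge0.
  have x1 : 0 < x / 3 by lra.
  have m1 : half_integral ((x + 1) / 3) <= half_integral (x / 3) by apply: half_integral_le => //; lra.
  have m2 : half_integral ((x + 2) / 3) <= half_integral (x / 3) by apply: half_integral_le => //; lra.
  have := hb _ x1; have := hb _ x0; rewrite invf_div => b1 b2.
  have b3 : half_integral (x / 3) <= 3 * x^-1 by [].
  rewrite ler_norml /Q.
  move: (h0 (x / 3)) (h0 ((x + 1) / 3)) (h0 ((x + 2) / 3)) (h0 x) m1 m2 b1 b3.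
  move: x^-1 (half_integral _) (half_integral _) (half_integral _) (half_integral _) => *.
  apply/andP; split; lra.
move=> l0; apply/eqP; rewrite -subr_eq0 -/(Q l) -normr_le0; apply/ler_addgt0Pr => e e0.
rewrite add0r; pose n := (Num.truncn (12 / (3 * e))).+1; rewrite (Qn _ n l0).
have nb : 12 / (3 * e) <= n%:R by apply/ltW; exact: truncnS_gt.
have n0 : 0 < n%:R :> R by rewrite ltr0n.
have n1 : 0 < l + 3 * n%:R by rewrite addr_gt0 // mulr_gt0.
apply: le_trans (Qb _ n1) _; rewrite ler_pdivrMr //.
have : 12 <= n%:R * (3 * e) by rewrite -ler_pdivrMr // mulr_gt0.
nra.
Qed.

End HalfLineIntegral.

(** * The cosecant and Herglotz' trick *)

Section EulerReflection.
Context {R : realType}.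

(** The triple angle formula makes cos(pi/3) a root of 4 c^3 - 3 c + 1 = (c + 1) (2 c - 1)^2, and it
    is positive. *)
Lemma cos_pi3 : cos (pi / 3) = 2^-1 :> R.
Proof.
pose y : R := pi / 3; rewrite -/y.
have c3 : 4 * cos y ^+ 3 - 3 * cos y + 1 = 0.
  have : cos (y + y + y) = -1 by rewrite -cospi; congr cos; rewrite /y; field.
  rewrite !cosD !sinD => h.
  have := sin2cos2 y; set c := cos y in h *; set s := sin y in h * => sE.
  have : (c * c - s * s) * c - (s * c + c * s) * s = 4 * c ^+ 3 - 3 * c.
    have -> : (c * c - s * s) * c - (s * c + c * s) * s = c ^+ 3 - 3 * c * s ^+ 2 by ring.
    by rewrite sE; ring.
  by rewrite h => <-; ring.
have c0 : 0 < cos y.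
  apply: cos_gt0_pihalf; have := @pi_gt0 R; rewrite /y => p0; apply/andP; split; lra.
have : (cos y + 1) * (2 * cos y - 1) ^+ 2 = 0 by rewrite -[RHS]c3; ring.
move/eqP; rewrite mulf_eq0 gt_eqF /= ?addr_gt0 // sqrf_eq0 => /eqP h; lra.
Qed.

Lemma sin_triple (y : R) : sin (3 * y) = 3 * sin y - 4 * sin y ^+ 3.
Proof.
have -> : 3 * y = y + y + y by ring.
rewrite !(sinD, cosD); have := cos2sin2 y; set c := cos y; set s := sin y => cE.
have -> : (s * c + c * s) * c + (c * c - s * s) * s = 3 * s * c ^+ 2 - s ^+ 3 by ring.
by rewrite cE; ring.
Qed.

Definition cosec_pi (x : R) : R := pi / sin (pi * x).

Lemma sin_pi_gt0 (x : R) : 0 < x < 1 -> 0 < sin (pi * x).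
Proof.
move=> /andP[x0 x1]; apply: sin_gt0_pi; have := @pi_gt0 R => p0.
by rewrite mulr_gt0 //= gtr_pMr.
Qed.

(** With s = sin(pi x/3), the other two sines have difference s and product 3/4 - s^2, while sin(pi
    x) = 4 s (3/4 - s^2). The alternating sum of reciprocals is then 1/s + s/(3/4 - s^2), which
    collapses to 3 / sin(pi x). *)
Lemma cosec_pi_triple (x : R) : 0 < x < 1 ->
  cosec_pi (x / 3) - cosec_pi ((x + 1) / 3) + cosec_pi ((x + 2) / 3) = 3 * cosec_pi x.
Proof.
move=> /andP[x0 x1].
have p1 : 0 < sin (pi * (x / 3)) by apply: sin_pi_gt0; apply/andP; split; lra.
have p2 : 0 < sin (pi * ((x + 1) / 3)) by apply: sin_pi_gt0; apply/andP; split; lra.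
have p3 : 0 < sin (pi * ((x + 2) / 3)) by apply: sin_pi_gt0; apply/andP; split; lra.
have p4 : 0 < sin (pi * x) by apply: sin_pi_gt0; apply/andP; split; lra.
rewrite /cosec_pi; pose a := pi * (x / 3).
have e2 : sin (pi * ((x + 1) / 3)) = sin a * 2^-1 + cos a * sin (pi / 3).
  by rewrite -cos_pi3 -sinD; congr sin; rewrite /a; field.
have e3 : sin (pi * ((x + 2) / 3)) = - sin a * 2^-1 + cos a * sin (pi / 3).
  have -> : pi * ((x + 2) / 3) = a + (pi - pi / 3) by rewrite /a; field.
  rewrite sinD sinB cosB sinpi cospi cos_pi3; ring.
have e4 : sin (pi * x) = 3 * sin a - 4 * sin a ^+ 3.
  by rewrite -sin_triple; congr sin; rewrite /a; field.
have D2 : sin (pi / 3) ^+ 2 = 3 / 4 :> R by rewrite sin2cos2 cos_pi3; field.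
have k2 := cos2sin2 a.
rewrite -/a in p1 *; rewrite e2 in p2 *; rewrite e3 in p3 *; rewrite e4 in p4 *.
move: p1 p2 p3 p4 k2 D2; set s := sin a; set c := cos a; set d := sin (pi / 3).
move=> p1 p2 p3 p4 k2 D2.
have bc : (s * 2^-1 + c * d) * (- s * 2^-1 + c * d) = 3 / 4 - s ^+ 2.
  have -> : (s * 2^-1 + c * d) * (- s * 2^-1 + c * d) = c ^+ 2 * d ^+ 2 - s ^+ 2 / 4 by field.
  by rewrite k2 D2; field.
have q0 : 0 < 3 / 4 - s ^+ 2 by rewrite -bc mulr_gt0.
have uv : (s * 2^-1 + c * d) - (- s * 2^-1 + c * d) = s by field.
have sub (u v : R) : 0 < u -> 0 < v -> pi / s - pi / u + pi / v = pi / s + pi * (u - v) / (u * v).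
  by move=> u0 v0; field; rewrite !gt_eqF.
rewrite sub // uv.
rewrite bc; have -> : 3 * s - 4 * s ^+ 3 = 4 * (s * (3 / 4 - s ^+ 2)) by field.
have : 3 / 4 - s ^+ 2 + s ^+ 2 = 3 / 4 by ring.
move: (3 / 4 - s ^+ 2) q0 => q q0 qE.
have -> : pi / s + pi * s / q = pi * (q + s ^+ 2) / (s * q) by field; rewrite !gt_eqF.
by rewrite qE; field; rewrite !gt_eqF.
Qed.

Lemma sin_le_id (y : R) : 0 <= y -> sin y <= y.
Proof.
rewrite le_eqVlt => /orP[/eqP <-|y0]; first by rewrite sin0.
have [c _] := @MVT R sin cos 0 y y0 (fun x _ => is_derive_sin x)
   (continuous_subspaceT (@continuous_sin R)).
rewrite sin0 !subr0 => ->.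
by rewrite ler_piMl ?cos_le1 // ltW.
Qed.

Lemma cos_ge_quad (y : R) : 0 <= y -> 1 - y ^+ 2 / 2 <= cos y.
Proof.
move=> y0; have -> : cos y = 1 - 2 * sin (y / 2) ^+ 2.
  have -> : cos y = cos (y / 2 *+ 2) by congr cos; rewrite mulr2n; field.
  by rewrite cos_mulr2n cos2sin2 mulr2n; ring.
have := @sin_le_id (y / 2); rewrite divr_ge0 // => /(_ isT) h.
have [s0|s0] := lerP 0 (sin (y / 2)).
  have : sin (y / 2) ^+ 2 <= (y / 2) ^+ 2 by rewrite ler_pXn2r ?nnegrE // divr_ge0.
  lra.
(* A negative sin(y/2) forces y > 4 because pi >= 2; then 1 - y^2/2 is far below -1 <= cos y. *)
have [y4|y4] := lerP y 4.
  move: s0; rewrite ltNge sin_ge0_pi // divr_ge0 //=.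
  have := @pi_ge2 R; lra.
have := sin2cos2 (y / 2); have := sqr_ge0 (cos (y / 2)) => h1 h2.
have : 16 <= y ^+ 2 by nra.
lra.
Qed.

Lemma sin_ge_cubic (y : R) : 0 <= y -> y <= 1 -> y - y ^+ 3 / 2 <= sin y.
Proof.
rewrite le_eqVlt => /orP[/eqP <-|y0 y1]; first by rewrite sin0 expr0n /= mul0r subrr.
have [c] := @MVT R sin cos 0 y y0 (fun x _ => is_derive_sin x)
   (continuous_subspaceT (@continuous_sin R)).
rewrite sin0 !subr0 in_itv /= => /andP[c0 cy] ->.
have := cos_ge_quad (ltW c0).
have : c ^+ 2 <= y ^+ 2 by rewrite ler_pXn2r ?nnegrE ?ltW.
move=> h1 h2; have : 1 - y ^+ 2 / 2 <= cos c by lra.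
move=> /(ler_wpM2r (ltW y0)); apply: le_trans; by apply: le_of_eq; field.
Qed.

(** With y = pi x, the cubic bound gives (y - sin y) / (y sin y) <= y, so the error is at most pi^2
    x, and pi < 4 explains the 16. *)
Lemma cosec_pi_near0 (x : R) : 0 < x -> x <= 4^-1 -> 0 <= cosec_pi x - x^-1 <= 16 * x.
Proof.
move=> x0 x1; have p2 := @pi_ge2 R; have p4 : pi < 4 :> R by have := @pihalf_lt2 R; lra.
pose y := pi * x; have y0 : 0 < y by rewrite mulr_gt0 // pi_gt0.
have y1 : y <= 1 by rewrite /y; nra.
have s1 := sin_le_id (ltW y0); have s2 := sin_ge_cubic (ltW y0) y1.
have s3 : y / 2 <= sin y.
  apply: le_trans s2; have : y ^+ 3 <= y by rewrite exprS ler_piMr ?exprn_ile1 // ltW.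
  lra.
have s0 : 0 < sin y by lra.
have -> : cosec_pi x - x^-1 = pi * ((y - sin y) / (y * sin y)).
  rewrite /cosec_pi -/y; have -> : x^-1 = pi / y.
    by rewrite /y invfM mulrA divff ?mul1r // gt_eqF // pi_gt0.
  by field; rewrite !gt_eqF.
apply/andP; split.
  apply: mulr_ge0; first exact: pi_ge0.
  by apply: divr_ge0; [rewrite subr_ge0 | apply: mulr_ge0; exact: ltW].
have h : (y - sin y) / (y * sin y) <= y.
  rewrite ler_pdivrMr; last exact: mulr_gt0.
  apply: (@le_trans _ _ (y ^+ 3 / 2)); first lra.
  have -> : y ^+ 3 / 2 = y * (y * (y / 2)) by field.
  by do 2 (apply: ler_wpM2l; first exact: ltW).
apply: le_trans (ler_wpM2l (ltW (pi_gt0 R)) h) _.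
rewrite /y mulrA; apply: ler_wpM2r; [exact: ltW | nra].
Qed.

(** Euler's integral B(l, 1 - l) for 0 < l < 1, in the form of the integral of e^(l u) / (1 + e^u)
    over the line, cut at u = 0. *)
Definition reflection_integral (l : R) : R := half_integral l + half_integral (1 - l).

(** The recurrence writes 1/x as the values at x and x + 1, so the pole cancels and only the values
    at 1 - x and 1 + x remain to be compared. *)
Lemma reflection_integral_near0 (x : R) : 0 < x -> x <= 4^-1 ->
  `|reflection_integral x - x^-1| <= 4 * x.
Proof.
move=> x0 x1; rewrite -(half_integral_rec x0) /reflection_integral.
have -> : half_integral x + half_integral (1 - x) - (half_integral x + half_integral (x + 1)) =
  half_integral (1 - x) - half_integral (1 + x) by rewrite opprD addrACA subrr add0r (addrC x 1).
have p1 : 0 < 1 - x by lra.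
have le1 : 1 - x <= 1 + x by lra.
have := half_integral_le p1 le1; have := half_integral_sub p1 le1 => h1 h2.
rewrite ger0_norm ?subr_ge0 //; apply: le_trans h1 _.
have -> : (1 - x)^-1 - (1 + x)^-1 = (2 * x) / ((1 - x) * (1 + x)) by field; rewrite !gt_eqF //; lra.
rewrite ler_pdivrMr; last by rewrite mulr_gt0 //; lra.
have : 2^-1 <= (1 - x) * (1 + x) by nra.
move: (_ * (1 + x)) => z z2; nra.
Qed.

Lemma reflection_integral_triple (x : R) : 0 < x < 1 ->
  reflection_integral (x / 3) - reflection_integral ((x + 1) / 3) + reflection_integral ((x + 2) / 3)
  = 3 * reflection_integral x.
Proof.
move=> /andP[x0 x1]; have y0 : 0 < 1 - x by lra.
rewrite /reflection_integral mulrDr -(half_integral_triple x0) -(half_integral_triple y0).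
have -> : 1 - x / 3 = (1 - x + 2) / 3 by field.
have -> : 1 - (x + 1) / 3 = (1 - x + 1) / 3 by field.
have -> : 1 - (x + 2) / 3 = (1 - x) / 3 by field.
by move: (half_integral _) (half_integral _) (half_integral _) (half_integral _)
  (half_integral _) (half_integral _) => *; ring.
Qed.

Lemma reflection_integralC x : reflection_integral (1 - x) = reflection_integral x.
Proof. by rewrite /reflection_integral opprB addrC subrKC. Qed.

Lemma cosec_piC x : cosec_pi (1 - x) = cosec_pi x.
Proof.
by rewrite /cosec_pi mulrBr mulr1 sinB sinpi cospi mul0r sub0r mulN1r opprK.
Qed.

(* Herglotz' trick: the difference D of the two sides is bounded, tends to 0
   at 0 and satisfies 3 D(x) = D(x/3) - D((x+1)/3) + D((x+2)/3). *)
Lemma euler_reflection (x : R) : 0 < x < 1 -> reflection_integral x = pi / sin (pi * x).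
Proof.
pose D (x : R) : R := reflection_integral x - cosec_pi x.
have D3 (z : R) : 0 < z < 1 -> 3 * D z = D (z / 3) - D ((z + 1) / 3) + D ((z + 2) / 3).
  move=> z01; rewrite /D mulrBr -reflection_integral_triple // -cosec_pi_triple //.
  by move: (reflection_integral _) (reflection_integral _) (reflection_integral _)
    (cosec_pi _) (cosec_pi _) (cosec_pi _) => *; ring.
have Dnear (z : R) : 0 < z -> z <= 4^-1 -> `|D z| <= 20 * z.
  move=> z0 z1; have := reflection_integral_near0 z0 z1; have := cosec_pi_near0 z0 z1.
  rewrite /D !ler_norml; move: z^-1 (reflection_integral z) (cosec_pi z) => a b c.
  by move=> /andP[? ?] /andP[? ?]; apply/andP; split; lra.
(* A bound is needed for the supremum to exist. The symmetry z -> 1 - z reduces to z <= 1/2; below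
   1/4 the estimate at 0 gives 20 z <= 5, above 1/4 both half integrals are at most 4. *)
have [B DB] : exists B : R, forall z : R, 0 < z < 1 -> `|D z| <= B.
  pose s0 := sin (pi * 4^-1 : R).
  have s00 : 0 < s0 by apply: sin_pi_gt0; apply/andP; split; lra.
  suff [B DB] : exists B : R, forall z : R, 0 < z <= 2^-1 -> `|D z| <= B.
    exists B => z /andP[z0 z1]; have [z2|z2] := lerP z 2^-1; first by apply: DB; rewrite z0.
    rewrite (_ : D z = D (1 - z)); first by apply: DB; apply/andP; split; lra.
    by rewrite /D reflection_integralC cosec_piC.
  exists (13 + pi / s0) => z /andP[z0 z2].
  have ps : 0 <= pi / s0 by rewrite divr_ge0 ?pi_ge0 // ltW.
  have [z4|z4] := lerP z 4^-1; first by apply: le_trans (Dnear _ z0 z4) _; lra.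
  have hJ (y : R) : 4^-1 < y -> 0 <= half_integral y <= 4.
    move=> y4; have y0 : 0 < y by lra.
    rewrite half_integral_ge0 /=; have := half_integral_rec y0.
    have := half_integral_ge0 (y + 1).
    have : y^-1 <= 4 by rewrite invf_ple ?posrE // ltW.
    lra.
  have z1 : 4^-1 < 1 - z by lra.
  have := hJ _ z4; have := hJ _ z1.
  have cz : 0 <= cosec_pi z <= pi / s0.
    have sz : s0 <= sin (pi * z).
      have p0 := pi_gt0 R; rewrite /s0 leNgt ltr_sin ?in_itv /=; last 2 first.
      - by apply/andP; split; nra.
      - by apply/andP; split; lra.
      by rewrite -leNgt ler_pM2l // ltW.
    have sz0 := lt_le_trans s00 sz.
    rewrite /cosec_pi divr_ge0 ?pi_ge0 ?(ltW sz0) //=.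
    by rewrite ler_pM2l ?pi_gt0 // lef_pV2.
  move: cz; rewrite /D /reflection_integral ler_norml.
  move: (cosec_pi z) (half_integral z) (half_integral _) => a b c.
  by move=> /andP[? ?] /andP[? ?] /andP[? ?]; apply/andP; split; lra.
pose E : set R := [set y | exists2 z : R, 0 < z < 1 & y = `|D z|].
have h12 : 0 < (2^-1 : R) < 1 by apply/andP; split; lra.
have supE : has_sup E.
  split; first by exists `|D 2^-1|, 2^-1.
  by exists B => _ [z z01 ->]; exact: DB.
pose m := sup E.
have Dm (z : R) : 0 < z < 1 -> `|D z| <= m by move=> z01; apply: (ub_le_sup supE.2); exists z.
have step (z : R) : 0 < z < 1 -> 3 * `|D z| <= `|D (z / 3)| + 2 * m.
  move=> /andP[z0 z1]; have z01 : 0 < z < 1 by apply/andP.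
  have h1 : `|D ((z + 1) / 3)| <= m by apply: Dm; apply/andP; split; lra.
  have h2 : `|D ((z + 2) / 3)| <= m by apply: Dm; apply/andP; split; lra.
  have -> : 3 * `|D z| = `|3 * D z| by rewrite normrM ger0_norm.
  rewrite D3 //; apply: le_trans (ler_normD _ _) _.
  have := ler_normB (D (z / 3)) (D ((z + 1) / 3)); lra.
(* In terms of the gap to the supremum, [step] says that dividing the argument by 3 at most triples
   the gap. A point that is nearly maximal is thus carried towards 0, where D is small. *)
have iter n (z : R) : 0 < z < 1 -> m - `|D (z / 3 ^+ n)| <= 3 ^+ n * (m - `|D z|).
  move=> z01; elim: n => [|n IHn]; first by rewrite expr0 divr1 mul1r.
  have z3 : 0 < z / 3 ^+ n < 1.
    case/andP: z01 => z0 z1; have p3 : 1 <= 3 ^+ n :> R by rewrite exprn_ege1 // ler1n.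
    have p30 : 0 < 3 ^+ n :> R by rewrite exprn_gt0.
    by rewrite divr_gt0 //= ltr_pdivrMr // mul1r (lt_le_trans z1).
  have := step _ z3; rewrite -mulrA -invfM -exprSr => h.
  rewrite [in leRHS]exprS -mulrA; move: h IHn.
  by move: (3 ^+ n * _) `|D (z / 3 ^+ n)| `|D (z / 3 ^+ n.+1)| => *; lra.
have m0 : m <= 0.
  apply/ler_addgt0Pr => e e0; rewrite add0r.
  (* Then z / 3^n <= 1/4, so the estimate at 0 applies, and it gives at most 20 / 3^n <= e/2. The
     point z is taken within e / (2 * 3^n) of the supremum, which leaves a gap of at most e/2 after
     n steps. *)
  pose n := (Num.truncn (4 + 40 / e)).+1.
  have e40 : 0 < 40 / e by rewrite divr_gt0.
  have hP : 4 + 40 / e <= 3 ^+ n.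
    apply/ltW/(lt_le_trans (truncnS_gt _)); rewrite -natrX ler_nat; exact/ltnW/ltn_expl.
  move: (3 ^+ n) hP (iter n) => P hP iterP.
  have P0 : 0 < P by lra.
  have [_ [z z01 ->] hz] := sup_adherent (divr_gt0 e0 (mulr_gt0 (ltr0n _ 2) P0)) supE.
  have [z0 z1] := andP z01.
  have zP : z / P <= P^-1 by apply: ler_piMl; rewrite ?invr_ge0; exact: ltW.
  have P4 : P^-1 <= 4^-1 by rewrite lef_pV2 ?posrE //; lra.
  have P40 : 20 * P^-1 <= e / 2.
    have -> : e / 2 = 20 * (e / 40) by field.
    by rewrite ler_pM2l // -[e / 40]invrK invf_div lef_pV2 ?posrE //; lra.
  have h1 := Dnear _ (divr_gt0 z0 P0) (le_trans zP P4).
  have h2 := iterP z z01.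
  have h3 : P * (m - `|D z|) <= e / 2.
    have : P * (m - `|D z|) <= P * (e / (2 * P)).
      by rewrite ler_pM2l //; move: hz; rewrite -/m; move: (e / _) `|_| => *; lra.
    by move/le_trans; apply; apply: le_of_eq; field; rewrite gt_eqF.
  move: h1 h2 h3; move: `|D (z / P)| (P * _) => a b; lra.
move=> x01; apply/eqP; rewrite -subr_eq0 -normr_le0 -/(cosec_pi x) -/(D x).
exact: le_trans (Dm _ x01) m0.
Qed.

End EulerReflection.

(** * Scalar means *)

Section WeightedHarmonicIntegral.
Context {R : realType}.
Local Notation mu := (@lebesgue_measure R).

Definition harm_weight (l t : R) : R := t `^ (l - 1) / (1 - t) `^ l.

(** The weighted harmonic mean of 1 and x, that is the inverse of (1 - t) + t / x. *)
Definition harm_fun (t x : R) : R := x / ((1 - t) * x + t).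

Lemma harm_den_gt0 (t x : R) : 0 <= t <= 1 -> 0 < x -> 0 < (1 - t) * x + t.
Proof.
move=> /andP[t0 t1] x0; have [->|tn] := eqVneq t 0; first by rewrite subr0 mul1r addr0.
have tp : 0 < t by rewrite lt0r tn.
by apply: ltr_wpDl => //; apply: mulr_ge0; [rewrite subr_ge0 | exact: ltW].
Qed.

Lemma harm_fun_ge0 (t x : R) : 0 <= t <= 1 -> 0 < x -> 0 <= harm_fun t x.
Proof. by move=> t01 x0; rewrite divr_ge0 // ltW // harm_den_gt0. Qed.

Lemma continuous_harm_weight (l t : R) : 0 < t < 1 -> {for t, continuous (harm_weight l)}.
Proof.
move=> /andP[t0 t1].
have powc (y : R) p : 0 < y -> {for y, continuous (fun z : R => z `^ p)}.
  by move=> y0; exact: is_derive_continuous (is_derive1_powR p y0).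
apply: cvgM; first exact: powc.
apply: cvgV; first by rewrite gt_eqF // powR_gt0 // subr_gt0.
have c1 : {for t, continuous (fun t : R => 1 - t)}.
  by apply: cvgB; [exact: cvg_cst | exact: cvg_id].
have t1' : 0 < 1 - t by rewrite subr_gt0.
exact: (continuous_comp c1 (powc _ l t1')).
Qed.

Lemma continuous_harm_fun (x t : R) : 0 < x -> 0 < t < 1 ->
  {for t, continuous (harm_fun ^~ x)}.
Proof.
move=> x0 /andP[t0 t1]; apply: cvgM; first exact: cvg_cst.
apply: cvgV; first by rewrite gt_eqF // harm_den_gt0 // (ltW t0) (ltW t1).
apply: cvgD; last exact: cvg_id.
by apply: cvgM; [apply: cvgB; [exact: cvg_cst | exact: cvg_id] | exact: cvg_cst].
Qed.

Lemma continuous_harm_integrand (l x t : R) : 0 < x -> 0 < t < 1 ->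
  {for t, continuous (fun t => harm_weight l t * harm_fun t x)}.
Proof.
by move=> x0 t01; apply: cvgM; [exact: continuous_harm_weight | exact: continuous_harm_fun].
Qed.

Lemma measurable_fun_unit_itv (f : R -> R) : (forall t, 0 < t < 1 -> {for t, continuous f}) ->
  measurable_fun (`]0%R, 1%R[%classic : set R) f.
Proof.
move=> cf; apply: open_continuous_measurable_fun; first exact: interval_open.
by move=> t; rewrite inE /= in_itv /=; exact: cf.
Qed.

Lemma measurable_harm_integrand (l x : R) : 0 < x ->
  measurable_fun (`]0%R, 1%R[%classic : set R) (fun t => (harm_weight l t * harm_fun t x)%:E).
Proof.
move=> x0; apply/measurable_EFinP; apply: measurable_fun_unit_itv => t.
exact: continuous_harm_integrand.
Qed.

Lemma harm_weight_ge0 (l t : R) : 0 <= harm_weight l t.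
Proof. by rewrite divr_ge0 ?powR_ge0. Qed.

Lemma harm_integrand_ge0 (l x t : R) : 0 < x -> 0 < t < 1 ->
  0 <= harm_weight l t * harm_fun t x.
Proof.
move=> x0 /andP[t0 t1]; apply: mulr_ge0; first exact: harm_weight_ge0.
by apply: harm_fun_ge0 => //; rewrite (ltW t0) (ltW t1).
Qed.

(* The substitution t = logistic x u turns the weighted integral over ]0, 1[ into
   x^l times an integral over the line that does not depend on x. *)
Definition logistic (x u : R) : R := x * expR u / (1 + x * expR u).

Lemma logistic_den_gt0 (x u : R) : 0 < x -> 0 < 1 + x * expR u.
Proof. by move=> x0; rewrite addr_gt0 // mulr_gt0 // expR_gt0. Qed.

Lemma logistic_itv (x u : R) : 0 < x -> 0 < logistic x u < 1.
Proof.
move=> x0; have d0 := logistic_den_gt0 u x0.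
by rewrite divr_gt0 ?mulr_gt0 ?expR_gt0 //= ltr_pdivrMr // mul1r ltrDr.
Qed.

Lemma is_derive_logistic (x u : R) : 0 < x ->
  is_derive u 1 (logistic x) (x * expR u / (1 + x * expR u) ^+ 2).
Proof.
move=> x0; have d0 := logistic_den_gt0 u x0.
have d1 : is_derive u (1 : R) (fun u : R => x * expR u) (x * expR u).
  by apply: is_derive_eq; rewrite /GRing.scale /=.
have d2 : is_derive u (1 : R) (fun u : R => 1 + x * expR u) (x * expR u).
  by have := is_deriveD (is_derive_cst (1 : R) u (1 : R)) d1; rewrite add0r.
have d3 := @is_deriveV R (fun u : R => 1 + x * expR u) u _ 1 (lt0r_neq0 d0) d2.
have d4 := is_deriveM d1 d3.
rewrite /logistic; apply: (is_derive_eq d4); rewrite /GRing.scale /=.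
by move: (expR u) d0 => y d0; field; rewrite gt_eqF.
Qed.

Lemma continuous_expM (x : R) : continuous (fun u : R => x * expR u).
Proof. by move=> u; apply: cvgM; [exact: cvg_cst | exact: continuous_expR]. Qed.

Lemma continuous_derive_logistic (x : R) : 0 < x -> continuous (logistic x)^`()%classic.
Proof.
move=> x0; have -> : (logistic x)^`()%classic = (fun u => x * expR u / (1 + x * expR u) ^+ 2).
  by apply/funext => u; rewrite derive1E; have [_ ->] := is_derive_logistic u x0.
move=> u; have d0 := logistic_den_gt0 u x0; apply: cvgM; first exact: continuous_expM.
apply: cvgV; first by rewrite gt_eqF // exprn_gt0.
have c1 : {for u, continuous (fun u : R => 1 + x * expR u)}.
  by apply: cvgD; [exact: cvg_cst | exact: continuous_expM].
by rewrite /continuous_at expr2; apply: cvgM.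
Qed.

Lemma logistic_lt (x : R) : 0 < x -> {homo logistic x : u v / u < v}.
Proof.
move=> x0 u v uv; have du := logistic_den_gt0 u x0; have dv := logistic_den_gt0 v x0.
have e : x * expR u < x * expR v by rewrite ltr_pM2l // ltr_expR.
rewrite /logistic ltr_pdivrMr // mulrAC ltr_pdivlMr //.
by move: (x * expR u) (x * expR v) e => a b; nra.
Qed.

Definition logistic_kernel (l u : R) : R := expR (l * u) / (1 + expR u).

Lemma logistic_kernel_ge0 l u : 0 <= logistic_kernel l u.
Proof. by rewrite divr_ge0 ?addr_ge0 ?expR_ge0. Qed.

Lemma continuous_logistic_kernel l : continuous (logistic_kernel l).
Proof.
move=> x; apply: cvgM; first exact: continuous_expRM.
apply: cvgV; first by rewrite gt_eqF // addr_gt0 ?expR_gt0.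
by apply: cvgD; [exact: cvg_cst | exact: continuous_expR].
Qed.

(** For t = [logistic x u] one has t / (1 - t) = x e^u, so the weight equals x^l e^(l u) / t and the
    remaining factors lose their dependence on x. *)
Lemma logistic_substitution (l x u : R) : 0 < x ->
  harm_weight l (logistic x u) * harm_fun (logistic x u) x * (x * expR u / (1 + x * expR u) ^+ 2)
  = x `^ l * logistic_kernel l u.
Proof.
move=> x0; have := logistic_itv u x0; have d0 := logistic_den_gt0 u x0.
set a := logistic x u => /andP[a0 a1]; have b0 : 0 < 1 - a by rewrite subr_gt0.
have e0 := expR_gt0 u; have xe0 : 0 < x * expR u by rewrite mulr_gt0.
have bE : 1 - a = (1 + x * expR u)^-1.
  by rewrite /a /logistic; move: (expR u) d0 => y d0; field; rewrite gt_eqF.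
have aE : a = x * expR u * (1 - a) by rewrite bE.
have wE : harm_weight l a = x `^ l * expR (l * u) / a.
  rewrite /harm_weight powRB; last by rewrite (gt_eqF a0) implybT.
  rewrite powRr1 ?ltW // {1}aE (powRM _ (ltW xe0) (ltW b0)) (powRM _ (ltW x0) (ltW e0)).
  rewrite -[expR u `^ l]expRM (mulrC u l).
  have := powR_gt0 l b0; move: ((1 - a) `^ l) (x `^ l) (expR _) => p q r p0.
  by field; rewrite !gt_eqF.
rewrite wE /harm_fun /logistic_kernel bE {1 2}/a /logistic.
move: (x `^ l) (expR (l * u)) (expR u) e0 d0 xe0 => q r y y0 d0 xe0.
by field; rewrite !gt_eqF //; lra.
Qed.

(** The positive half-line carries exponent 1 - l, since e^(l u) / (1 + e^u) = e^(-(1 - l) u) / (1 +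
    e^(-u)); reflection turns the negative half-line into the one with exponent l. *)
Lemma integral_logistic_kernel (l : R) : 0 < l < 1 ->
  (\int[mu]_u (logistic_kernel l u)%:E = (reflection_integral l)%:E)%E.
Proof.
move=> /andP[l0 l1]; have l1' : 0 < 1 - l by rewrite subr_gt0.
have ml D : measurable_fun D (EFin \o logistic_kernel l).
  apply/measurable_EFinP; apply: measurable_funTS.
  by apply: continuous_measurable_fun; exact: continuous_logistic_kernel.
have -> : [set: R] = `]-oo, 0%R] `|` `]0%R, +oo[.
  by apply/seteqP; split=> // u _ /=; rewrite !in_itv /= andbT; case: (lerP u 0) => _; [left | right].
rewrite ge0_integral_setU //=; last 3 first.
- exact: ml.
- by move=> u _; rewrite lee_fin logistic_kernel_ge0.
- apply/disj_setPS => u [] /=; rewrite !in_itv /= andbT => u0 u1.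
  by have := lt_le_trans u1 u0; rewrite ltxx.
transitivity ((half_integral l)%:E + (half_integral (1 - l))%:E)%E; last by rewrite -EFinD.
congr (_ + _)%E.
  rewrite -(half_integral_EFin l0).
  have := @ge0_integration_by_substitutionNy R (logistic_kernel l) 0; rewrite oppr0 => ->.
  - by apply: eq_integral => u _; congr EFin; rewrite /logistic_kernel /half_kernel /= mulrN mulNr.
  - by apply: continuous_subspaceT; exact: continuous_logistic_kernel.
  - by move=> u _; exact: logistic_kernel_ge0.
rewrite -(half_integral_EFin l1') (integral_itv_obnd_cbnd (ml `]0%R, +oo[%classic)).
apply: eq_integral => u _; congr EFin; rewrite /logistic_kernel /half_kernel.
have -> : expR (- (1 - l) * u) = expR (l * u) * expR (- u) by rewrite -expRD; congr expR; ring.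
rewrite expRN; have := expR_gt0 u; move: (expR u) => y y0.
by field; rewrite gt_eqF //; apply/andP; split => //; lra.
Qed.

(** The integrand may be singular at both ends of the interval. The substitution is therefore made
    on [-n, n] and its image, and monotone convergence passes to the limit on both sides. *)
Lemma integral_harm_weight (l x : R) : 0 < l < 1 -> 0 < x ->
  (\int[mu]_(t in `]0%R, 1%R[) (harm_weight l t * harm_fun t x)%:E
   = (pi / sin (pi * l) * x `^ l)%:E)%E.
Proof.
move=> l01 x0; pose G t := harm_weight l t * harm_fun t x.
pose FF (n : nat) : set R := `[logistic x (- n%:R), logistic x n%:R]%classic.
pose NN (n : nat) : set R := `[(- n%:R), n%:R]%classic.
have FE : \bigcup_n FF n = `]0%R, 1%R[%classic.
  apply/seteqP; split=> t /=.
    move=> [n _]; rewrite /FF /= !in_itv /= => /andP[h1 h2].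
    have /andP[h3 _] := logistic_itv (- n%:R) x0; have /andP[_ h4] := logistic_itv n%:R x0.
    by rewrite (lt_le_trans h3 h1) (le_lt_trans h2 h4).
  rewrite in_itv /= => /andP[t0 t1]; have t1' : 0 < 1 - t by rewrite subr_gt0.
  pose u := ln (t / ((1 - t) * x)).
  have tE : t = logistic x u.
    rewrite /logistic /u lnK ?posrE ?divr_gt0 ?mulr_gt0 //.
    by field; rewrite !gt_eqF //; lra.
  exists (Num.truncn `|u|).+1 => //; rewrite /FF /= in_itv /= tE.
  have nu := truncnS_gt `|u|; set n := _.+1 in nu *.
  have := nu; rewrite ltr_norml => /andP[u1 u2].
  by rewrite !ltW // logistic_lt.
have NE : \bigcup_n NN n = [set: R].
  apply/seteqP; split=> // u _; exists (Num.truncn `|u|).+1 => //; rewrite /NN /= in_itv /=.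
  by have := truncnS_gt `|u|; set n := _.+1; rewrite ltr_norml => /andP[u1 u2]; rewrite !ltW.
have sub n : (\int[mu]_(t in FF n) (G t)%:E =
              \int[mu]_(u in NN n) (x `^ l * logistic_kernel l u)%:E)%E.
  rewrite integration_by_substitution_increasing //.
  - apply: eq_integral => u _; congr EFin; rewrite -logistic_substitution //=.
    by congr (_ * _); rewrite derive1E; have [_ ->] := is_derive_logistic u x0.
  - by rewrite -subr_ge0 opprK addr_ge0.
  - by move=> u v _ _; exact: logistic_lt.
  - by move=> u _; exact: continuous_derive_logistic.
  - by apply: cvgP; apply: cvg_at_right_filter; exact: continuous_derive_logistic.
  - by apply: cvgP; apply: cvg_at_left_filter; exact: continuous_derive_logistic.
  - split.
    + by move=> u _; case: (is_derive_logistic u x0).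
    + by apply: cvg_at_right_filter; exact: is_derive_continuous (is_derive_logistic _ x0).
    + by apply: cvg_at_left_filter; exact: is_derive_continuous (is_derive_logistic _ x0).
  - apply: continuous_in_subspaceT => t; rewrite inE /= in_itv /= => /andP[h1 h2].
    have /andP[h3 _] := logistic_itv (- n%:R) x0; have /andP[_ h4] := logistic_itv n%:R x0.
    by apply: continuous_harm_integrand => //; rewrite (lt_le_trans h3 h1) (le_lt_trans h2 h4).
have lhs : (\int[mu]_(t in FF n) (G t)%:E @[n --> \oo] --> \int[mu]_(t in `]0%R, 1%R[) (G t)%:E)%E.
  rewrite -FE; apply: ge0_nondecreasing_set_cvg_integral.
  - move=> m n mn; apply/subsetPset => t; rewrite /FF /NN /= !in_itv /= => /andP[h1 h2].
    have mono u v : u <= v -> logistic x u <= logistic x v.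
      by rewrite le_eqVlt => /orP[/eqP -> //|uv]; apply/ltW/logistic_lt.
    apply/andP; split; [apply: le_trans h1 | apply: (le_trans h2)]; apply: mono;
      rewrite ?lerN2 ler_nat //.
  - by move=> n; exact: measurable_itv.
  - move=> n; apply: measurable_funS (measurable_harm_integrand l x0) => //.
    by rewrite -FE; exact: bigcup_sup.
  - move=> n t tF; rewrite lee_fin; apply: harm_integrand_ge0 => //.
    have : (\bigcup_n FF n) t by exists n.
    by rewrite FE /= in_itv.
have xl0 : 0 <= x `^ l := powR_ge0 x l.
have mk : measurable_fun [set: R] (EFin \o logistic_kernel l).
  by apply/measurable_EFinP; apply: continuous_measurable_fun; exact: continuous_logistic_kernel.
have rhs : (\int[mu]_(u in NN n) (x `^ l * logistic_kernel l u)%:E @[n --> \oo] -->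
            \int[mu]_u (x `^ l * logistic_kernel l u)%:E)%E.
  rewrite -NE; apply: ge0_nondecreasing_set_cvg_integral.
  - move=> m n mn; apply/subsetPset => t; rewrite /FF /NN /= !in_itv /= => /andP[h1 h2].
    have mn' : m%:R <= n%:R :> R by rewrite ler_nat.
    by apply/andP; split; [apply: le_trans h1; rewrite lerN2 | apply: (le_trans h2)].
  - by move=> n; exact: measurable_itv.
  - move=> n; apply/measurable_EFinP/measurable_funTS/measurable_funM => //.
    exact/measurable_EFinP.
  - by move=> n t _; rewrite lee_fin mulr_ge0 // logistic_kernel_ge0.
have -> : (\int[mu]_(t in `]0%R, 1%R[) (G t)%:E = \int[mu]_u (x `^ l * logistic_kernel l u)%:E)%E.
  apply: (cvg_unique _ lhs) => //.
  by rewrite (_ : (fun n => _) = fun n => (\int[mu]_(u in NN n) (x `^ l * logistic_kernel l u)%:E)%E) //;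
    apply/funext.
under eq_integral do rewrite EFinM.
rewrite ge0_integralZl_EFin //; last by move=> u _; rewrite lee_fin logistic_kernel_ge0.
by rewrite integral_logistic_kernel // euler_reflection // -EFinM mulrC.
Qed.

End WeightedHarmonicIntegral.

(** * Integrals of powers and uniform Lipschitz bounds *)

Section LogarithmicMean.
Context {R : realType}.
Local Notation mu := (@lebesgue_measure R).

Lemma powR_expR (x t : R) : 0 < x -> x `^ t = expR (ln x * t).
Proof. by move=> x0; rewrite /powR gt_eqF // mulrC. Qed.

Definition pow_primitive (x t : R) : R := if x == 1 then t else x `^ t / ln x.

Lemma is_derive_pow_primitive (x t : R) : 0 < x -> is_derive t 1 (pow_primitive x) (x `^ t).
Proof.
move=> x0; rewrite powR_expR //; have [->|x1] := eqVneq x 1.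
  have -> : pow_primitive 1 = id by apply/funext => u; rewrite /pow_primitive eqxx.
  by rewrite ln1 mul0r expR0; exact: is_derive_id.
have -> : pow_primitive x = (fun u : R => (ln x)^-1 * expR (ln x * u)).
  by apply/funext => u; rewrite /pow_primitive (negPf x1) powR_expR // mulrC.
have l0 : ln x != 0 by rewrite ln_eq0.
have h := is_derive_expRM (ln x) t.
by apply: is_derive_eq; rewrite /GRing.scale /= mulrA mulVf // mul1r.
Qed.

Lemma pow_primitive01 (x : R) : 0 < x -> pow_primitive x 1 - pow_primitive x 0 = log_mean_fun x.
Proof.
move=> x0; rewrite /pow_primitive /log_mean_fun; case: eqP => _; first by rewrite subr0.
by rewrite powRr1 ?ltW // powRr0 -mulrBl.
Qed.

Lemma continuous_powRr (x : R) : 0 < x -> continuous (fun t : R => x `^ t).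
Proof.
move=> x0; have -> : (fun t : R => x `^ t) = (fun t => expR (ln x * t)).
  by apply/funext => t; rewrite powR_expR.
exact: continuous_expRM.
Qed.

Lemma integral_powRr (x : R) : 0 < x ->
  (\int[mu]_(t in `[0%R, 1%R]) (x `^ t)%:E = (log_mean_fun x)%:E)%E.
Proof.
move=> x0; rewrite (@continuous_FTC2 _ _ (pow_primitive x)) //.
- by rewrite -EFinB pow_primitive01.
- by apply: continuous_subspaceT; exact: continuous_powRr.
- split.
  + by move=> t _; case: (is_derive_pow_primitive t x0).
  + by apply: cvg_at_right_filter; exact: is_derive_continuous (is_derive_pow_primitive _ x0).
  + by apply: cvg_at_left_filter; exact: is_derive_continuous (is_derive_pow_primitive _ x0).
- by move=> t _; rewrite derive1E; have [_ ->] := is_derive_pow_primitive t x0.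
Qed.

Lemma telescope_nth (f : R -> R) (a b : R) (s : seq R) :
  \sum_(i < size s) (f (nth b s i) - f (nth b (a :: s) i)) = f (last a s) - f a.
Proof.
elim: s a => [|h s IHs] a; first by rewrite big_ord0 subrr.
by rewrite big_ord_recl /= IHs addrC subrKA.
Qed.

(** By the mean value theorem each subinterval contributes its length times x^xi to the exact
    integral, with xi within [d] of the tag. The bound depends on x only through [L], which makes it
    usable over a whole spectrum. *)
Lemma riemann_sum_powR (x L d : R) (s : seq R) (c : nat -> R) : 0 < x -> 0 <= L ->
  (forall t u, 0 <= t <= 1 -> 0 <= u <= 1 -> `|x `^ t - x `^ u| <= L * `|t - u|) ->
  itv_partition 0 1 s ->
  (forall i, (i < size s)%N ->
     nth 1 (0 :: s) i <= c i <= nth 1 s i /\ nth 1 s i - nth 1 (0 :: s) i < d) ->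
  `|\sum_(i < size s) (nth 1 s i - nth 1 (0 :: s) i) * x `^ (c i) - log_mean_fun x| <= L * d.
Proof.
move=> x0 L0 Lx sP cP; have [pth /eqP lst] := sP.
have inc i : (i < size s)%N -> nth 1 (0 :: s) i < nth 1 s i by move=> isz; apply: (pathP 1 pth).
have n0 i : (i < (size s).+1)%N -> 0 <= nth 1 (0 :: s) i <= 1.
  by move=> isz; rewrite (itv_partition_nth_ge isz sP) (itv_partition_nth_le isz sP).
have -> : log_mean_fun x = \sum_(i < size s)
    (pow_primitive x (nth 1 s i) - pow_primitive x (nth 1 (0 :: s) i)).
  by rewrite telescope_nth lst pow_primitive01.
rewrite -sumrB.
apply: le_trans (ler_norm_sum _ _ _) _.
have -> : L * d = \sum_(i < size s) (nth 1 s i - nth 1 (0 :: s) i) * (L * d).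
  by rewrite -mulr_suml (telescope_nth id) lst subr0 mul1r.
apply: ler_sum => i _; have isz := ltn_ord i; have ii := inc _ isz.
have [xi xiI ->] := MVT ii (fun t _ => is_derive_pow_primitive t x0)
   (continuous_subspaceT (fun t => is_derive_continuous (is_derive_pow_primitive t x0))).
have [cI di] := cP i isz.
rewrite [_ * (_ - _)]mulrC -mulrBr normrM gtr0_norm ?subr_gt0 //.
rewrite ler_pM2l ?subr_gt0 //.
have lo := n0 i (ltnW isz); have := n0 i.+1 isz => /= hi.
move: xiI; rewrite in_itv /= => /andP[x1 x2]; have [c1 c2] := andP cI.
move: lo hi => /andP[lo _] /andP[_ hi].
apply: le_trans (Lx _ _ _ _) _.
- by rewrite (le_trans lo c1) (le_trans c2 hi).
- by rewrite (le_trans lo (ltW x1)) (le_trans (ltW x2) hi).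
apply: ler_wpM2l => //; apply: (le_trans _ (ltW di)).
by rewrite ler_norml; apply/andP; split; lra.
Qed.

(** Tagged partitions of arbitrarily small mesh exist; otherwise a condition on all fine partitions
    could hold vacuously and would not determine a limit. *)
Lemma uniform_partition (d : R) : 0 < d -> exists (s : seq R) (c : nat -> R),
  [/\ itv_partition 0 1 s, forall i, (i < size s)%N -> 0 <= c i <= 1 &
  forall i, (i < size s)%N ->
     nth 1 (0 :: s) i <= c i <= nth 1 s i /\ nth 1 s i - nth 1 (0 :: s) i < d].
Proof.
move=> d0; pose n := (Num.truncn d^-1).+1.
have nd : d^-1 < n%:R := truncnS_gt _.
have n0 : 0 < n%:R :> R by rewrite ltr0n.
pose s : seq R := mkseq (fun i => i.+1%:R / n%:R) n.
have sz : size s = n by rewrite size_mkseq.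
have ns i : (i < n)%N -> nth 1 s i = i.+1%:R / n%:R by move=> ni; rewrite nth_mkseq.
have ns0 i : (i < n)%N -> nth 1 (0 :: s) i = i%:R / n%:R.
  by case: i => [|i] ni; [rewrite mul0r | rewrite /= ns // ltnW].
have ltn i : i%:R / n%:R < i.+1%:R / n%:R :> R by rewrite ltr_pM2r ?invr_gt0 // ltr_nat.
exists s, (nth 1 s); split.
- split.
    by apply/(pathP 1) => i; rewrite sz => ni; rewrite ns0 // ns.
  by rewrite (last_nth 1) sz /= ns // divff // gt_eqF.
- move=> i; rewrite sz => ni; rewrite ns // divr_ge0 //= ler_pdivrMr // mul1r ler_nat //.
- move=> i; rewrite sz => ni; rewrite ns // ns0 // lexx andbT ltW //; split=> //.
  rewrite -mulrBl -natrB // subSnn mul1r.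
  by rewrite -[d]invrK ltf_pV2 ?posrE ?invr_gt0.
Qed.

(** The derivative is t (1/z)^(1 - t) with 0 <= 1 - t <= 2 and 1/z <= 1/c. Enlarging the base to 1 +
    1/c >= 1 makes the power monotone in its exponent, whence the square. The range of t includes
    the exponents 1/2 and -1/2. *)
Lemma powR_lipschitz_base (c M t : R) : 0 < c -> `|t| <= 1 ->
  forall r s, c <= r <= M -> c <= s <= M ->
    `|r `^ t - s `^ t| <= (1 + c^-1) ^+ 2 * `|r - s|.
Proof.
move=> c0 t1.
suff lt r s : c <= r -> r < s -> `|r `^ t - s `^ t| <= (1 + c^-1) ^+ 2 * `|r - s|.
  move=> r s /andP[cr _] /andP[cs _]; have [rs|rs|->] := ltgtP r s.
  - exact: lt.
  - by rewrite distrC (distrC r); exact: lt.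
  - by rewrite !subrr normr0 mulr0.
move=> cr rs; have r0 := lt_le_trans c0 cr.
have [||z] := @MVT R (fun z => z `^ t) (fun z => t * z `^ (t - 1)) r s rs.
- by move=> z; rewrite in_itv /= => /andP[rz _]; apply: is_derive1_powR; exact: lt_trans rz.
- apply: continuous_in_subspaceT => z; rewrite inE /= in_itv /= => /andP[rz _].
  exact: is_derive_continuous (is_derive1_powR t (lt_le_trans r0 rz)).
rewrite in_itv /= => /andP[rz zs] e.
rewrite distrC e normrM (distrC r); apply: ler_wpM2r => //.
have z0 := lt_trans r0 rz.
rewrite normrM (ger0_norm (powR_ge0 _ _)) -[leRHS]mul1r; apply: ler_pM => //; first exact: powR_ge0.
have ci : 0 < c^-1 by rewrite invr_gt0.
have -> : z `^ (t - 1) = z^-1 `^ (1 - t).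
  by rewrite -[z^-1]powR_inv1 ?ltW // -powRrM mulN1r opprB.
have t2 := t1; move: t2; rewrite ler_norml => /andP[t2 t3].
apply: (@le_trans _ _ ((1 + c^-1) `^ (1 - t))).
  apply: ge0_ler_powR; rewrite ?nnegrE ?subr_ge0 ?invr_ge0 ?(ltW z0) ?addr_ge0 ?(ltW ci) //.
  apply: (@le_trans _ _ c^-1); last by rewrite lerDr.
  by rewrite lef_pV2 ?posrE // (le_trans cr) // ltW.
rewrite -powR_mulrn ?addr_ge0 ?(ltW ci) //; apply: ler_powR; first by rewrite lerDl ltW.
by lra.
Qed.

(** The derivative in the exponent is ln x * x^z: |ln x| is controlled by its values at [c] and [M],
    and x^z <= (1 + M)^z <= 1 + M. *)
Lemma powR_lipschitz_exponent (c M : R) : 0 < c -> c <= M -> exists2 L, 0 <= L &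
  forall x t u, c <= x <= M -> 0 <= t <= 1 -> 0 <= u <= 1 -> `|x `^ t - x `^ u| <= L * `|t - u|.
Proof.
move=> c0 cM; have M0 := lt_le_trans c0 cM.
exists ((`|ln c| + `|ln M|) * (1 + M)); first by apply: mulr_ge0; apply: addr_ge0 => //; exact: ltW.
move=> x.
suff lt t u : c <= x <= M -> 0 <= t -> u <= 1 -> t < u ->
    `|x `^ t - x `^ u| <= (`|ln c| + `|ln M|) * (1 + M) * `|t - u|.
  move=> t u xI /andP[t0 t1] /andP[u0 u1]; have [tu|tu|->] := ltgtP t u.
  - exact: lt.
  - by rewrite distrC (distrC t); exact: lt.
  - by rewrite !subrr normr0 mulr0.
move=> /andP[cx xM] t0 u1 tu; have x0 := lt_le_trans c0 cx.
have dp (z : R) : is_derive z 1 (fun z : R => x `^ z) (ln x * x `^ z).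
  have -> : (fun z : R => x `^ z) = (fun z => expR (ln x * z)).
    by apply/funext => y; rewrite powR_expR.
  by rewrite powR_expR //; exact: is_derive_expRM.
have [z] := MVT tu (fun z _ => dp z) (continuous_subspaceT (fun z => is_derive_continuous (dp z))).
rewrite in_itv /= => /andP[tz zu] e.
rewrite distrC e normrM (distrC t); apply: ler_wpM2r => //.
rewrite normrM (ger0_norm (powR_ge0 _ _)); apply: ler_pM => //; first exact: powR_ge0.
  have l1 : ln c <= ln x by rewrite ler_ln ?posrE.
  have l2 : ln x <= ln M by rewrite ler_ln ?posrE.
  have := ler_norm (- ln c); have := ler_norm (ln M); rewrite normrN => h1 h2.
  have := normr_ge0 (ln c); have := normr_ge0 (ln M) => h3 h4.
  by rewrite ler_norml; apply/andP; split; lra.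
apply: (@le_trans _ _ ((1 + M) `^ z)).
  apply: ge0_ler_powR; rewrite ?nnegrE ?addr_ge0 ?(ltW M0) ?(ltW x0) ?(le_trans t0 (ltW tz)) //.
  by rewrite (le_trans xM) // lerDr.
by apply: ler1_powR; [rewrite lerDl ltW | exact: le_trans (ltW zu) u1].
Qed.

(** Riemann sums of t -> x^t are convex combinations of powers, so they inherit the constant of the
    powers, and it survives in the limit. This avoids differentiating (x - 1) / ln x near x = 1. *)
Lemma log_mean_lipschitz (c M : R) : 0 < c -> c <= M ->
  forall r s, c <= r <= M -> c <= s <= M ->
    `|log_mean_fun r - log_mean_fun s| <= (1 + c^-1) ^+ 2 * `|r - s|.
Proof.
move=> c0 cM r s rI sI; have [L L0 hL] := powR_lipschitz_exponent c0 cM.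
apply/ler_addgt0Pr => e e0.
have d0 : 0 < e / (2 * (L + 1)) by rewrite divr_gt0 ?mulr_gt0 ?ltr_wpDl.
have [p [z [pP z01 zP]]] := uniform_partition d0.
have pos y : c <= y <= M -> 0 < y by move=> /andP[cy _]; exact: lt_le_trans cy.
have app y : c <= y <= M ->
    `|\sum_(i < size p) (nth 1 p i - nth 1 (0 :: p) i) * y `^ (z i) - log_mean_fun y| <= e / 2.
  move=> yI; apply: le_trans (riemann_sum_powR (pos _ yI) L0 _ pP zP) _.
    by move=> t u; exact: hL.
  have -> : L * (e / (2 * (L + 1))) = (e / 2) * (L / (L + 1)).
    by field; rewrite gt_eqF // ltr_wpDl.
  by apply: ler_piMr; rewrite ?ler_pdivrMr ?mul1r ?lerDl ?ltr_wpDl // divr_ge0 // ltW.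
have pth : path <%O 0 p by case: pP.
have diff : `|\sum_(i < size p) (nth 1 p i - nth 1 (0 :: p) i) * r `^ (z i) -
   \sum_(i < size p) (nth 1 p i - nth 1 (0 :: p) i) * s `^ (z i)| <= (1 + c^-1) ^+ 2 * `|r - s|.
  rewrite -sumrB; apply: le_trans (ler_norm_sum _ _ _) _.
  have S1 : \sum_(i < size p) (nth 1 p i - nth 1 (0 :: p) i) = 1.
    by rewrite (telescope_nth id); case: pP => _ /eqP ->; rewrite subr0.
  set K := _ * `|r - s|.
  have -> : K = \sum_(i < size p) (nth 1 p i - nth 1 (0 :: p) i) * K.
    by rewrite -mulr_suml S1 mul1r.
  apply: ler_sum => i _; rewrite -mulrBr normrM.
  have inc : nth 1 (0 :: p) i < nth 1 p i by apply: (pathP 1 pth).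
  rewrite gtr0_norm ?subr_gt0 // ler_pM2l ?subr_gt0 //.
  apply: (powR_lipschitz_base c0 _ rI sI).
  by have /andP[z0 z1] := z01 i (ltn_ord i); rewrite ger0_norm.
move: (app _ rI) (app _ sI) diff; rewrite !ler_norml.
move: (\sum_(i < _) _) (\sum_(i < _) _) (log_mean_fun r) (log_mean_fun s) (_ * `|_|) => *.
by lra.
Qed.

(** The difference is t (r - s) divided by the two denominators, each of which is at least c / (1 +
    c), the inverse of 1 + 1/c. *)
Lemma harm_fun_lipschitz (c M t : R) : 0 < c -> 0 <= t <= 1 ->
  forall r s, c <= r <= M -> c <= s <= M ->
    `|harm_fun t r - harm_fun t s| <= (1 + c^-1) ^+ 2 * `|r - s|.
Proof.
move=> c0 t01 r s /andP[cr _] /andP[cs _].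
have [t0 t1] := andP t01.
have dl y : c <= y -> (1 + c^-1)^-1 <= (1 - t) * y + t.
  move=> cy; have -> : (1 + c^-1)^-1 = c / (1 + c) by field; rewrite !gt_eqF //; lra.
  rewrite ler_pdivrMr ?addr_gt0 //.
  have h1 : (1 - t) * c <= (1 - t) * y by apply: ler_wpM2l; rewrite ?subr_ge0.
  have : c <= ((1 - t) * c + t) * (1 + c) by nra.
  move/le_trans; apply; apply: ler_wpM2r; [lra | by rewrite lerD2r].
have k0 : 0 < 1 + c^-1 by rewrite addr_gt0 ?invr_gt0.
have ki : 0 < (1 + c^-1)^-1 by rewrite invr_gt0.
have p1 := lt_le_trans ki (dl _ cr); have p2 := lt_le_trans ki (dl _ cs).
have -> : harm_fun t r - harm_fun t s =
    t * (((1 - t) * r + t)^-1 * ((1 - t) * s + t)^-1) * (r - s).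
  by rewrite /harm_fun; field; rewrite !gt_eqF.
rewrite normrM; apply: ler_wpM2r => //.
have v1 : ((1 - t) * r + t)^-1 <= 1 + c^-1 by rewrite invf_ple ?posrE // dl.
have v2 : ((1 - t) * s + t)^-1 <= 1 + c^-1 by rewrite invf_ple ?posrE // dl.
have w1 : 0 <= ((1 - t) * r + t)^-1 by rewrite invr_ge0 ltW.
have w2 : 0 <= ((1 - t) * s + t)^-1 by rewrite invr_ge0 ltW.
rewrite ger0_norm ?mulr_ge0 // -[leRHS]mul1r; apply: ler_pM => //; first exact: mulr_ge0.
by rewrite expr2; apply: ler_pM.
Qed.

End LogarithmicMean.

(** * Self-adjoint operators and functional calculus *)

Section ScalarTheory.
Context {R : realType} {k : scalar_kind}.
Local Notation K := (scalar_field R k).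

Lemma of_realD : {morph (@of_real R k) : x y / x + y}.
Proof. by case: k => x y //=; rewrite rmorphD. Qed.

Lemma of_realM : {morph (@of_real R k) : x y / x * y}.
Proof. by case: k => x y //=; rewrite rmorphM. Qed.

Lemma of_real1 : @of_real R k 1 = 1. Proof. by case: k. Qed.

Lemma of_real0 : @of_real R k 0 = 0. Proof. by case: k. Qed.

Lemma of_realN : {morph (@of_real R k) : x / - x}.
Proof. by case: k => x //=; rewrite rmorphN. Qed.

Lemma ler_of_real (x y : R) : (of_real x <= of_real y :> K) = (x <= y).
Proof. by case: k => //=; rewrite lecR. Qed.

Lemma ltr_of_real (x y : R) : (of_real x < of_real y :> K) = (x < y).
Proof. by case: k => //=; rewrite ltcR. Qed.

Lemma norm_of_real (x : R) : `|of_real x : K| = of_real `|x|.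
Proof.
case: k => //=; rewrite normc_def /=.
by congr (_ %:C)%C; rewrite -[RHS]sqrtr_sqr; congr Num.sqrt; rewrite -[RHS]addr0; congr (_ + _); exact: expr0n.
Qed.

Lemma sre_of_real (x : R) : sre (of_real x : K) = x.
Proof. by case: k. Qed.

Lemma ge0_of_real (z : K) : 0 <= z -> z = of_real (sre z).
Proof.
move: z; case: k => //= z; rewrite lecE /= => /andP[/eqP h _].
by case: z h => a b /= ->.
Qed.

Lemma sreD : {morph (@sre R k) : x y / x + y}.
Proof. by case: k => // -[a b] [c d]. Qed.

Lemma sreZ (r : R) (z : K) : sre (of_real r * z) = r * sre z.
Proof. by move: z; case: k => // -[a b] /=; rewrite mul0r subr0. Qed.

Lemma sre_conj (z : K) : sre (sconj z) = sre z.
Proof. by move: z; case: k => // -[a b]. Qed.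

Lemma sre_ge0 (z : K) : 0 <= z -> 0 <= sre z.
Proof. by move=> z0; move: (z0); rewrite {1}(ge0_of_real z0) -of_real0 ler_of_real. Qed.

End ScalarTheory.

Lemma sre_dotC (R : realType) (k : scalar_kind)
    (H : completeNormedModType (scalar_field R k))
    (dot : {dot H for (@sconj R k)}) (x y : H) :
  sre (dot x y) = sre (dot y x).
Proof.
case: k H dot x y => H dot x y.
  by have := @hermC R false idfun _ dot x y; rewrite expr0 mul1r => ->.
have := @hermC _ false (@conjc R) _ dot x y; rewrite expr0 mul1r => ->.
by rewrite (@sre_conj R ComplexScalars).
Qed.

(** * The real inner product and norm *)

Section RealInner.
Context {R : realType} {k : scalar_kind}.
Context {H : completeNormedModType (scalar_field R k)}.
Context (dot : {dot H for (@sconj R k)}).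
Hypothesis Hdot : is_hilbert dot.

(** Real parts turn both scalar fields into one real inner product space; all later estimates are
    made with real numbers in it. *)
Definition rdot (x y : H) : R := sre (dot x y).
Definition rsc (r : R) (x : H) : H := of_real r *: x.
Definition nrm (x : H) : R := sre `|x|.


Lemma rdotC x y : rdot x y = rdot y x.
Proof. exact: sre_dotC. Qed.

Lemma rdotDl x y z : rdot (x + y) z = rdot x z + rdot y z.
Proof. by rewrite /rdot linearDl sreD. Qed.

Lemma rdotZl r x y : rdot (rsc r x) y = r * rdot x y.
Proof. by rewrite /rdot /rsc linearZl_LR sreZ. Qed.

Lemma rdot_nrm x : rdot x x = nrm x ^+ 2.
Proof.
rewrite /rdot Hdot /nrm.
have h := ge0_of_real (normr_ge0 x).
by rewrite {1}h expr2 -of_realM sre_of_real expr2.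
Qed.

Lemma nrm_ge0 x : 0 <= nrm x. Proof. exact: sre_ge0. Qed.

Lemma normE x : `|x| = of_real (nrm x).
Proof. exact: ge0_of_real. Qed.

Lemma op_norm_leP (A : H -> H) (c : R) : op_norm_le A c <-> forall x, nrm (A x) <= c * nrm x.
Proof.
by split=> h x; have := h x; rewrite !normE -of_realM ler_of_real.
Qed.

Lemma rdotDr x y z : rdot x (y + z) = rdot x y + rdot x z.
Proof. by rewrite rdotC rdotDl !(rdotC x). Qed.

Lemma rdotZr r x y : rdot x (rsc r y) = r * rdot x y.
Proof. by rewrite rdotC rdotZl (rdotC x). Qed.

Lemma rdot0l y : rdot 0 y = 0.
Proof. by have := rdotDl 0 0 y; rewrite addr0 => h; lra. Qed.

Lemma rdotNl x y : rdot (- x) y = - rdot x y.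
Proof. by have := rdotDl x (- x) y; rewrite subrr rdot0l => h; lra. Qed.

Lemma rdotNr x y : rdot x (- y) = - rdot x y.
Proof. by rewrite rdotC rdotNl (rdotC x). Qed.

Lemma rdot0r y : rdot y 0 = 0. Proof. by rewrite rdotC rdot0l. Qed.

Definition rdotE := (rdotDl, rdotDr, rdotNl, rdotNr, rdotZl, rdotZr, rdot0l, rdot0r).

Lemma nrm_eq0 x : nrm x = 0 -> x = 0.
Proof. by move=> h; apply/normr0_eq0; rewrite normE h of_real0. Qed.

Lemma nrm0 : nrm 0 = 0.
Proof. by rewrite /nrm normr0 -(@of_real0 R k) sre_of_real. Qed.

Lemma nrmZ r x : nrm (rsc r x) = `|r| * nrm x.
Proof. by rewrite {1}/nrm /rsc normrZ norm_of_real sreZ. Qed.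

Lemma nrmD x y : nrm (x + y) <= nrm x + nrm y.
Proof. by rewrite -(@ler_of_real R k) of_realD -!normE ler_normD. Qed.

Lemma nrmN x : nrm (- x) = nrm x. Proof. by rewrite /nrm normrN. Qed.

Lemma nrmB x y : nrm (x - y) = nrm (y - x). Proof. by rewrite -nrmN opprB. Qed.

Lemma nrm_complete (u : nat -> H) :
  (forall e, 0 < e -> exists N, forall m n, (N <= m)%N -> (N <= n)%N ->
     nrm (u m - u n) <= e) ->
  exists l, forall e, 0 < e -> exists N, forall n, (N <= n)%N -> nrm (u n - l) <= e.
Proof.
move=> cu.
have: cvgn u.
  apply/cauchy_cvgP/cauchy_ballP => e e0.
  have ee := ge0_of_real (ltW e0).
  have e0' : 0 < sre e by rewrite -(@ltr_of_real R k) of_real0 -ee.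
  have [|N hN] := cu (sre e / 2); first by rewrite divr_gt0.
  near_simpl; exists ([set n | (N <= n)%N], [set n | (N <= n)%N]); first by split; exists N.
  move=> [m n] [/= Nm Nn]; rewrite -ball_normE /= normE ee ltr_of_real.
  apply: (le_lt_trans (hN _ _ Nm Nn)); lra.
move=> /cvg_ex[l hl]; exists l => e e0.
have := (@cvgrPdist_le _ _ _ _ _ _ _).1 hl (of_real e).
rewrite -(@of_real0 R k) ltr_of_real => /(_ _ e0) [N _ hN].
by exists N => n Nn; have := hN n Nn; rewrite /= normE ler_of_real nrmB.
Qed.

End RealInner.

(** * Symmetric forms and coercive operators *)

Section Operators.
Context {R : realType} {k : scalar_kind}.
Context {H : completeNormedModType (scalar_field R k)}.
Context (dot : {dot H for (@sconj R k)}).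
Hypothesis Hdot : is_hilbert dot.
Local Notation rdot := (rdot dot).
Local Notation rdotE := (rdotE dot).
Implicit Types (T S : H -> H) (x y : H).

Lemma lin_add T : linear T -> {morph T : x y / x + y}.
Proof. by move=> lT x y; have := lT 1 x y; rewrite !scale1r. Qed.

Lemma lin0 T : linear T -> T 0 = 0.
Proof. by move=> lT; have := lin_add lT 0 0; rewrite addr0 => /eqP; rewrite -subr_eq subrr => /eqP. Qed.

Lemma lin_scale T a x : linear T -> T (a *: x) = a *: T x.
Proof. by move=> lT; have := lT a x 0; rewrite (lin0 lT) !addr0. Qed.

Lemma lin_rsc T r x : linear T -> T (rsc r x) = rsc r (T x).
Proof. exact: lin_scale. Qed.

Lemma lin_opp T : linear T -> {morph T : x / - x}.
Proof. by move=> lT x; rewrite -scaleN1r lin_scale // scaleN1r. Qed.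

Lemma lin_sub T : linear T -> {morph T : x y / x - y}.
Proof. by move=> lT x y; rewrite lin_add // lin_opp. Qed.

Lemma lin_sum T n (f : 'I_n -> H) : linear T -> T (\sum_i f i) = \sum_i T (f i).
Proof. by move=> lT; apply: (big_morph T (lin_add lT) (lin0 lT)). Qed.

Definition opsym T := forall x y, rdot (T x) y = rdot x (T y).

(** The bound is strictly positive so that one can divide by it, and symmetry is that of the real
    form. *)
Definition selfadjoint T := [/\ linear T, exists2 c, 0 < c & forall x, nrm (T x) <= c * nrm x & opsym T].

Lemma selfadjointP T c : linear T -> (forall x, nrm (T x) <= c * nrm x) -> opsym T ->
  selfadjoint T.
Proof.
move=> lT bT sT; split=> //; exists (`|c| + 1); first by rewrite ltr_pwDr.
move=> x; apply: le_trans (bT x) _; apply: ler_wpM2r; first exact: nrm_ge0.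
by rewrite (le_trans (ler_norm _)) // lerDl.
Qed.

Lemma positive_selfadjoint T : positive_operator dot T -> selfadjoint T.
Proof.
move=> [[lT [c bT]] sT _]; apply: (@selfadjointP T c) => // [|x y].
  exact/op_norm_leP.
by congr sre; exact: sT.
Qed.

(** The form at x + s y is a nonnegative quadratic polynomial in s. It may be only semidefinite, so
    a vanishing leading coefficient is a case of its own. *)
Lemma cauchy_schwarz_form T x y : linear T -> opsym T -> (forall z, 0 <= rdot (T z) z) ->
  rdot (T x) y ^+ 2 <= rdot (T x) x * rdot (T y) y.
Proof.
move=> lT sT pT.
have h s : 0 <= rdot (T x) x + 2 * s * rdot (T x) y + s ^+ 2 * rdot (T y) y.
  have := pT (x + rsc s y); rewrite (lin_add lT) (lin_rsc _ _ lT) !rdotE.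
  rewrite (sT y x) (rdotC _ y (T x)).
  by move/le_trans; apply; apply: le_of_eq; ring.
set a := rdot (T x) x in h *; set b := rdot (T x) y in h *; set c := rdot (T y) y in h *.
have c0 : 0 <= c by exact: pT.
have [c1|] := ltrP 0 c.
  have := h (- b / c); have -> : a + 2 * (- b / c) * b + (- b / c) ^+ 2 * c = (a * c - b ^+ 2) / c.
    by field; rewrite gt_eqF.
  by rewrite pmulr_lge0 ?invr_gt0 // subr_ge0.
move=> c1; have {}c1 : c = 0 by apply/eqP; rewrite eq_le c1.
have [->|b0] := eqVneq b 0; first by rewrite c1 mulr0 expr0n.
(* The polynomial is now affine in s with slope 2 b; this s would give it the value -1. *)
have := h (- (a + 1) / (2 * b)); rewrite c1 mulr0 addr0.
have -> : a + 2 * (- (a + 1) / (2 * b)) * b = -1 by field.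
by rewrite ler0N1.
Qed.

Lemma cauchy_schwarz x y : rdot x y ^+ 2 <= rdot x x * rdot y y.
Proof.
by apply: (@cauchy_schwarz_form idfun) => // z; rewrite (rdot_nrm Hdot) sqr_ge0.
Qed.

Lemma rdot_le_nrm x y : `|rdot x y| <= nrm x * nrm y.
Proof.
rewrite -(@ler_pXn2r _ 2) ?nnegrE ?normr_ge0 ?mulr_ge0 ?nrm_ge0 //.
by rewrite real_normK ?num_real // exprMn -!(rdot_nrm Hdot) cauchy_schwarz.
Qed.

(** Cauchy-Schwarz for the form of [T] at x and T x: |T x|^4 <= <T x, x> <T T x, T x> <= <T x, x> c
    |T x|^2. It turns a lower bound on the norm of T x into coercivity. *)
Lemma positive_form_bound T c x : linear T -> opsym T -> (forall z, 0 <= rdot (T z) z) ->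
    (forall z, nrm (T z) <= c * nrm z) ->
  nrm (T x) ^+ 2 <= c * rdot (T x) x.
Proof.
move=> lT sT pT bT.
have h := cauchy_schwarz_form x (T x) lT sT pT.
rewrite (rdot_nrm Hdot) in h.
have h2 : rdot (T (T x)) (T x) <= c * nrm (T x) ^+ 2.
  apply: le_trans (ler_norm _) _; apply: le_trans (rdot_le_nrm _ _) _.
  by rewrite expr2 mulrA ler_wpM2r ?nrm_ge0.
have [->|n0] := eqVneq (nrm (T x)) 0.
  have [c0|c0] := lerP 0 c; first by rewrite expr0n mulr_ge0.
  have := bT x; have := nrm_ge0 (T x) => t0 t1.
  have x0 : nrm x = 0 by have := nrm_ge0 x; nra.
  by rewrite (nrm_eq0 x0) (lin0 lT) rdot0l mulr0 expr0n.
have n1 : 0 < nrm (T x) ^+ 2 by rewrite exprn_gt0 // lt0r n0 nrm_ge0.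
rewrite -(ler_pM2l n1) -expr2; apply: le_trans h _.
apply: le_trans (ler_wpM2l (pT x) h2) _.
by apply: le_of_eq; ring.
Qed.

Lemma geometric_cauchy (q C : R) (u : nat -> H) : 0 <= q -> q < 1 ->
  (forall n, nrm (u n.+1 - u n) <= q ^+ n * C) ->
  forall e, 0 < e -> exists N, forall m n, (N <= m)%N -> (N <= n)%N ->
     nrm (u m - u n) <= e.
Proof.
move=> q0 q1 hu e e0.
have C0 : 0 <= C by have := hu 0%N; rewrite expr0 mul1r; apply: le_trans; exact: nrm_ge0.
have q1' : 0 < 1 - q by rewrite subr_gt0.
have h n j : nrm (u (n + j)%N - u n) <= C / (1 - q) * (q ^+ n - q ^+ (n + j)).
  elim: j => [|j IHj]; first by rewrite addn0 !subrr nrm0 mulr0.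
  have -> : u (n + j.+1)%N - u n = (u (n + j).+1 - u (n + j)%N) + (u (n + j)%N - u n).
    by rewrite addnS subrKA.
  apply: le_trans (nrmD _ _) _; apply: le_trans (lerD (hu _) IHj) _.
  rewrite addnS exprS le_eqVlt; apply/orP; left; apply/eqP; field.
  by rewrite gt_eqF.
have [N hN] : exists N, 2 * (C / (1 - q)) * q ^+ N <= e.
  have [->|Cn0] := eqVneq C 0; first by exists 0%N; rewrite mul0r mulr0 mul0r ltW.
  have d0 : 0 < e / (2 * (C / (1 - q))) by rewrite divr_gt0 ?mulr_gt0 ?invr_gt0 // lt0r Cn0.
  have q1n : `|q| < 1 by rewrite ger0_norm.
  have [N _ hN] := (@cvgrPdist_le _ _ _ _ _ _ _).1 (cvg_expr q1n) _ d0.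
  exists N; have := hN N (leqnn N); rewrite /= sub0r normrN ger0_norm ?exprn_ge0 //.
  rewrite ler_pdivlMr ?mulr_gt0 ?invr_gt0 ?(lt0r C) ?Cn0 //.
  by rewrite [X in X <= e -> _]mulrC.
have h2 n : (N <= n)%N -> nrm (u n - u N) <= e / 2.
  move=> /subnKC <-; apply: le_trans (h _ _) _.
  have C1 : 0 <= C / (1 - q) by rewrite divr_ge0 // ltW.
  apply: (@le_trans _ _ (C / (1 - q) * q ^+ N)); last by nra.
  by apply: ler_wpM2l => //; rewrite gerBl exprn_ge0.
exists N => m n Nm Nn; rewrite -(subrKA (u N)).
by apply: le_trans (nrmD _ _) _; rewrite [X in _ + X]nrmB; have := h2 _ Nm; have := h2 _ Nn; lra.
Qed.

(* The solution is the fixed point of the contraction x |-> x - tau (T x - y). *)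
Lemma coercive_surjective T c y : selfadjoint T -> 0 < c ->
  (forall x, c * nrm x ^+ 2 <= rdot (T x) x) -> exists x, T x = y.
Proof.
move=> [lT [K0 K00 bK0] sT] c0 cT.
(* Adding [c] ensures c < K, so that the contraction factor is the root of a positive number. *)
pose K := K0 + c; have K1 : 0 < K by rewrite addr_gt0.
have bK x : nrm (T x) <= K * nrm x.
  by apply: le_trans (bK0 x) _; rewrite ler_wpM2r ?nrm_ge0 // lerDl ltW.
(* This minimizes 1 - 2 tau c + tau^2 K^2, the bound for the squared factor; the minimum is 1 - c^2
   / K^2. *)
pose tau := c / K ^+ 2.
pose q := Num.sqrt (1 - c ^+ 2 / K ^+ 2).
have cK : c ^+ 2 / K ^+ 2 < 1.
  by rewrite ltr_pdivrMr ?exprn_gt0 // mul1r ltr_pXn2r ?nnegrE ?ltW // /K ltrDr.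
have cK0 : 0 < c ^+ 2 / K ^+ 2 by rewrite divr_gt0 ?exprn_gt0.
have q0 : 0 <= q by exact: sqrtr_ge0.
have q2 : q ^+ 2 = 1 - c ^+ 2 / K ^+ 2 by rewrite sqr_sqrtr // subr_ge0 ltW.
have q1 : q < 1.
  by rewrite -(@ltr_pXn2r _ 2) ?nnegrE // expr1n q2 ltrBlDr ltrDl.
have contr v : nrm (v - rsc tau (T v)) <= q * nrm v.
  rewrite -(@ler_pXn2r _ 2) ?nnegrE ?mulr_ge0 ?nrm_ge0 // exprMn q2.
  rewrite -(rdot_nrm Hdot) !rdotE (rdotC _ v (T v)) !(rdot_nrm Hdot).
  have h1 := cT v.
  have h2 : nrm (T v) ^+ 2 <= K ^+ 2 * nrm v ^+ 2.
    by rewrite -exprMn ler_pXn2r ?nnegrE ?mulr_ge0 ?nrm_ge0 // ltW.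
  have t0 : 0 < tau by rewrite divr_gt0 ?exprn_gt0.
  have e1 : tau * K ^+ 2 = c by rewrite /tau mulfVK // expf_neq0 // gt_eqF.
  have -> : c ^+ 2 / K ^+ 2 = tau * c by rewrite /tau expr2 mulrAC.
  have := ler_wpM2l (ltW t0) h2; rewrite (mulrA tau (K ^+ 2)) e1 => /(ler_wpM2l (ltW t0)) h3.
  have h4 : tau * (c * nrm v ^+ 2) <= tau * rdot (T v) v by rewrite ler_pM2l.
  lra.
pose u n := iter n (fun x => x - rsc tau (T x - y)) 0.
have uS m : u m.+1 = u m - rsc tau (T (u m) - y) by [].
clearbody u.
have step n : nrm (u n.+1 - u n) <= q ^+ n * nrm (u 1%N - u 0%N).
  elim: n => [|n IHn]; first by rewrite expr0 mul1r.
  have -> : u n.+2 - u n.+1 = (u n.+1 - u n) - rsc tau (T (u n.+1 - u n)).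
    have -> : u n.+2 - u n.+1 = (u n.+1 - rsc tau (T (u n.+1) - y)) - (u n - rsc tau (T (u n) - y)).
      by rewrite -!uS.
    rewrite opprD opprK addrACA (lin_sub lT) /rsc !scalerBr.
    by congr (_ + _); rewrite !opprB addrC subrKA.
  apply: le_trans (contr _) _; rewrite exprS -mulrA; exact: ler_wpM2l.
have cau := geometric_cauchy q0 q1 step.
have [l hl] := nrm_complete cau.
exists l; apply/eqP; rewrite -subr_eq0; apply/eqP/nrm_eq0/eqP.
rewrite eq_le nrm_ge0 andbT; apply/ler_addgt0Pr => e e0; rewrite add0r.
have t0 : 0 < tau by rewrite divr_gt0 ?exprn_gt0.
have [|N1 h1] := hl (e / (2 * K)); first by rewrite divr_gt0 ?mulr_gt0.
have [|N2 h2] := cau (tau * (e / 2)); first by rewrite mulr_gt0 // divr_gt0.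
pose n := maxn N1 N2.
have -> : T l - y = (T (u n) - y) - T (u n - l) by rewrite (lin_sub lT) opprB [RHS]addrC subrKA.
apply: le_trans (nrmD _ _) _; rewrite nrmN.
have := bK (u n - l); have := h1 n (leq_maxl _ _) => h3 h4.
have h5 : nrm (T (u n - l)) <= e / 2.
  apply: le_trans h4 _; rewrite -ler_pdivlMl //; apply: le_trans h3 _.
  by apply: le_of_eq; field; rewrite gt_eqF.
have := h2 n.+1 n (leq_trans (leq_maxr _ _) (leqnSn _)) (leq_maxr _ _).
rewrite uS addrAC subrr add0r nrmN nrmZ gtr0_norm //.
rewrite (ler_pM2l t0) => h6; lra.
Qed.

End Operators.

(** * Invertibility and polynomials of an operator *)

Section PolynomialCalculus.
Context {R : realType} {k : scalar_kind}.
Context {H : completeNormedModType (scalar_field R k)}.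
Context (dot : {dot H for (@sconj R k)}).
Hypothesis Hdot : is_hilbert dot.
Local Notation rdot := (rdot dot).
Local Notation rdotE := (rdotE dot).
Local Notation opsym := (opsym dot).
Local Notation selfadjoint := (selfadjoint dot).
Implicit Types (T S : H -> H) (x y : H) (p q : {poly R}).

Lemma bounded_below_injective T c : linear T -> 0 < c ->
  (forall x, c * nrm x <= nrm (T x)) -> injective T.
Proof.
move=> lT c0 cT x y exy; apply/eqP; rewrite -subr_eq0; apply/eqP/nrm_eq0.
have := cT (x - y); rewrite (lin_sub lT) exy subrr nrm0.
by have := nrm_ge0 (x - y); nra.
Qed.

Lemma invertible_bounded_below T : invertible_operator T ->
  exists2 c, 0 < c & forall x, c * nrm x <= nrm (T x).
Proof.
move=> [S [[_ [c /op_norm_leP bS]] TS ST]].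
exists (`|c| + 1)^-1; first by rewrite invr_gt0 ltr_pwDr.
move=> x; rewrite ler_pdivrMl ?ltr_pwDr // -{1}(TS x).
apply: le_trans (bS _) _; apply: ler_wpM2r; first exact: nrm_ge0.
by rewrite (le_trans (ler_norm _)) // lerDl.
Qed.

Lemma coercive_bounded_below T c : (forall x, c * nrm x ^+ 2 <= rdot (T x) x) ->
  forall x, c * nrm x <= nrm (T x).
Proof.
move=> cT x; have h := le_trans (cT x) (le_trans (ler_norm _) (rdot_le_nrm Hdot _ _)).
have := nrm_ge0 x; rewrite le_eqVlt => /orP[/eqP <-|x0].
  by rewrite mulr0 nrm_ge0.
by rewrite -(ler_pM2r x0) -mulrA -expr2.
Qed.

Lemma coercive_invertible T c : selfadjoint T -> 0 < c ->
  (forall x, c * nrm x ^+ 2 <= rdot (T x) x) -> invertible_operator T.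
Proof.
move=> sT c0 cT; have bT := coercive_bounded_below cT.
have surj y := coercive_surjective Hdot y sT c0 cT.
have [lT _ _] := sT; have iT := bounded_below_injective lT c0 bT.
pose S y := projT1 (cid (surj y)).
have TS y : T (S y) = y by rewrite /S; case: cid.
exists S; split=> //; last by move=> x; apply: iT; rewrite TS.
split.
  by move=> a x y; apply: iT; rewrite lT !TS.
exists c^-1; apply/op_norm_leP => x.
by rewrite ler_pdivlMl // -[in leRHS](TS x).
Qed.

Lemma poly_op_widen p T x n : (size p <= n)%N ->
  poly_op p T x = \sum_(i < n) rsc p`_i (iter i T x).
Proof.
move=> pn; rewrite /poly_op (big_ord_widen n (fun i => of_real p`_i *: iter i T x)) //.
rewrite big_mkcond; apply: eq_bigr => i _; case: ltnP => // /(nth_default 0) ->.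
by rewrite /rsc of_real0 scale0r.
Qed.

Lemma poly_opD p q T x : poly_op (p + q) T x = poly_op p T x + poly_op q T x.
Proof.
pose n := maxn (size p) (size q).
rewrite !(@poly_op_widen _ _ _ n) ?leq_maxl ?leq_maxr ?size_polyD //.
by rewrite -big_split; apply: eq_bigr => i _; rewrite coefD /rsc of_realD scalerDl.
Qed.

Lemma poly_opZ r p T x : poly_op (r *: p) T x = rsc r (poly_op p T x).
Proof.
rewrite (@poly_op_widen _ _ _ (size p)) ?size_scale_leq // /rsc scaler_sumr.
by apply: eq_bigr => i _; rewrite coefZ of_realM scalerA.
Qed.

Lemma poly_op0 T x : poly_op 0 T x = 0.
Proof. by rewrite /poly_op size_poly0 big_ord0. Qed.

Lemma poly_opC c T x : poly_op c%:P T x = rsc c x.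
Proof. by rewrite (@poly_op_widen _ _ _ 1) ?size_polyC_leq1 // big_ord1 coefC. Qed.

Lemma poly_opMX p T x : poly_op (p * 'X) T x = poly_op p T (T x).
Proof.
rewrite (@poly_op_widen _ _ _ (size p).+1); last first.
  by apply: leq_trans (size_polyMleq _ _) _; rewrite size_polyX addnC.
rewrite big_ord_recl coefMX /= /rsc of_real0 scale0r add0r.
by apply: eq_bigr => i _; rewrite coefMX /= -iterSr.
Qed.

Lemma poly_opN p T x : poly_op (- p) T x = - poly_op p T x.
Proof. by rewrite -scaleN1r poly_opZ /rsc of_realN of_real1 scaleN1r. Qed.

Lemma poly_opB p q T x : poly_op (p - q) T x = poly_op p T x - poly_op q T x.
Proof. by rewrite poly_opD poly_opN. Qed.

Lemma poly_opX T x : poly_op 'X T x = T x.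
Proof. by rewrite -['X]mul1r poly_opMX poly_opC /rsc of_real1 scale1r. Qed.

Lemma linear_iter T n : linear T -> linear (iter n T).
Proof. by move=> lT; elim: n => //= n IHn a x y; rewrite /= IHn lT. Qed.

Lemma poly_op_linear p T : linear T -> linear (poly_op p T).
Proof.
move=> lT a x y; rewrite /poly_op scaler_sumr -big_split; apply: eq_bigr => i _ /=.
by rewrite linear_iter // scalerDr !scalerA mulrC.
Qed.

Lemma poly_opM p q T x : linear T -> poly_op (p * q) T x = poly_op p T (poly_op q T x).
Proof.
move=> lT; elim/poly_ind: p q x => [|p c IHp] q x; first by rewrite mul0r !poly_op0.
have comm r z : poly_op r T (T z) = T (poly_op r T z).
  rewrite /poly_op lin_sum //; apply: eq_bigr => i _.
  by rewrite lin_scale // -iterSr.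
rewrite mulrDl -mulrA mul_polyC !poly_opD poly_opMX poly_opC poly_opZ IHp.
by rewrite mulrC poly_opMX comm.
Qed.

Lemma poly_op_comm p q T x : linear T ->
  poly_op p T (poly_op q T x) = poly_op q T (poly_op p T x).
Proof. by move=> lT; rewrite -!poly_opM // mulrC. Qed.

Lemma poly_op_sum n (f : 'I_n -> {poly R}) T x :
  poly_op (\sum_i f i) T x = \sum_i poly_op (f i) T x.
Proof.
by rewrite (big_morph (fun p => poly_op p T x) (fun p q => poly_opD p q T x) (poly_op0 T x)).
Qed.

Lemma poly_op_selfadjoint p T : selfadjoint T -> selfadjoint (poly_op p T).
Proof.
move=> [lT [c c0 bT] sT].
have [b hb] : exists b, forall x, nrm (poly_op p T x) <= b * nrm x.
  elim/poly_ind: p => [|p a [b hb]].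
    by exists 0 => x; rewrite poly_op0 nrm0 mul0r.
  exists (`|b| * c + `|a|) => x; rewrite poly_opD poly_opMX poly_opC mulrDl.
  apply: le_trans (nrmD _ _) _; rewrite nrmZ lerD2r.
  apply: le_trans (hb _) _; apply: (@le_trans _ _ (`|b| * nrm (T x))).
    by apply: ler_wpM2r (ler_norm _); exact: nrm_ge0.
  by rewrite -mulrA ler_wpM2l.
apply: (@selfadjointP _ _ _ _ _ b) => //; first exact: poly_op_linear.
elim/poly_ind: p {b hb} => [|p a IHp] x y; first by rewrite !poly_op0 !rdotE.
by rewrite !poly_opD !poly_opMX !poly_opC !rdotE IHp sT -!(poly_opX T) poly_op_comm.
Qed.

End PolynomialCalculus.

(** * Positivity over the spectrum *)

Section SpectralPositivity.
Context {R : realType} {k : scalar_kind}.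
Context {H : completeNormedModType (scalar_field R k)}.
Context (dot : {dot H for (@sconj R k)}).
Hypothesis Hdot : is_hilbert dot.
Local Notation rdot := (rdot dot).
Local Notation rdotE := (rdotE dot).
Local Notation opsym := (opsym dot).
Local Notation selfadjoint := (selfadjoint dot).
Implicit Types (T S : H -> H) (x y : H) (p q : {poly R}).

Lemma spectrumE T r : spectrum T (of_real r) = ~ invertible_operator (poly_op ('X - r%:P) T).
Proof.
rewrite /spectrum /=; congr (~ invertible_operator _); apply/funext => x.
by rewrite poly_opB poly_opX poly_opC.
Qed.

Lemma invertible_opp T : invertible_operator T -> invertible_operator (fun x => - T x).
Proof.
move=> [S [[lS [c bS]] TS ST]]; exists (fun x => S (- x)); split=> [|x|x].
- split=> [a x y|]; first by rewrite opprD -scalerN lS.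
  by exists c => x; apply: le_trans (bS _) _; rewrite normrN.
- by rewrite opprK TS.
- by rewrite ST opprK.
Qed.

(** For r < m the operator T - r is coercive, and for r > M the operator r - T is; both are then
    invertible. *)
Lemma spectrum_itv T m M r : selfadjoint T ->
  (forall x, m * nrm x ^+ 2 <= rdot (T x) x <= M * nrm x ^+ 2) ->
  spectrum T (of_real r) -> m <= r <= M.
Proof.
move=> sT mM; rewrite spectrumE => nI; apply/andP; split; rewrite leNgt; apply/negP => h; apply: nI.
  apply: (@coercive_invertible _ _ _ _ Hdot _ (m - r)).
  - exact: poly_op_selfadjoint.
  - by rewrite subr_gt0.
  - move=> x; rewrite poly_opB poly_opX poly_opC !rdotE (rdot_nrm Hdot).
    by have /andP[] := mM x; lra.
have -> : poly_op ('X - r%:P) T = (fun x => - poly_op (r%:P - 'X) T x).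
  by apply/funext => x; rewrite -poly_opN opprB.
apply: invertible_opp; apply: (@coercive_invertible _ _ _ _ Hdot _ (r - M)).
- exact: poly_op_selfadjoint.
- by rewrite subr_gt0.
- move=> x; rewrite poly_opB poly_opX poly_opC !rdotE (rdot_nrm Hdot).
  by have /andP[] := mM x; lra.
Qed.

(** A root a + i b exists over the complex numbers. If b is not 0, the remainder of q modulo (X -
    a)^2 + b^2 has degree at most 1 and real coefficients and vanishes at a + i b, so it is 0. *)
Lemma real_poly_factor q : (1 < size q)%N ->
  (exists a, root q a) \/
  (exists a b q', b != 0 /\ q = q' * (('X - a%:P) ^+ 2 + (b ^+ 2)%:P)).
Proof.
move=> sq.
have : size (map_poly (real_complex R) q) != 1%N by rewrite size_map_poly gtn_eqF.
move=> /closed_rootP[[a b] rz].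
have [b0|b0] := eqVneq b 0.
  left; exists a; move: rz; rewrite b0 -[(_ +i* _)%C]/(real_complex R a) /root horner_map /=.
  by rewrite -[0]/(real_complex R 0) (inj_eq (@complexI R)).
right; exists a, b.
pose d : {poly R} := ('X - a%:P) ^+ 2 + (b ^+ 2)%:P.
have sd : size d = 3.
  rewrite size_polyDl size_exp_XsubC // ltnS.
  by apply: leq_trans (size_polyC_leq1 _) _.
have d0 : d != 0 by rewrite -size_poly_gt0 sd.
exists (q %/ d); split=> //.
have := divp_eq q d; rewrite -/d => qE.
suff r0 : q %% d = 0 by rewrite {1}qE r0 addr0.
have := ltn_modp q d; rewrite d0 sd => sr.
move: rz; rewrite /root {1}qE rmorphD rmorphM /= hornerD hornerM.
have -> : (map_poly (real_complex R) d).[(a +i* b)%C] = 0.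
  rewrite /d rmorphD rmorphXn rmorphB /= map_polyX !map_polyC hornerD horner_exp.
  rewrite hornerD hornerN hornerX !hornerC; apply/eqP; rewrite eq_complex /=.
  by apply/andP; split; apply/eqP; rewrite /=; ring.
rewrite mulr0 add0r.
set r := q %% d in sr *.
have -> : r = (r`_0)%:P + (r`_1) *: 'X.
  apply/polyP => i; rewrite coefD coefC coefZ coefX.
  case: i => [|[|i]] /=; rewrite ?mulr0 ?addr0 ?mulr1 ?add0r //.
  by rewrite nth_default // (leq_trans (n := 2)) // -ltnS.
rewrite rmorphD /= map_polyC map_polyZ map_polyX hornerD hornerC hornerZ hornerX.
rewrite eq_complex /= => /andP[/eqP h1 /eqP h2].
have r1 : r`_1 = 0.
  have : r`_1 * b = 0 by rewrite -[RHS]h2; ring.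
  by move/eqP; rewrite mulf_eq0 (negPf b0) orbF => /eqP.
have r0 : r`_0 = 0 by rewrite -[RHS]h1 r1; ring.
by rewrite r0 r1 scale0r addr0.
Qed.

(* A linear factor X - a of q gives an invertible T - a, and an irreducible
   quadratic factor (X - a)^2 + b^2 a coercive operator. *)
Lemma poly_op_bounded_below q T : selfadjoint T -> q != 0 ->
  (forall r, root q r -> ~ spectrum T (of_real r)) ->
  exists2 c, 0 < c & forall x, c * nrm x <= nrm (poly_op q T x).
Proof.
move=> sT; have [lT _ _] := sT.
have prodbb q1 q2 : (exists2 c, 0 < c & forall x, c * nrm x <= nrm (poly_op q1 T x)) ->
    (exists2 c, 0 < c & forall x, c * nrm x <= nrm (poly_op q2 T x)) ->
    exists2 c, 0 < c & forall x, c * nrm x <= nrm (poly_op (q1 * q2) T x).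
  move=> [c c0 hc] [d d0 hd]; exists (c * d); first exact: mulr_gt0.
  move=> x; rewrite poly_opM //; apply: le_trans (hc _).
  by rewrite -mulrA ler_pM2l.
have [n] := ubnP (size q); elim: n q => // n IHn q sq q0 rq.
have [s1|s1] := leqP (size q) 1.
  have := size1_polyC s1; set c := q`_0 => qE.
  have c0 : c != 0 by move: q0; rewrite qE polyC_eq0.
  by exists `|c|; [rewrite normr_gt0 | move=> x; rewrite qE poly_opC nrmZ].
have [[a ra]|[a [b [q' [b0 qE]]]]] := real_poly_factor s1.
  have [q' qE] := factor_theorem _ _ ra.
  have q'0 : q' != 0 by apply: contra_neq q0 => h; rewrite qE h mul0r.
  rewrite qE; apply: prodbb.
    apply: IHn => //.
    - by move: sq; rewrite qE size_Mmonic ?monicXsubC // size_XsubC addn2 ltnS.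
    - by move=> r rr; apply: rq; rewrite qE rootM rr.
  have := rq _ ra; rewrite spectrumE => /contrapT; exact: invertible_bounded_below.
have q'0 : q' != 0 by apply: contra_neq q0 => h; rewrite qE h mul0r.
set d := (_ + _) in qE.
have sd : size d = 3.
  rewrite size_polyDl size_exp_XsubC // ltnS.
  by apply: leq_trans (size_polyC_leq1 _) _.
have d0 : d != 0 by rewrite -size_poly_gt0 sd.
rewrite qE; apply: prodbb.
  apply: IHn => //.
  - by move: sq; rewrite qE size_mul // sd addn3 ltnS; apply: ltn_trans.
  - by move=> r rr; apply: rq; rewrite qE rootM rr.
exists (b ^+ 2); first by rewrite lt0r sqrf_eq0 b0 sqr_ge0.
apply: (coercive_bounded_below Hdot) => x.
rewrite /d poly_opD poly_opC expr2 poly_opM // rdotDl rdotZl (rdot_nrm Hdot).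
have [_ _ ->] := poly_op_selfadjoint ('X - a%:P) sT.
by rewrite lerDr (rdot_nrm Hdot) sqr_ge0.
Qed.

(* With l the infimum of the form of p(T), the operator p(T) - l is positive; if
   p - l had no root in the spectrum it would also be bounded below, hence
   coercive, contradicting the choice of l. *)
Lemma spectrum_lower_bound p T x : selfadjoint T -> (1 < size p)%N -> x != 0 ->
  exists2 r, spectrum T (of_real r) &
    forall y, p.[r] * nrm y ^+ 2 <= rdot (poly_op p T y) y.
Proof.
move=> sT sp x0; have sP q := poly_op_selfadjoint q sT.
have [c c0 bc] : exists2 c, 0 < c & forall x, nrm (poly_op p T x) <= c * nrm x by case: (sP p).
pose E := [set a | forall y, a * nrm y ^+ 2 <= rdot (poly_op p T y) y].
have Ec : E (- c).
  move=> y; have := rdot_le_nrm Hdot (poly_op p T y) y; rewrite ler_norml => /andP[h _].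
  apply: le_trans h; rewrite mulNr lerN2 expr2 mulrA; apply: ler_wpM2r (bc y); exact: nrm_ge0.
have x1 : 0 < nrm x ^+ 2.
  rewrite exprn_gt0 // lt0r nrm_ge0 andbT; apply: contra_neq x0; exact: nrm_eq0.
have Eub a : E a -> a <= rdot (poly_op p T x) x / nrm x ^+ 2.
  by move=> /(_ x); rewrite ler_pdivlMr.
have supE : has_sup E.
  by split; [exists (- c) | exists (rdot (poly_op p T x) x / nrm x ^+ 2) => a /Eub].
pose l := sup E.
have El : E l.
  move=> y; have := nrm_ge0 y; rewrite le_eqVlt => /orP[/eqP y0|y0].
    by rewrite (nrm_eq0 (esym y0)) rdot0r nrm0 expr0n mulr0.
  rewrite -ler_pdivlMr ?exprn_gt0 //; apply: ge_sup => [|a Ea]; first by exists (- c).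
  by rewrite ler_pdivlMr ?exprn_gt0.
pose q := p - l%:P.
have q0 : q != 0.
  apply: contraTneq sp => /eqP; rewrite subr_eq0 => /eqP ->.
  by rewrite -leqNgt size_polyC_leq1.
have qT y : 0 <= rdot (poly_op q T y) y.
  by rewrite /q poly_opB poly_opC !rdotE (rdot_nrm Hdot) subr_ge0.
have [[r rr sr]|nr] := pselect (exists2 r, root q r & spectrum T (of_real r)).
  exists r => // y; suff -> : p.[r] = l by exact: El.
  by move: rr; rewrite /root /q hornerD hornerN hornerC subr_eq0 => /eqP.
have [r rr sr|d d0 hd] := poly_op_bounded_below sT q0.
  by apply: nr; exists r.
have [lq [M M0 bM] sq] := sP q.
(* From d |y| <= |q(T) y| and [positive_form_bound], the form of q(T) is at least d^2 / M times
   |y|^2, so [l] could be increased by that amount. *)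
suff /(ub_le_sup supE.2) : E (l + d ^+ 2 / M).
  by rewrite -/l gerDl leNgt divr_gt0 ?exprn_gt0.
move=> y; rewrite mulrDl -lerBrDl.
apply: (@le_trans _ _ (rdot (poly_op q T y) y)); last first.
  by rewrite /q poly_opB poly_opC !rdotE (rdot_nrm Hdot).
rewrite mulrAC ler_pdivrMr // [leRHS]mulrC.
apply: le_trans (positive_form_bound Hdot y lq sq qT bM).
by rewrite -exprMn ler_pXn2r ?nnegrE ?nrm_ge0 ?mulr_ge0 ?nrm_ge0 // ltW.
Qed.

Lemma poly_op_ge0 p T x : selfadjoint T ->
  (forall r, spectrum T (of_real r) -> 0 <= p.[r]) -> 0 <= rdot (poly_op p T x) x.
Proof.
move=> sT pT; have [->|x0] := eqVneq x 0; first by rewrite rdot0r.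
have [sp|/size1_polyC pE] := ltnP 1 (size p).
  have [r sr /(_ x)] := spectrum_lower_bound sT sp x0.
  by apply: le_trans; rewrite mulr_ge0 ?pT ?sqr_ge0.
(* For constant p the hypothesis says something only if the spectrum has a real point; the
   polynomial X supplies one. *)
have sX : (1 < size ('X : {poly R}))%N by rewrite size_polyX.
have [r /pT + _] := spectrum_lower_bound sT sX x0.
by rewrite pE hornerC poly_opC !rdotE (rdot_nrm Hdot) => p0; rewrite mulr_ge0 ?sqr_ge0.
Qed.

(** Positivity applied to c^2 - p^2, as |p(T) x|^2 is the form of p^2(T) at x. Existence and
    uniqueness in the functional calculus both rest on this bound. *)
Lemma poly_op_norm_le p T c x : selfadjoint T -> 0 <= c ->
  (forall r, spectrum T (of_real r) -> `|p.[r]| <= c) ->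
  nrm (poly_op p T x) <= c * nrm x.
Proof.
move=> sT c0 pT; rewrite -(@ler_pXn2r _ 2) ?nnegrE ?mulr_ge0 ?nrm_ge0 // exprMn.
have [lT _ _] := sT.
have := @poly_op_ge0 ((c ^+ 2)%:P - p * p) T x sT.
rewrite poly_opB poly_opC poly_opM // !rdotE.
have [_ _ ->] := poly_op_selfadjoint p sT; rewrite !(rdot_nrm Hdot) subr_ge0; apply.
move=> r /pT; rewrite hornerD hornerN hornerM hornerC subr_ge0 -expr2 => h.
by rewrite -[leLHS]real_normK ?num_real // ler_pXn2r ?nnegrE.
Qed.

End SpectralPositivity.

(** * Continuous functional calculus *)

Section FunctionalCalculus.
Context {R : realType} {k : scalar_kind}.
Context {H : completeNormedModType (scalar_field R k)}.
Context (dot : {dot H for (@sconj R k)}).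
Hypothesis Hdot : is_hilbert dot.
Local Notation rdot := (rdot dot).
Local Notation rdotE := (rdotE dot).
Local Notation selfadjoint := (selfadjoint dot).
Implicit Types (T S : H -> H) (x y : H) (p q : {poly R}) (f g : R -> R).

(** The specification [is_cfc] with one polynomial per tolerance instead of a sequence, which is
    easier to combine under sums and products. *)
Definition cfc_approx f T S := forall e : R, 0 < e -> exists p : {poly R},
  (forall r, spectrum T (of_real r) -> `|p.[r] - f r| <= e) /\
  (forall x, nrm (poly_op p T x - S x) <= e * nrm x).

Lemma is_cfcP f T S : is_cfc f T S <-> cfc_approx f T S.
Proof.
split.
  move=> [p pf pS] e e0; have [N1 _ h1] := pf e e0; have [N2 _ h2] := pS e e0.
  exists (p (maxn N1 N2)); split; first exact: h1 (leq_maxl _ _).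
  exact/op_norm_leP/(h2 _ (leq_maxr _ _)).
move=> h; have e0 (n : nat) : 0 < n.+1%:R^-1 :> R by rewrite invr_gt0 ltr0n.
have [p hp] := choice (fun n : nat => h _ (e0 n)).
have small (e : R) (n : nat) : 0 < e -> ((Num.truncn e^-1).+1 <= n)%N -> n.+1%:R^-1 <= e.
  move=> e1 en; rewrite invf_ple ?posrE ?ltr0n //; apply/ltW/(lt_le_trans (truncnS_gt _)).
  by rewrite ler_nat ltnW.
exists p => e e1; exists (Num.truncn e^-1).+1 => // n /= nN.
  by move=> r /(hp n).1 hr; apply: le_trans hr _; exact: small.
apply/op_norm_leP => x; apply: le_trans ((hp n).2 x) _; apply: ler_wpM2r; first exact: nrm_ge0.
exact: small.
Qed.

Lemma cfc_approx_eq f g T S : (forall r, spectrum T (of_real r) -> f r = g r) ->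
  cfc_approx f T S -> cfc_approx g T S.
Proof.
by move=> fg h e e0; have [p [h1 h2]] := h e e0; exists p; split=> // r sr; rewrite -fg // h1.
Qed.

Lemma cfc_approx_poly p T : cfc_approx (horner p) T (poly_op p T).
Proof.
move=> e e0; exists p; split=> [r _|x]; first by rewrite subrr normr0 ltW.
by rewrite subrr nrm0 mulr_ge0 ?nrm_ge0 // ltW.
Qed.

Variable (T : H -> H).
Hypothesis sT : selfadjoint T.

(** Not only the approximants that define [S], but every polynomial close to f on the spectrum is
    equally close to [S]: the two polynomials are compared by [poly_op_norm_le]. *)
Lemma cfc_approx_bound f S p e x : cfc_approx f T S -> 0 <= e ->
  (forall r, spectrum T (of_real r) -> `|p.[r] - f r| <= e) ->
  nrm (poly_op p T x - S x) <= e * nrm x.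
Proof.
move=> h e0 pf; apply/ler_addgt0Pr => d d0.
pose d' := d / (2 * (nrm x + 1)).
have x0 := nrm_ge0 x.
have x1 : 0 < nrm x + 1 by rewrite ltr_wpDl.
have d'0 : 0 < d' by rewrite divr_gt0 // mulr_gt0.
have [q [h1 h2]] := h _ d'0.
have h3 : nrm (poly_op (p - q) T x) <= (e + d') * nrm x.
  apply: (poly_op_norm_le Hdot) => //; first by rewrite addr_ge0 // ltW.
  move=> r sr; rewrite hornerD hornerN -(subrKA (f r)).
  by apply: le_trans (ler_normD _ _) _; apply: lerD; [exact: pf | rewrite distrC; exact: h1].
have -> : poly_op p T x - S x = poly_op (p - q) T x + (poly_op q T x - S x).
  by rewrite poly_opB subrKA.
apply: le_trans (nrmD _ _) _; apply: le_trans (lerD h3 (h2 x)) _.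
have : d' * nrm x <= d / 2.
  have -> : d / 2 = d' * (nrm x + 1) by rewrite /d'; field; rewrite gt_eqF.
  by apply: ler_wpM2l; [exact: ltW | rewrite lerDl].
by rewrite mulrDl; move: (d' * _) (e * _) => a b; lra.
Qed.

Lemma cfc_approx_uniq f S S' : cfc_approx f T S -> cfc_approx f T S' -> S = S'.
Proof.
move=> h h'; apply/funext => x; apply/eqP; rewrite -subr_eq0; apply/eqP/nrm_eq0/eqP.
rewrite eq_le nrm_ge0 andbT; apply/ler_addgt0Pr => e e0; rewrite add0r.
have x1 : 0 < nrm x + 1 by rewrite ltr_wpDl // nrm_ge0.
pose d := e / (2 * (nrm x + 1)); have d0 : 0 < d by rewrite divr_gt0 // mulr_gt0.
have [p [h1 h2]] := h _ d0; have h3 := cfc_approx_bound x h' (ltW d0) h1.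
have -> : S x - S' x = (poly_op p T x - S' x) - (poly_op p T x - S x).
  by rewrite opprB [RHS]addrC subrKA.
apply: le_trans (nrmD _ _) _; rewrite nrmN; apply: le_trans (lerD h3 (h2 x)) _.
have -> : e = d * (nrm x + 1) + d * (nrm x + 1) by rewrite /d; field; rewrite gt_eqF.
by apply: lerD; apply: ler_wpM2l; rewrite ?lerDl //; exact: ltW.
Qed.

(** Exhibiting one operator that meets the specification makes the chosen one meet it, and
    uniqueness identifies the two. *)
Lemma cfc_approxE f S : cfc_approx f T S -> cfc f T = S.
Proof.
move=> h; have hS : is_cfc f T S by apply/is_cfcP.
apply: (@cfc_approx_uniq f) => //; apply/is_cfcP.
exact: (xgetPex (fun=> 0) (ex_intro _ S hS)).
Qed.

Lemma cfc_approx_norm f S e x : cfc_approx f T S -> 0 <= e ->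
  (forall r, spectrum T (of_real r) -> `|f r| <= e) -> nrm (S x) <= e * nrm x.
Proof.
move=> h e0 fe; have := @cfc_approx_bound f S 0 e x h e0.
rewrite poly_op0 sub0r nrmN; apply=> r sr.
by rewrite horner0 sub0r normrN; exact: fe.
Qed.

Lemma cfc_approx_add f g S S' : cfc_approx f T S -> cfc_approx g T S' ->
  cfc_approx (fun r => f r + g r) T (fun x => S x + S' x).
Proof.
move=> h h' e e0; have e2 : 0 < e / 2 by rewrite divr_gt0.
have [p [h1 h2]] := h _ e2; have [q [h3 h4]] := h' _ e2.
exists (p + q); split=> [r sr|x].
  rewrite hornerD opprD addrACA [leRHS]splitr; apply: le_trans (ler_normD _ _) _.
  by apply: lerD; [exact: h1 | exact: h3].
rewrite poly_opD opprD addrACA [e]splitr mulrDl; apply: le_trans (nrmD _ _) _.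
by apply: lerD; [exact: h2 | exact: h4].
Qed.

Lemma cfc_approx_scale a f S : cfc_approx f T S ->
  cfc_approx (fun r => a * f r) T (fun x => rsc a (S x)).
Proof.
move=> h e e0; have a1 : 0 < `|a| + 1 by rewrite ltr_wpDl.
have d0 : 0 < e / (`|a| + 1) by rewrite divr_gt0.
have [p [h1 h2]] := h _ d0.
have ae : `|a| * (e / (`|a| + 1)) <= e.
  by rewrite mulrA ler_pdivrMr // mulrC ler_pM2l // lerDl.
exists (a *: p); split=> [r sr|x].
  rewrite hornerZ -mulrBr normrM; apply: le_trans ae.
  by apply: ler_wpM2l => //; exact: h1.
rewrite poly_opZ /rsc -scalerBr -/(rsc a _) nrmZ; apply: (@le_trans _ _ (`|a| * (e / (`|a| + 1) * nrm x))).
  by apply: ler_wpM2l => //; exact: h2.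
by rewrite mulrA; apply: ler_wpM2r => //; exact: nrm_ge0.
Qed.

Lemma cfc_approx_sum n (f : 'I_n -> R -> R) (S : 'I_n -> H -> H) :
  (forall i, cfc_approx (f i) T (S i)) ->
  cfc_approx (fun r => \sum_i f i r) T (fun x => \sum_i S i x).
Proof.
elim: n f S => [|n IHn] f S h.
  have -> : (fun r => \sum_(i < 0) f i r) = horner 0 by apply/funext => r; rewrite big_ord0 horner0.
  have -> : (fun x => \sum_(i < 0) S i x) = poly_op 0 T by apply/funext => x; rewrite big_ord0 poly_op0.
  exact: cfc_approx_poly.
have -> : (fun r => \sum_i f i r) = (fun r => f ord0 r + \sum_i f (lift ord0 i) r).
  by apply/funext => r; rewrite big_ord_recl.
have -> : (fun x => \sum_i S i x) = (fun x => S ord0 x + \sum_i S (lift ord0 i) x).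
  by apply/funext => x; rewrite big_ord_recl.
by apply: cfc_approx_add => //; exact: IHn.
Qed.

(** The specification constrains an arbitrary map [S]; linearity is inherited from the approximating
    polynomials. *)
Lemma cfc_approx_linear f S : cfc_approx f T S -> linear S.
Proof.
move=> h a x y; have [lT _ _] := sT.
apply/eqP; rewrite -subr_eq0; apply/eqP/nrm_eq0/eqP.
rewrite eq_le nrm_ge0 andbT; apply/ler_addgt0Pr => e e0; rewrite add0r.
pose C := nrm (a *: x + y) + sre `|a| * nrm x + nrm y.
have a0 : 0 <= sre `|a| by apply: sre_ge0.
have C0 : 0 <= C by rewrite !addr_ge0 ?mulr_ge0 ?nrm_ge0.
have [p [_ h2]] := h (e / (C + 1)) (divr_gt0 e0 (ltr_wpDl C0 ltr01)).
set d := e / (C + 1) in h2.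
have -> : S (a *: x + y) - (a *: S x + S y) =
  (poly_op p T y - S y) + a *: (poly_op p T x - S x) - (poly_op p T (a *: x + y) - S (a *: x + y)).
  rewrite (poly_op_linear p lT) scalerBr; set u := poly_op p T y; set v := a *: poly_op p T x.
  set u' := S y; set v' := a *: S x; set w := S _.
  by rewrite (addrACA u) -opprD opprB [RHS]addrC (addrC u v) subrKA (addrC u').
have nZ z : nrm (a *: z) = sre `|a| * nrm z.
  rewrite /nrm normrZ {1}(ge0_of_real (normr_ge0 a)).
  by rewrite sreZ.
apply: le_trans (nrmD _ _) _; rewrite nrmN; apply: le_trans (lerD (nrmD _ _) (h2 _)) _.
rewrite nZ; apply: (@le_trans _ _ (d * C)).
  rewrite /C !mulrDr; have := h2 y; have := ler_wpM2l a0 (h2 x).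
  rewrite mulrCA.
  by move: (nrm _) (_ * nrm _) (d * (_ * _)) (d * nrm y) (d * nrm _) => *; lra.
rewrite /d mulrAC ler_pdivrMr ?ltr_wpDl // ler_pM2l // lerDl //.
Qed.

Lemma cfc_approx_selfadjoint f S : cfc_approx f T S -> selfadjoint S.
Proof.
move=> h; have [p1 [_ hp1]] := h 1 ltr01.
have [_ [c c0 bc] _] := poly_op_selfadjoint p1 sT.
apply: (@selfadjointP _ _ _ _ _ (c + 1)); first exact: cfc_approx_linear h.
  move=> x; have -> : S x = poly_op p1 T x - (poly_op p1 T x - S x) by rewrite opprB addrC subrK.
  apply: le_trans (nrmD _ _) _; rewrite nrmN mulrDl; exact: lerD.
move=> x y; apply/eqP; rewrite -subr_eq0 -normr_le0; apply/ler_addgt0Pr => e e0.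
have xy0 : 0 <= nrm x * nrm y by rewrite mulr_ge0 ?nrm_ge0.
pose d := e / (2 * (nrm x * nrm y + 1)).
have d0 : 0 < d by rewrite divr_gt0 // mulr_gt0 // ltr_wpDl.
have [p [_ hp]] := h _ d0; have [_ _ sp] := poly_op_selfadjoint p sT.
have -> : rdot (S x) y - rdot x (S y) =
  rdot x (poly_op p T y - S y) - rdot (poly_op p T x - S x) y.
  by rewrite !rdotE sp; ring.
have b1 : `|rdot x (poly_op p T y - S y)| <= d * (nrm x * nrm y).
  apply: le_trans (rdot_le_nrm Hdot _ _) _; rewrite mulrCA; apply: ler_wpM2l => //; exact: nrm_ge0.
have b2 : `|rdot (poly_op p T x - S x) y| <= d * (nrm x * nrm y).
  apply: le_trans (rdot_le_nrm Hdot _ _) _; rewrite mulrA; apply: ler_wpM2r => //; exact: nrm_ge0.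
rewrite add0r; apply: le_trans (ler_normB _ _) _; apply: le_trans (lerD b1 b2) _.
have -> : e = d * (nrm x * nrm y + 1) + d * (nrm x * nrm y + 1).
  by rewrite /d; field; rewrite gt_eqF // ltr_wpDl.
by apply: lerD; apply: ler_wpM2l; rewrite ?lerDl //; exact: ltW.
Qed.

Lemma cfc_approx_mul f g F G S S' : cfc_approx f T S -> cfc_approx g T S' ->
  (forall r, spectrum T (of_real r) -> `|f r| <= F) ->
  (forall r, spectrum T (of_real r) -> `|g r| <= G) -> 0 <= F -> 0 <= G ->
  cfc_approx (fun r => f r * g r) T (S \o S').
Proof.
move=> h h' fF gG F0 G0 e e0; have [lT _ _] := sT.
have FG : 0 < F + G + 1 by rewrite ltr_wpDl // addr_ge0.
(* The error of a product is at most d (G + d) + F d; with d <= 1 the quadratic term is absorbed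
   into d (F + G + 1). *)
pose d := Num.min 1 (e / (F + G + 1)).
have d0 : 0 < d by rewrite lt_min ltr01 divr_gt0.
have d1 : d <= 1 by rewrite ge_min lexx.
have dFG : d * (F + G + 1) <= e by rewrite -ler_pdivlMr // ge_min lexx orbT.
have key : d * (G + d) + F * d <= e by apply: le_trans dFG; nra.
have [p [h1 h2]] := h _ d0; have [q [h3 h4]] := h' _ d0.
have qb r : spectrum T (of_real r) -> `|q.[r]| <= G + d.
  move=> sr; have -> : q.[r] = g r + (q.[r] - g r) by rewrite addrC subrK.
  by apply: le_trans (ler_normD _ _) _; apply: lerD; [exact: gG | exact: h3].
exists (p * q); split=> [r sr|x].
  have -> : (p * q).[r] - f r * g r = (p.[r] - f r) * q.[r] + f r * (q.[r] - g r).
    by rewrite hornerM; ring.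
  apply: le_trans (ler_normD _ _) _; rewrite !normrM; apply: le_trans key.
  by apply: lerD; apply: ler_pM => //; [exact: h1 | exact: qb | exact: fF | exact: h3].
have lS := cfc_approx_linear h.
have -> : poly_op (p * q) T x - (S \o S') x =
    (poly_op p T (poly_op q T x) - S (poly_op q T x)) + S (poly_op q T x - S' x).
  by rewrite poly_opM // (lin_sub lS) subrKA.
have x0 := nrm_ge0 x.
apply: le_trans (nrmD _ _) _; apply: le_trans (_ : (d * (G + d) + F * d) * nrm x <= _); last exact: ler_wpM2r.
rewrite mulrDl -!mulrA; apply: lerD.
  apply: le_trans (h2 _) _; apply: ler_wpM2l; first exact: ltW.
  by apply: (poly_op_norm_le Hdot) => //; rewrite addr_ge0 // ltW.
apply: le_trans (cfc_approx_norm _ h F0 fF) _; exact: ler_wpM2l.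
Qed.

(** An approximant p satisfies only p >= -d on the spectrum, so positivity is used for p + d, and d
    is then arbitrary. *)
Lemma cfc_approx_ge0 f S x : cfc_approx f T S ->
  (forall r, spectrum T (of_real r) -> 0 <= f r) -> 0 <= rdot (S x) x.
Proof.
move=> h f0; apply/ler_addgt0Pr => e e0.
have x0 : 0 <= nrm x * nrm x by rewrite mulr_ge0 ?nrm_ge0.
have x1 : 0 < nrm x * nrm x + 1 by rewrite ltr_wpDl.
pose d := e / (2 * (nrm x * nrm x + 1)).
have d0 : 0 < d by rewrite divr_gt0 // mulr_gt0.
have [p [h1 h2]] := h _ d0.
have h3 : 0 <= rdot (poly_op (p + d%:P) T x) x.
  apply: (poly_op_ge0 Hdot) => // r sr; rewrite hornerD hornerC.
  by have := h1 r sr; have := f0 r sr; rewrite ler_norml => f1 /andP[? _]; lra.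
have h4 : `|rdot (poly_op p T x - S x) x| <= d * (nrm x * nrm x).
  apply: le_trans (rdot_le_nrm Hdot _ _) _; rewrite mulrA; apply: ler_wpM2r => //; exact: nrm_ge0.
have h5 : 2 * (d * (nrm x * nrm x)) <= e.
  have -> : e = 2 * (d * (nrm x * nrm x + 1)) by rewrite /d; field; rewrite gt_eqF.
  by rewrite ler_pM2l // ler_pM2l // lerDl.
move: h3 h4; rewrite poly_opD poly_opC !rdotE (rdot_nrm Hdot) expr2 ler_norml.
move: h5; move: (d * _) (rdot (S x) x) (rdot _ x) => a b c h5 h3 /andP[_ h4]; lra.
Qed.

Variables (c M : R).
Hypotheses (cM : c < M).
Hypothesis spT : forall r, spectrum T (of_real r) -> c <= r <= M.

Definition lipschitz_itv f L := forall r s, c <= r <= M -> c <= s <= M ->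
  `|f r - f s| <= L * `|r - s|.

(** Existence: Bernstein approximants of f are uniformly Cauchy on the spectrum, hence so are their
    values at [T] in operator norm, and completeness of the space provides the limit. *)
Lemma cfc_lipschitz f L : 0 <= L -> lipschitz_itv f L -> cfc_approx f T (cfc f T).
Proof.
move=> L0 fL; have L1 : 0 < L + 1 by rewrite ltr_wpDl.
have app (e : R) : 0 < e -> exists p : {poly R}, forall r, c <= r <= M -> `|p.[r] - f r| <= e.
  move=> e0; have [n [xs [b [_ _ _ hb]]]] := bernstein_discretization cM (divr_gt0 e0 L1).
  exists (\sum_(j < n) f (xs j) *: b j) => r rI; apply: le_trans (hb f L L0 fL r rI) _.
  by rewrite mulrA ler_pdivrMr // mulrC ler_pM2l // lerDl.
have e0 (n : nat) : 0 < n.+1%:R^-1 :> R by rewrite invr_gt0 ltr0n.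
have [p hp] := choice (fun n : nat => app _ (e0 n)).
have small (e : R) (n : nat) : 0 < e -> ((Num.truncn e^-1).+1 <= n)%N -> n.+1%:R^-1 <= e.
  move=> e1 en; rewrite invf_ple ?posrE ?ltr0n //; apply/ltW/(lt_le_trans (truncnS_gt _)).
  by rewrite ler_nat ltnW.
have cau x e : 0 < e -> exists N, forall m n, (N <= m)%N -> (N <= n)%N ->
    nrm (poly_op (p m) T x - poly_op (p n) T x) <= e * nrm x.
  move=> e1; have e2 : 0 < e / 2 by rewrite divr_gt0.
  exists (Num.truncn (e / 2)^-1).+1 => m n Nm Nn; rewrite -poly_opB.
  apply: (poly_op_norm_le Hdot) => //; first exact: ltW.
  move=> r /spT rI; rewrite hornerD hornerN -(subrKA (f r)) [e]splitr.
  apply: le_trans (ler_normD _ _) _; apply: lerD.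
    exact: le_trans (hp m r rI) (small _ _ e2 Nm).
  by rewrite distrC; exact: le_trans (hp n r rI) (small _ _ e2 Nn).
have lim x : exists l, forall e, 0 < e -> exists N, forall n, (N <= n)%N ->
    nrm (poly_op (p n) T x - l) <= e.
  apply: nrm_complete => e e1; have x1 : 0 < nrm x + 1 by rewrite ltr_wpDl // nrm_ge0.
  have [N hN] := cau x _ (divr_gt0 e1 x1); exists N => m n Nm Nn.
  apply: le_trans (hN _ _ Nm Nn) _; rewrite mulrAC ler_pdivrMr // ler_pM2l // lerDl //.
have [S hS] := choice lim.
suff h : cfc_approx f T S by rewrite (cfc_approxE h).
move=> e e1; pose n := (Num.truncn (e / 2)^-1).+1.
have e2 : 0 < e / 2 by rewrite divr_gt0.
exists (p n); split=> [r /spT rI|x].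
  by apply: le_trans (hp n r rI) _; apply: le_trans (small _ _ e2 (leqnn _)) _; lra.
apply/ler_addgt0Pr => d d0; have [N1 hN1] := hS x d d0.
pose m := maxn N1 n.
rewrite -(subrKA (poly_op (p m) T x)); apply: le_trans (nrmD _ _) _; apply: lerD; last first.
  exact: hN1 (leq_maxl _ _).
rewrite -poly_opB; apply: (poly_op_norm_le Hdot) => //; first exact: ltW.
move=> r /spT rI; rewrite hornerD hornerN -(subrKA (f r)) [e]splitr.
apply: le_trans (ler_normD _ _) _; apply: lerD.
  exact: le_trans (hp n r rI) (small _ _ e2 (leqnn _)).
by rewrite distrC; exact: le_trans (hp m r rI) (small _ _ e2 (leq_maxr _ _)).
Qed.

(* The spectral measure of T at z, seen as a limit of discrete measures that
   is uniform over all functions with a given Lipschitz constant. *)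
Lemma spectral_discretization z e : 0 < e -> exists n (m xs : nat -> R),
  [/\ forall j, 0 <= m j, forall j, (j < n)%N -> c <= xs j <= M &
   forall f L S, 0 <= L -> lipschitz_itv f L -> cfc_approx f T S ->
     `|rdot (S z) z - \sum_(j < n) m j * f (xs j)| <= L * e].
Proof.
move=> e0; have z0 : 0 <= nrm z * nrm z by rewrite mulr_ge0 ?nrm_ge0.
have z1 : 0 < nrm z * nrm z + 1 by rewrite ltr_wpDl.
have [n [xs [b [xsI b0 _ hb]]]] := bernstein_discretization cM (divr_gt0 e0 z1).
(* The weights are the forms of the Bernstein basis polynomials at z, nonnegative because these
   polynomials are nonnegative on [c, M]. *)
exists n, (fun j => rdot (poly_op (b j) T z) z), xs; split=> // [j|f L S L0 fL h].
  by apply: (poly_op_ge0 Hdot) => // r /spT; exact: b0.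
pose p := \sum_(j < n) f (xs j) *: b j.
set d := e / _ in hb; have d0 : 0 < d by rewrite divr_gt0.
have dz : d * (nrm z * nrm z) <= e.
  by rewrite /d mulrAC ler_pdivrMr // ler_pM2l // lerDl.
clearbody d; have -> : rdot (S z) z - \sum_(j < n) rdot (poly_op (b j) T z) z * f (xs j) =
    - rdot (poly_op p T z - S z) z.
  rewrite !rdotE opprB; congr (_ - _); rewrite /p poly_op_sum.
  rewrite (big_morph (rdot^~ z) (fun x y => rdotDl dot x y z) (rdot0l dot z)).
  by apply: eq_bigr => j _; rewrite poly_opZ rdotZl mulrC.
rewrite normrN; apply: le_trans (rdot_le_nrm Hdot _ _) _.
have h1 : nrm (poly_op p T z - S z) <= (L * d) * nrm z.
  apply: (cfc_approx_bound _ h); first by rewrite mulr_ge0 // ltW.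
  by move=> r /spT; exact: hb.
apply: le_trans (ler_wpM2r (nrm_ge0 _) h1) _; rewrite -!mulrA; exact: ler_wpM2l.
Qed.

End FunctionalCalculus.

(** * Means of quadratic functionals *)

Section IntegralByDiscretization.
Context {R : realType}.
Local Notation mu := (@lebesgue_measure R).

(** Transfers a scalar identity, [G x] being the integral of [w t * h t x], to quadratic forms: g(t)
    and y will be the forms of h_t(T) and G(T). The same finite positive combination approximates g
    uniformly in t and approximates y, and the finite mass [W] of the weight keeps the integrated
    error small. *)
Lemma integral_by_discretization (D : set R) (w g : R -> R) (h : R -> R -> R)
    (G : R -> R) (I : R -> Prop) (y W : R) :
  measurable D -> (forall t, D t -> 0 <= w t) -> measurable_fun D w ->
  (\int[mu]_(t in D) (w t)%:E = W%:E)%E ->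
  (forall x, I x -> measurable_fun D (h ^~ x)) ->
  (forall x t, I x -> D t -> 0 <= h t x) ->
  (forall x, I x -> \int[mu]_(t in D) (w t * h t x)%:E = (G x)%:E)%E ->
  (forall t, D t -> 0 <= g t) ->
  (forall e, 0 < e -> exists n (m xs : nat -> R),
    [/\ forall j, 0 <= m j, forall j, (j < n)%N -> I (xs j),
        forall t, D t -> `|g t - \sum_(j < n) m j * h t (xs j)| <= e &
        `|y - \sum_(j < n) m j * G (xs j)| <= e]) ->
  (\int[mu]_(t in D) (w t * g t)%:E = y%:E)%E.
Proof.
move=> mD w0 mw wW mh h0 hG g0 disc.
have W0 : 0 <= W by rewrite -lee_fin -wW; apply: integral_ge0 => t Dt; rewrite lee_fin w0.
have msum n (m xs : nat -> R) : (forall j, (j < n)%N -> I (xs j)) ->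
    measurable_fun D (fun t => \sum_(j < n) m j * h t (xs j)).
  elim: n => [|n IHn] Ix; first by under eq_fun do rewrite big_ord0; exact: measurable_cst.
  under eq_fun do rewrite big_ord_recr /=.
  apply: measurable_funD; first by apply: IHn => j jn; apply: Ix; exact: ltnW.
  by apply: measurable_funM; [exact: measurable_cst | apply: mh; exact: Ix].
(* Measurability of g is not assumed: g is a limit of finite combinations of the measurable
   functions [h ^~ x]. *)
have mg : measurable_fun D g.
  have e0 (n : nat) : 0 < n.+1%:R^-1 :> R by rewrite invr_gt0 ltr0n.
  have disc' (k : nat) : exists s : R -> R, measurable_fun D s /\
      forall t, D t -> `|g t - s t| <= k.+1%:R^-1.
    have [n [m [xs [_ Ix gm _]]]] := disc _ (e0 k).
    by exists (fun t => \sum_(j < n) m j * h t (xs j)); split; [exact: msum | exact: gm].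
  have [s hs] := choice disc'.
  apply: (@measurable_fun_cvg _ _ _ D s g) => [k|t Dt]; first by case: (hs k).
  apply/cvgrPdist_le => e e1; exists (Num.truncn e^-1).+1 => // n /= nN.
  apply: le_trans ((hs n).2 t Dt) _.
  rewrite invf_ple ?posrE ?ltr0n //; apply/ltW/(lt_le_trans (truncnS_gt _)).
  by rewrite ler_nat ltnW.
have mwg : measurable_fun D (EFin \o (fun t => w t * g t)).
  by apply/measurable_EFinP; exact: measurable_funM.
have mwE : measurable_fun D (EFin \o w) by apply/measurable_EFinP.
have int_sum n (m xs : nat -> R) : (forall j, 0 <= m j) -> (forall j, (j < n)%N -> I (xs j)) ->
    (\int[mu]_(t in D) (w t * \sum_(j < n) m j * h t (xs j))%:E =
     (\sum_(j < n) m j * G (xs j))%:E)%E.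
  move=> m0; elim: n => [|n IHn] Ix.
    rewrite big_ord0; under eq_integral do rewrite big_ord0 mulr0.
    exact: integral0.
  have Ix' j : (j < n)%N -> I (xs j) by move=> jn; apply: Ix; exact: ltnW.
  under eq_integral do rewrite big_ord_recr /= mulrDr EFinD.
  rewrite ge0_integralD //.
  - rewrite IHn // big_ord_recr /= EFinD; congr (_ + _)%E.
    under eq_integral do rewrite mulrCA EFinM.
    rewrite ge0_integralZl_EFin //.
    + by rewrite hG ?EFinM //; exact: Ix.
    + by move=> t Dt; rewrite lee_fin mulr_ge0 ?w0 ?h0 //; exact: Ix.
    + by apply/measurable_EFinP; apply: measurable_funM => //; apply: mh; exact: Ix.
  - move=> t Dt; rewrite lee_fin mulr_ge0 ?w0 // sumr_ge0 // => j _.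
    by rewrite mulr_ge0 // h0 //; exact: Ix'.
  - by apply/measurable_EFinP; apply: measurable_funM => //; exact: msum.
  - by move=> t Dt; rewrite lee_fin !mulr_ge0 ?w0 ?h0 //; exact: Ix.
  - apply/measurable_EFinP; apply: measurable_funM => //; apply: measurable_funM => //.
    by apply: mh; exact: Ix.
have int_ew e : 0 <= e -> (\int[mu]_(t in D) (e * w t)%:E = (e * W)%:E)%E.
  move=> e0; under eq_integral do rewrite EFinM.
  by rewrite ge0_integralZl_EFin // wW.
have mew e : measurable_fun D (EFin \o (fun t => e * w t)).
  by apply/measurable_EFinP; apply: measurable_funM.
have W1 : 0 < 1 + W by rewrite ltr_pwDl.
apply/eqP; rewrite eq_le; apply/andP; split; apply/lee_addgt0Pr => e e0.
  (* The error d in y and the error d * W in the integral add up to e. *)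
  have d0 : 0 < e / (1 + W) by rewrite divr_gt0.
  have [n [m [xs [m0 Ix gm ym]]]] := disc _ d0; set d := e / _ in d0 gm ym.
  pose S t := \sum_(j < n) m j * h t (xs j).
  apply: (@le_trans _ _ (\int[mu]_(t in D) ((w t * S t)%:E + (d * w t)%:E))%E).
    apply: ge0_le_integral => //.
    - by move=> t Dt; rewrite lee_fin mulr_ge0 ?w0 ?g0.
    - by apply: emeasurable_funD => //; apply/measurable_EFinP; apply: measurable_funM => //; exact: msum.
    - move=> t Dt; rewrite -EFinD lee_fin (mulrC d) -mulrDr; apply: ler_wpM2l; first exact: w0.
      by have := gm t Dt; rewrite -/(S t) ler_norml; move: (S t) (g t) => a b /andP[? ?]; lra.
  rewrite ge0_integralD //.
  - rewrite int_sum // (int_ew d (ltW d0)) -EFinD lee_fin.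
    have -> : e = d + d * W by rewrite /d; field; rewrite gt_eqF.
    by move: ym; rewrite ler_norml; move: (\sum_(i < _) _) (d * W) => a b /andP[? ?]; lra.
  - move=> t Dt; rewrite lee_fin mulr_ge0 ?w0 // sumr_ge0 // => j _.
    by rewrite mulr_ge0 // h0 //; exact: Ix.
  - by apply/measurable_EFinP; apply: measurable_funM => //; exact: msum.
  - by move=> t Dt; rewrite lee_fin mulr_ge0 ?w0 // ltW.
  - exact: mew.
have d0 : 0 < e / (1 + W) by rewrite divr_gt0.
have [n [m [xs [m0 Ix gm ym]]]] := disc _ d0; set d := e / _ in d0 gm ym.
pose S t := \sum_(j < n) m j * h t (xs j).
have eE : e = d + d * W by rewrite /d; field; rewrite gt_eqF.
apply: (@le_trans _ _ ((\sum_(j < n) m j * G (xs j))%:E + d%:E)%E).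
  rewrite -EFinD lee_fin.
  by move: ym; rewrite ler_norml; move: (\sum_(i < _) _) => a /andP[? ?]; lra.
rewrite {1}eE EFinD addeA [leRHS]addeAC leeD2r //.
rewrite -int_sum // -(int_ew d (ltW d0)) -ge0_integralD //; last 3 first.
- by move=> t Dt; rewrite lee_fin mulr_ge0 ?w0 ?g0.
- by move=> t Dt; rewrite lee_fin mulr_ge0 ?w0 // ltW.
- exact: mew.
apply: ge0_le_integral => //.
- move=> t Dt; rewrite lee_fin mulr_ge0 ?w0 // sumr_ge0 // => j _.
  by rewrite mulr_ge0 // h0 //; exact: Ix.
- by apply/measurable_EFinP; apply: measurable_funM => //; exact: msum.
- by apply: emeasurable_funD; [exact: mwg | exact: mew].
- move=> t Dt; rewrite -EFinD lee_fin (mulrC d) -mulrDr; apply: ler_wpM2l; first exact: w0.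
  by have := gm t Dt; rewrite -/(S t) ler_norml; move: (S t) (g t) => a b /andP[? ?]; lra.
Qed.

End IntegralByDiscretization.

(** * Legendre duality and products in the functional calculus *)

Section QuadraticMeans.
Context {R : realType} {k : scalar_kind}.
Context {H : completeNormedModType (scalar_field R k)}.
Context (dot : {dot H for (@sconj R k)}).
Hypothesis Hdot : is_hilbert dot.
Local Notation rdot := (rdot dot).
Local Notation rdotE := (rdotE dot).
Local Notation opsym := (opsym dot).
Local Notation selfadjoint := (selfadjoint dot).
Implicit Types (A B T S : H -> H) (x y z : H).

(** The square is centred at [S y], where the supremum is attained. *)
Lemma fenchel_conj_quad A S : linear A -> opsym A -> (forall x, 0 <= rdot (A x) x) ->
  (forall y, A (S y) = y) -> fenchel_conj dot (quad dot A) = quad dot S.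
Proof.
move=> lA sA pA AS; apply/funext => y.
have E x : ((sre (dot y x))%:E - quad dot A x = (rdot y x - 2^-1 * rdot (A x) x)%:E)%E.
  by rewrite EFinB.
apply/eqP; rewrite eq_le; apply/andP; split.
  apply: ge_ereal_sup => _ [x _ <-]; rewrite E lee_fin -/(rdot (S y) y).
  have := pA (x - S y); rewrite (lin_sub lA) AS !rdotE.
  rewrite (sA x (S y)) AS (rdotC dot x y) (rdotC dot y (S y)).
  by move: (rdot _ _) (rdot _ _) (rdot _ _) => a b c; lra.
apply: ereal_sup_ubound; exists (S y) => //; rewrite E AS; congr EFin.
by rewrite -/(rdot (S y) y) (rdotC dot y (S y)); field.
Qed.

Lemma positive_operator_ge0 A x : positive_operator dot A -> 0 <= rdot (A x) x.
Proof. by move=> [_ _ h]; exact: sre_ge0 (h x). Qed.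

(** [K] plays the role of h_t(T) with T = Q B Q, and enters only through the relation ((1 - t) T +
    t) K = T. The averaged conjugate is the quadratic functional of N = (1 - t) A^(-1) + t B^(-1),
    and P K P is a right inverse of N. *)
Lemma harm_mean_quad (A B P Q K : H -> H) t :
  positive_operator dot A -> positive_operator dot B -> invertible_operator B ->
  selfadjoint P -> selfadjoint Q ->
  (forall x, P (P x) = A x) -> (forall x, P (Q x) = x) -> (forall x, Q (P x) = x) -> 0 < t < 1 ->
  (forall y, rsc (1 - t) (Q (B (Q (K y)))) + rsc t (K y) = Q (B (Q y))) ->
  harm_mean dot t (quad dot A) (quad dot B) = quad dot (fun x => P (K (P x))).
Proof.
move=> A_pos B_pos [B' [[lB' _] BB' B'B]] [lP _ symP] [lQ _ symQ] PP PQ QP /andP[t0 t1] hK.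
have [lA _ symA] := positive_selfadjoint A_pos; have [lB _ symB] := positive_selfadjoint B_pos.
have symB' : opsym B' by move=> x y; rewrite -{1}(B'B y) -symB B'B.
rewrite /harm_mean (fenchel_conj_quad (S := Q \o Q) lA symA) //; last 2 first.
- by move=> x; exact: positive_operator_ge0.
- by move=> y; rewrite -PP /= !PQ.
rewrite (fenchel_conj_quad (S := B') lB symB) //; last by move=> x; exact: positive_operator_ge0.
pose N x := rsc (1 - t) (Q (Q x)) + rsc t (B' x).
have -> : (fun y => ((1 - t)%:E * quad dot (Q \o Q) y + t%:E * quad dot B' y)%E) = quad dot N.
  apply/funext => y; rewrite /quad -!EFinM -EFinD; congr EFin.
  by rewrite -!/(rdot _ _) /N !rdotE /=; ring.
apply: fenchel_conj_quad => [a x y|x y|x|x].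
- rewrite /N (lQ a x y) lQ lB' /rsc !scalerDr !scalerA ![_ * a]mulrC -!scalerA.
  by rewrite addrACA -!scalerDr.
- by rewrite /N !rdotE !symQ symB'.
- rewrite /N !rdotE symQ (rdot_nrm Hdot); apply: addr_ge0; apply: mulr_ge0.
  + by rewrite subr_ge0 ltW.
  + exact: sqr_ge0.
  + exact: ltW.
  + by rewrite -[X in rdot _ X](B'B x) rdotC; exact: positive_operator_ge0.
(* The relation for [K] gives T v = t K y; applying P turns it into B (Q v) = t P K y, which
   evaluates the term with B^(-1). *)
- rewrite /N QP; set y := P x; pose v := y - rsc (1 - t) (K y).
  have Tv : Q (B (Q v)) = rsc t (K y).
    rewrite /v (lin_sub lQ) (lin_sub lB) (lin_sub lQ).
    by rewrite (lin_rsc _ _ lQ) (lin_rsc _ _ lB) (lin_rsc _ _ lQ) -hK addrC addKr.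
  have Bv : B (Q v) = rsc t (P (K y)) by rewrite -(lin_rsc _ _ lP) -Tv PQ.
  have -> : rsc t (B' (P (K y))) = Q v by rewrite -(lin_rsc _ _ lB') -Bv BB'.
  by rewrite /v (lin_sub lQ) (lin_rsc _ _ lQ) /y QP addrC subrK.
Qed.

Lemma form_bounds A d : selfadjoint A -> (forall x, 0 <= rdot (A x) x) -> 0 < d ->
    (forall x, d * nrm x <= nrm (A x)) ->
  exists c M, [/\ 0 < c, c < M & forall x, c * nrm x ^+ 2 <= rdot (A x) x <= M * nrm x ^+ 2].
Proof.
move=> [lA [K K0 bK] sA] qA d0 hd.
have c0 : 0 < d ^+ 2 / K by rewrite divr_gt0 ?exprn_gt0.
(* Coercivity with constant d^2 / K comes from [positive_form_bound]. The upper constant K is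
   enlarged by it to make the interval nondegenerate. *)
exists (d ^+ 2 / K), (d ^+ 2 / K + K); split; rewrite ?ltrDl // => x; apply/andP; split.
  rewrite mulrAC ler_pdivrMr // [leRHS]mulrC.
  apply: le_trans (positive_form_bound Hdot x lA sA qA bK).
  by rewrite -exprMn ler_pXn2r ?nnegrE ?nrm_ge0 ?mulr_ge0 ?nrm_ge0 // ltW.
apply: le_trans (ler_norm _) _; apply: le_trans (rdot_le_nrm Hdot _ _) _.
rewrite expr2 mulrA; apply: ler_wpM2r; first exact: nrm_ge0.
by apply: le_trans (bK x) _; apply: ler_wpM2r; [exact: nrm_ge0 | rewrite lerDr ltW].
Qed.

Lemma lipschitz_itv_bounded (c M L : R) f r : c < M -> 0 <= L -> lipschitz_itv c M f L ->
  c <= r <= M -> `|f r| <= `|f c| + L * (M - c).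
Proof.
move=> cM L0 fL rI; have cI : c <= c <= M by rewrite lexx ltW.
rewrite -(subrK (f c) (f r)) addrC; apply: le_trans (ler_normD _ _) _; rewrite lerD2l.
apply: le_trans (fL _ _ rI cI) _; apply: ler_wpM2l => //.
by case/andP: rI => h1 h2; rewrite ger0_norm ?subr_ge0 // lerD2r.
Qed.

Lemma cfc_mul T c M f g Lf Lg : selfadjoint T -> c < M ->
  (forall r, spectrum T (of_real r) -> c <= r <= M) -> 0 <= Lf -> 0 <= Lg ->
  lipschitz_itv c M f Lf -> lipschitz_itv c M g Lg ->
  cfc_approx (fun r => f r * g r) T (cfc f T \o cfc g T).
Proof.
move=> sT cM spT f0 g0 fL gL.
apply: (cfc_approx_mul Hdot sT (F := `|f c| + Lf * (M - c)) (G := `|g c| + Lg * (M - c))).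
- exact: (cfc_lipschitz Hdot sT cM spT f0).
- exact: (cfc_lipschitz Hdot sT cM spT g0).
- by move=> r /spT; exact: lipschitz_itv_bounded.
- by move=> r /spT; exact: lipschitz_itv_bounded.
- by rewrite addr_ge0 // mulr_ge0 // subr_ge0 ltW.
- by rewrite addr_ge0 // mulr_ge0 // subr_ge0 ltW.
Qed.

Lemma lipschitz_powR (c M t : R) : 0 < c -> `|t| <= 1 ->
  lipschitz_itv c M (fun r => r `^ t) ((1 + c^-1) ^+ 2).
Proof. by move=> c0 t1 r s; exact: powR_lipschitz_base. Qed.

Lemma op_pow_mul T c M s t : selfadjoint T -> 0 < c -> c < M ->
  (forall r, spectrum T (of_real r) -> c <= r <= M) -> `|s| <= 1 -> `|t| <= 1 ->
  cfc_approx (fun r => r `^ (s + t)) T (op_pow T s \o op_pow T t).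
Proof.
move=> sT c0 cM spT s1 t1.
have L0 : 0 <= (1 + c^-1) ^+ 2 by exact: sqr_ge0.
have := cfc_mul sT cM spT L0 L0 (lipschitz_powR c0 s1) (lipschitz_powR c0 t1).
apply: cfc_approx_eq => r /spT /andP[cr _]; rewrite -powRD //.
by rewrite (gt_eqF (lt_le_trans c0 cr)) implybT.
Qed.

Lemma op_pow0 T c M : selfadjoint T -> 0 < c ->
  (forall r, spectrum T (of_real r) -> c <= r <= M) -> cfc_approx (fun r => r `^ 0) T id.
Proof.
move=> sT c0 spT; have := cfc_approx_poly 1%:P T.
have -> : poly_op 1%:P T = id by apply/funext => x; rewrite poly_opC /rsc of_real1 scale1r.
by apply: cfc_approx_eq => r _; rewrite powRr0 hornerC.
Qed.

Lemma op_pow1 T c M : selfadjoint T -> 0 < c ->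
  (forall r, spectrum T (of_real r) -> c <= r <= M) -> cfc_approx (fun r => r `^ 1) T T.
Proof.
move=> sT c0 spT; have := cfc_approx_poly 'X T.
have -> : poly_op 'X T = T by apply/funext => x; rewrite poly_opX.
apply: cfc_approx_eq => r /spT /andP[cr _]; rewrite hornerX powRr1 //.
exact: ltW (lt_le_trans c0 cr).
Qed.

End QuadraticMeans.

(** * The square roots of A and the conjugated operator T *)

Section MeanOfPair.
Context {R : realType} {k : scalar_kind}.
Context {H : completeNormedModType (scalar_field R k)}.
Context (dot : {dot H for (@sconj R k)}).
Hypothesis Hdot : is_hilbert dot.
Local Notation rdot := (rdot dot).
Local Notation rdotE := (rdotE dot).
Local Notation opsym := (opsym dot).
Local Notation selfadjoint := (selfadjoint dot).
Local Notation mu := (@lebesgue_measure R).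
Variables (A B : H -> H).
Hypotheses (A_pos : positive_operator dot A) (A_inv : invertible_operator A).
Hypotheses (B_pos : positive_operator dot B) (B_inv : invertible_operator B).
Implicit Types (x y z : H).

Let P := op_pow A 2^-1.
Let Q := op_pow A (- 2^-1).
Let T := Q \o B \o Q.

Let half_le1 : `|2^-1 : R| <= 1.
Proof. by rewrite ger0_norm // invf_le1 // ler1n. Qed.

Let halfN_le1 : `|- 2^-1 : R| <= 1.
Proof. by rewrite normrN. Qed.

Let sA : selfadjoint A. Proof. exact: positive_selfadjoint. Qed.

(** All three products follow from x^s x^t = x^(s + t) on the spectrum, with s + t equal to 1 or 0,
    and uniqueness of the calculus. *)
Lemma sqrt_invsqrt_spec : [/\ selfadjoint P, selfadjoint Q, P \o P = A, P \o Q = id & Q \o P = id].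
Proof.
have [d d0 hd] := invertible_bounded_below A_inv.
have [c [M [c0 cM bA]]] := form_bounds Hdot sA (fun x => positive_operator_ge0 x A_pos) d0 hd.
have spA r : spectrum A (of_real r) -> c <= r <= M := spectrum_itv Hdot sA bA.
have L0 : 0 <= (1 + c^-1) ^+ 2 by exact: sqr_ge0.
have aP := cfc_lipschitz Hdot sA cM spA L0 (lipschitz_powR c0 half_le1).
have aQ := cfc_lipschitz Hdot sA cM spA L0 (lipschitz_powR c0 halfN_le1).
have mul s t := op_pow_mul Hdot sA c0 cM spA (s := s) (t := t).
split.
- exact: cfc_approx_selfadjoint aP.
- exact: cfc_approx_selfadjoint aQ.
- have := mul _ _ half_le1 half_le1; rewrite (_ : 2^-1 + 2^-1 = 1) => [h|]; last by field.
  exact: (cfc_approx_uniq Hdot sA h (op_pow1 sA c0 spA)).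
- have := mul _ _ half_le1 halfN_le1; rewrite subrr => h.
  exact: (cfc_approx_uniq Hdot sA h (op_pow0 sA c0 spA)).
- have := mul _ _ halfN_le1 half_le1; rewrite addNr => h.
  exact: (cfc_approx_uniq Hdot sA h (op_pow0 sA c0 spA)).
Qed.

Let sB : selfadjoint B. Proof. exact: positive_selfadjoint. Qed.

Lemma conjugate_selfadjoint : selfadjoint T.
Proof.
have [_ [lQ [q q0 bQ] symQ] _ _ _] := sqrt_invsqrt_spec; have [lB [b b0 bB] symB] := sB.
split.
- by move=> a x y; rewrite /T /= lQ lB lQ.
- exists (q * (b * q)); first by rewrite !mulr_gt0.
  move=> x; rewrite -!mulrA; apply: le_trans (bQ _) _; rewrite ler_pM2l //.
  by apply: le_trans (bB _) _; rewrite ler_pM2l.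
- by move=> x y; rewrite /T /= symQ symB symQ.
Qed.

Lemma conjugate_form_bounds : exists c M, [/\ 0 < c, c < M &
  forall x, c * nrm x ^+ 2 <= rdot (T x) x <= M * nrm x ^+ 2].
Proof.
have [[_ [p p0 bP] _] [_ _ symQ] _ PQ _] := sqrt_invsqrt_spec.
have [b b0 bB] := invertible_bounded_below B_inv.
(* As P Q = id and P is bounded by p, Q is bounded below by 1/p. *)
have bQ x : p^-1 * nrm x <= nrm (Q x).
  by rewrite ler_pdivrMl //; have := bP (Q x); rewrite -[P (Q x)]/((P \o Q) x) PQ.
apply: (form_bounds Hdot conjugate_selfadjoint (d := p^-1 * (b * p^-1))).
- by move=> x; rewrite /T /= symQ; exact: positive_operator_ge0.
- by rewrite !mulr_gt0 ?invr_gt0.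
- move=> x; rewrite /T /=; apply: le_trans (bQ _); rewrite -mulrA ler_pM2l ?invr_gt0 //.
  by apply: le_trans (bB _); rewrite -mulrA ler_pM2l.
Qed.

End MeanOfPair.

(** * The means of functionals and operators through T *)

Section SpectralMeans.
Context {R : realType} {k : scalar_kind}.
Context {H : completeNormedModType (scalar_field R k)}.
Context (dot : {dot H for (@sconj R k)}).
Hypothesis Hdot : is_hilbert dot.
Local Notation rdot := (rdot dot).
Local Notation rdotE := (rdotE dot).
Local Notation selfadjoint := (selfadjoint dot).
Local Notation mu := (@lebesgue_measure R).
Variable T : H -> H.
Hypothesis sT : selfadjoint T.
Variables (c M : R).
Hypotheses (c_gt0 : 0 < c) (cM : c < M).
Hypothesis spT : forall r, spectrum T (of_real r) -> c <= r <= M.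

Let L := (1 + c^-1) ^+ 2.

Let L_ge0 : 0 <= L. Proof. exact: sqr_ge0. Qed.

Let calc f : lipschitz_itv c M f L -> cfc_approx f T (cfc f T).
Proof. exact: (cfc_lipschitz Hdot sT cM spT L_ge0). Qed.

Let pos_itv r : c <= r <= M -> 0 < r.
Proof. by move=> /andP[h _]; exact: lt_le_trans h. Qed.

Let lip_pow t : 0 <= t <= 1 -> lipschitz_itv c M (fun r => r `^ t) L.
Proof. by move=> /andP[t0 t1]; apply: lipschitz_powR => //; rewrite ger0_norm. Qed.

Let lip_harm t : 0 <= t <= 1 -> lipschitz_itv c M (harm_fun t) L.
Proof. by move=> t01 r s; exact: harm_fun_lipschitz. Qed.

Let lip_log : lipschitz_itv c M (@log_mean_fun R) L.
Proof. by move=> r s; apply: log_mean_lipschitz => //; exact: ltW. Qed.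

(** The factor 1/2 of [quad] goes into the weights. The coefficient [a], bounded by [C],
    accommodates the constant pi / sin(pi l) in front of x^l next to the coefficient 1 of h_t. *)
Let discretization z (C e : R) : 0 <= C -> 0 < e -> exists n (m xs : nat -> R),
  [/\ forall j, 0 <= m j, forall j, (j < n)%N -> c <= xs j <= M &
   forall f a, lipschitz_itv c M f L -> 0 <= a <= C ->
     `|a * (2^-1 * rdot (cfc f T z) z) - \sum_(j < n) m j * (a * f (xs j))| <= e].
Proof.
move=> C0 e0; have CL : 0 < C * L + 1 by rewrite ltr_wpDl // mulr_ge0.
have [n [m [xs [m0 xsI hm]]]] := spectral_discretization Hdot sT cM spT z (divr_gt0 e0 CL).
exists n, (fun j => 2^-1 * m j), xs; split=> // [j|f a fL /andP[a0 aC]].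
  by rewrite mulr_ge0.
have := hm f L _ L_ge0 fL (calc fL); set d := e / _ => h.
have -> : \sum_(j < n) 2^-1 * m j * (a * f (xs j)) = a * (2^-1 * \sum_(j < n) m j * f (xs j)).
  by rewrite !mulr_sumr; apply: eq_bigr => j _; ring.
rewrite -!mulrBr normrM (ger0_norm a0) normrM (ger0_norm (x := 2^-1)) //.
have d0 : 0 <= d by rewrite divr_ge0 // ltW.
apply: (@le_trans _ _ (C * (L * d))).
  apply: ler_pM => //; apply: le_trans (_ : 1 * (L * d) <= _); last by rewrite mul1r.
  by apply: ler_pM => //; rewrite invf_le1 // ler1n.
by rewrite mulrA /d mulrA ler_pdivrMr // mulrC ler_pM2l // lerDl.
Qed.

(** On the spectrum the polynomial (1 - t) x + t times h_t(x) is x; multiplicativity and uniqueness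
    carry this over to operators. *)
Lemma harm_relation t y : 0 < t < 1 ->
  rsc (1 - t) (T (cfc (harm_fun t) T y)) + rsc t (cfc (harm_fun t) T y) = T y.
Proof.
move=> /andP[t0 t1]; have t01 : 0 <= t <= 1 by rewrite !ltW.
have aK := calc (lip_harm t01).
pose p : {poly R} := (1 - t) *: 'X + t%:P.
have pE r : p.[r] = (1 - t) * r + t by rewrite /p !hornerE.
have M0 : 0 < M := lt_trans c_gt0 cM.
have h := cfc_approx_mul Hdot sT (F := M + 1) (cfc_approx_poly p T) aK _
  (fun r sr => lipschitz_itv_bounded cM L_ge0 (lip_harm t01) (spT sr)) _ _.
have {}h : cfc_approx (fun r => p.[r] * harm_fun t r) T (poly_op p T \o cfc (harm_fun t) T).
  apply: h.
  - move=> r /spT rI; have r0 := pos_itv rI; rewrite pE.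
    have d0 := harm_den_gt0 t01 r0; rewrite gtr0_norm //.
    case/andP: rI => _ rM; apply: lerD; last exact: ltW.
    by apply: le_trans rM; apply: ler_piMl; [exact: ltW | rewrite gerBl ltW].
  - by rewrite addr_ge0 // ltW.
  - by rewrite addr_ge0 // mulr_ge0 // subr_ge0 ltW.
have h1 : cfc_approx (fun r => p.[r] * harm_fun t r) T T.
  apply: cfc_approx_eq (op_pow1 sT c_gt0 spT) => r /spT rI; have r0 := pos_itv rI.
  by rewrite powRr1 ?ltW // pE /harm_fun mulrC mulfVK // gt_eqF // harm_den_gt0.
have := cfc_approx_uniq Hdot sT h h1 => /(congr1 (@^~ y)) /= <-.
by rewrite /p poly_opD poly_opZ poly_opX poly_opC.
Qed.

(** The endpoints l = 0 and l = 1, defined separately, match T^0 = id and T^1 = T. In between, the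
    scalar identity with value C x^l, C = pi / sin(pi l), is transferred to the form of T, and the
    normalizing factor is 1 / C. *)
Lemma geom_mean_quad (A B P : H -> H) l x :
  (forall y, P (P y) = A y) -> (forall y, P (T (P y)) = B y) -> opsym dot P ->
  (forall t, 0 < t < 1 -> harm_mean dot t (quad dot A) (quad dot B) =
     quad dot (fun y => P (cfc (harm_fun t) T (P y)))) ->
  0 <= l <= 1 ->
  geom_mean dot l (quad dot A) (quad dot B) x = (2^-1 * rdot (op_pow T l (P x)) (P x))%:E.
Proof.
move=> PA PB symP hm /andP[l0 l1]; rewrite /geom_mean; case: eqP => [->|/eqP ln0].
  rewrite /op_pow (cfc_approxE Hdot sT (op_pow0 sT c_gt0 spT)).
  by rewrite /quad -PA; congr (_ * _)%:E; exact: symP.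
case: eqP => [->|/eqP ln1].
  rewrite /op_pow (cfc_approxE Hdot sT (op_pow1 sT c_gt0 spT)).
  by rewrite /quad -PB; congr (_ * _)%:E; exact: symP.
have l01 : 0 < l < 1 by rewrite !lt_neqAle l0 l1 eq_sym ln0 ln1.
set z := P x; set g := fun t => 2^-1 * rdot (cfc (harm_fun t) T z) z.
have s0 := sin_pi_gt0 l01; have p0 := pi_gt0 R.
pose C := pi / sin (pi * l); have C0 : 0 < C by rewrite divr_gt0.
transitivity ((sin (pi * l) / pi)%:E * (C * (2^-1 * rdot (op_pow T l z) z))%:E)%E; last first.
  rewrite -EFinM; congr EFin; rewrite mulrA /C -[pi / sin (pi * l)]invf_div mulfV ?mul1r //.
  by rewrite mulf_neq0 ?invr_neq0 // gt_eqF.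
congr (_ * _)%E.
transitivity (\int[mu]_(t in `]0%R, 1%R[) (harm_weight l t * g t)%:E)%E.
  apply: eq_integral => t; rewrite inE /= in_itv /= => t01.
  rewrite (hm t t01) -EFinM; congr EFin; rewrite /harm_weight /g; congr (_ * (_ * _)).
  exact: symP.
have itvD t : `]0%R, 1%R[%classic t -> 0 <= t <= 1 :> bool.
  by rewrite /= in_itv /= => /andP[? ?]; rewrite !ltW.
apply: (@integral_by_discretization _ _ _ _ (fun t r => harm_fun t r) (fun r => C * r `^ l)
    (fun r => c <= r <= M) _ C).
- exact: measurable_itv.
- by move=> t _; exact: harm_weight_ge0.
- by apply: measurable_fun_unit_itv => t; exact: continuous_harm_weight.
(* The total mass of the weight is the scalar identity at x = 1, where every harmonic mean equals
   1. *)
- have := integral_harm_weight l01 (ltr01 : 0 < (1 : R)); rewrite powR1 mulr1 -/C => <-.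
  apply: eq_integral => t _; congr EFin.
  by rewrite /harm_fun mulr1 subrK invr1 !mulr1.
- move=> r /pos_itv r0; apply: measurable_fun_unit_itv => t; exact: continuous_harm_fun.
- by move=> r t /pos_itv r0 /itvD t01; exact: harm_fun_ge0.
- by move=> r /pos_itv r0; rewrite integral_harm_weight.
- move=> t /itvD t01; rewrite /g mulr_ge0 //.
  apply: (cfc_approx_ge0 Hdot sT _ (calc (lip_harm t01))) => r /spT /pos_itv r0.
  exact: harm_fun_ge0.
(* The bound 1 + C admits both coefficients, 1 for h_t and C for x^l, in one discretization. *)
- move=> e e0; have C1 : 0 <= 1 + C by rewrite addr_ge0 // ltW.
  have [n [m [xs [m0 xsI hd]]]] := discretization z C1 e0.
  exists n, m, xs; split=> // [t /itvD t01|].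
    have := hd _ 1 (lip_harm t01); rewrite ler01 lerDl (ltW C0) mul1r => /(_ isT).
    by under eq_bigr do rewrite mul1r.
  have CI : 0 <= C <= 1 + C by rewrite (ltW C0) lerDr ler01.
  have lI : 0 <= l <= 1 by rewrite l0 l1.
  exact: hd (lip_pow lI) CI.
Qed.

(** The same transfer with weight 1 on [0, 1], applied to the family x^t and its integral. *)
Lemma log_mean_quad (A B P : H -> H) :
  (forall y, P (P y) = A y) -> (forall y, P (T (P y)) = B y) -> opsym dot P ->
  (forall t, 0 < t < 1 -> harm_mean dot t (quad dot A) (quad dot B) =
     quad dot (fun y => P (cfc (harm_fun t) T (P y)))) ->
  log_mean dot (quad dot A) (quad dot B) =
  quad dot (fun y => P (cfc (@log_mean_fun R) T (P y))).
Proof.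
move=> PA PB symP hm; apply/funext => x; rewrite /log_mean; set z := P x.
have -> : quad dot (fun y => P (cfc (@log_mean_fun R) T (P y))) x =
    (2^-1 * rdot (cfc (@log_mean_fun R) T z) z)%:E.
  by congr (_ * _)%:E; exact: symP.
have itvD t : `[0%R, 1%R]%classic t -> 0 <= t <= 1 :> bool by rewrite /= in_itv.
transitivity (\int[mu]_(t in `[0%R, 1%R]) (1 * (2^-1 * rdot (op_pow T t z) z))%:E)%E.
  apply: eq_integral => t; rewrite inE => /itvD t01.
  by rewrite (geom_mean_quad x PA PB symP hm t01) mul1r.
apply: (@integral_by_discretization _ _ _ _ (fun t r => r `^ t) (@log_mean_fun R)
    (fun r => c <= r <= M) _ 1).
- exact: measurable_itv.
- by [].
- exact: measurable_cst.
- by rewrite integral_cst //= lebesgue_measure_itv /= lte_fin ltr01 mul1e sube0.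
- move=> r /pos_itv r0; apply: measurable_funTS; apply: continuous_measurable_fun.
  exact: continuous_powRr.
- by move=> r t _ _; exact: powR_ge0.
- by move=> r /pos_itv r0; under eq_integral do rewrite mul1r; exact: integral_powRr.
- move=> t /itvD t01; rewrite mulr_ge0 //.
  by apply: (cfc_approx_ge0 Hdot sT _ (calc (lip_pow t01))) => r _; exact: powR_ge0.
- move=> e e0; have [n [m [xs [m0 xsI hd]]]] := discretization z ler01 e0.
  exists n, m, xs; split=> // [t /itvD t01|].
    have := hd _ 1 (lip_pow t01); rewrite ler01 lexx mul1r => /(_ isT).
    by under eq_bigr do rewrite mul1r.
  have := hd _ 1 lip_log; rewrite ler01 lexx mul1r => /(_ isT).
  by under eq_bigr do rewrite mul1r.
Qed.

(** Up to conjugation by [P], the error of an operator Riemann sum is the functional calculus of the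
    scalar error, which is at most K times the mesh on the spectrum. Its operator norm is thus at
    most b^2 K times the mesh. *)
Lemma op_integral_powR (P : H -> H) (b : R) : linear P -> 0 <= b ->
  (forall x, nrm (P x) <= b * nrm x) ->
  is_op_integral (fun t x => P (op_pow T t (P x))) 0 1
    (fun x => P (cfc (@log_mean_fun R) T (P x))).
Proof.
move=> lP b0 bP e e0; have [K K0 hK] := powR_lipschitz_exponent c_gt0 (ltW cM).
have bK : 0 < b * b * K + 1 by rewrite ltr_wpDl // !mulr_ge0.
exists (e / (b * b * K + 1)); first by rewrite divr_gt0.
set d := e / _; have d0 : 0 < d by rewrite divr_gt0.
move=> s u sP uP; apply/op_norm_leP => x.
have uI i : (i < size s)%N -> 0 <= u i <= 1.
  move=> isz; have [/andP[u1 u2] _] := uP i isz.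
  have /andP[h1 _] : 0 <= nth 1 (0 :: s) i <= 1.
    by rewrite (itv_partition_nth_ge (ltnW isz : (i < (size s).+1)%N) sP)
      (itv_partition_nth_le (ltnW isz : (i < (size s).+1)%N) sP).
  have h2 := itv_partition_nth_le (isz : (i.+1 < (size s).+1)%N) sP.
  by rewrite (le_trans h1 u1) (le_trans u2 h2).
pose D i := nth 1 s i - nth 1 (0 :: s) i.
have h : cfc_approx (fun r => \sum_(i < size s) D i * r `^ (u i) + -1 * log_mean_fun r) T
   (fun y => \sum_(i < size s) rsc (D i) (op_pow T (u i) y) + rsc (-1) (cfc (@log_mean_fun R) T y)).
  apply: cfc_approx_add; last by apply: cfc_approx_scale; exact: calc lip_log.
  by apply: cfc_approx_sum => i; apply: cfc_approx_scale; apply: calc; apply: lip_pow; exact: uI.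
have Kd : 0 <= K * d by rewrite mulr_ge0 // ltW.
have hn := cfc_approx_norm Hdot sT (P x) h Kd.
have -> : \sum_(i < size s) of_real (nth 1 s i - nth 1 (0 :: s) i) *: P (op_pow T (u i) (P x)) -
    P (cfc (@log_mean_fun R) T (P x)) =
  P (\sum_(i < size s) rsc (D i) (op_pow T (u i) (P x)) + rsc (-1) (cfc (@log_mean_fun R) T (P x))).
  rewrite (lin_add lP) (lin_sum _ lP) (lin_rsc _ _ lP); congr (_ + _).
    by apply: eq_bigr => i _; rewrite (lin_rsc _ _ lP).
  by rewrite /rsc of_realN of_real1 scaleN1r.
apply: le_trans (bP _) _; apply: (@le_trans _ _ (b * (K * d * (b * nrm x)))).
  apply: ler_wpM2l => //; apply: le_trans (hn _) _; last exact: ler_wpM2l.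
  move=> r /spT rI; rewrite mulN1r; apply: riemann_sum_powR sP uP => //; first exact: pos_itv rI.
  by move=> t t'; exact: hK.
have -> : b * (K * d * (b * nrm x)) = b * b * K * d * nrm x by ring.
apply: ler_wpM2r; first exact: nrm_ge0.
by rewrite /d mulrA ler_pdivrMr // mulrC ler_pM2l // lerDl.
Qed.

End SpectralMeans.

(** Both candidates are compared with the Riemann sum of one partition that is fine enough for
    each. *)
Lemma is_op_integral_uniq (R : realType) (k : scalar_kind)
    (H : completeNormedModType (scalar_field R k)) (F : R -> H -> H) (S S' : H -> H) :
  is_op_integral F 0 1 S -> is_op_integral F 0 1 S' -> S = S'.
Proof.
move=> h h'; apply/funext => x; apply/eqP; rewrite -subr_eq0; apply/eqP/nrm_eq0/eqP.
rewrite eq_le nrm_ge0 andbT; apply/ler_addgt0Pr => e e0; rewrite add0r.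
have x1 : 0 < nrm x + 1 by rewrite ltr_wpDl // nrm_ge0.
pose e' := e / (2 * (nrm x + 1)); have e'0 : 0 < e' by rewrite divr_gt0 // mulr_gt0.
have [d d0 hd] := h _ e'0; have [d' d'0 hd'] := h' _ e'0.
have m0 : 0 < Num.min d d' by rewrite lt_min d0 d'0.
have md : Num.min d d' <= d by rewrite ge_min lexx.
have md' : Num.min d d' <= d' by rewrite ge_min lexx orbT.
have [s [u [sP _ uP]]] := uniform_partition m0.
have /op_norm_leP /(_ x) h1 := hd s u sP (fun i isz => conj (uP i isz).1
  (lt_le_trans (uP i isz).2 md)).
have /op_norm_leP /(_ x) h2 := hd' s u sP (fun i isz => conj (uP i isz).1
  (lt_le_trans (uP i isz).2 md')).
move: h1 h2; set v := \sum_(i < _) _ => h1 h2.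
have -> : S x - S' x = (v - S' x) - (v - S x) by rewrite opprB [RHS]addrC subrKA.
apply: le_trans (nrmD _ _) _; rewrite nrmN; apply: le_trans (lerD h2 h1) _.
have -> : e = e' * (nrm x + 1) + e' * (nrm x + 1) by rewrite /e'; field; rewrite gt_eqF.
by apply: lerD; apply: ler_wpM2l; rewrite ?lerDl //; exact: ltW.
Qed.

Theorem proposition6p4 (R : realType) (k : scalar_kind)
    (H : completeNormedModType (scalar_field R k)) (dot : {dot H for (@sconj R k)})
    (Hdot : is_hilbert dot) (A B : H -> H)
    (A_pos : positive_operator dot A) (A_inv : invertible_operator A)
    (B_pos : positive_operator dot B) (B_inv : invertible_operator B) :
  [/\ log_mean dot (quad dot A) (quad dot B) = quad dot (op_log_mean A B),
      is_op_integral (fun t => op_geom_mean t A B) 0 1 (op_log_mean A B) &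
      op_log_mean A B =
        op_pow A 2^-1 \o
          cfc (@log_mean_fun R)
            (op_pow A (- 2^-1) \o B \o op_pow A (- 2^-1)) \o
        op_pow A 2^-1].
Proof.
have [sP sQ PP PQ QP] := sqrt_invsqrt_spec Hdot A_pos A_inv.
have sT := conjugate_selfadjoint Hdot A_pos A_inv B_pos.
have [c [M [c0 cM T_itv]]] := conjugate_form_bounds Hdot A_pos A_inv B_pos B_inv.
rewrite /op_log_mean.
have -> : (fun t => op_geom_mean t A B) = (fun t x => op_pow A 2^-1
    (op_pow (op_pow A (- 2^-1) \o B \o op_pow A (- 2^-1)) t (op_pow A 2^-1 x))) by [].
(* From here on the roots of A are arbitrary self-adjoint P and Q with P P = A and P, Q inverse to
   each other. *)
move: sP sQ PP PQ QP sT T_itv; move: (op_pow A 2^-1) (op_pow A (- 2^-1)) => P Q sP sQ PP PQ QP.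
set T := Q \o B \o Q => sT T_itv.
have spT r (sr : spectrum T (of_real r)) : c <= r <= M := spectrum_itv Hdot sT T_itv sr.
have [lP [b b0 bP] symP] := sP.
have PPE x : P (P x) = A x by rewrite -PP.
have PQE x : P (Q x) = x by rewrite -[LHS]/((P \o Q) x) PQ.
have QPE x : Q (P x) = x by rewrite -[LHS]/((Q \o P) x) QP.
have PTE x : P (T (P x)) = B x by rewrite /T /= QPE PQE.
have hm t (t01 : 0 < t < 1) := harm_mean_quad Hdot A_pos B_pos B_inv sP sQ PPE PQE QPE t01
  (fun y => harm_relation Hdot sT c0 cM spT y t01).
have intP := op_integral_powR Hdot sT c0 cM spT lP (ltW b0) bP.
(* Existence makes the chosen integral meet its specification and uniqueness computes it, which
   settles the last two claims at once. *)
have intE : op_integral (fun t x => P (op_pow T t (P x))) 0 1 =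
    (fun x => P (cfc (@log_mean_fun R) T (P x))).
  exact: (is_op_integral_uniq (xgetPex (fun=> 0) (ex_intro _ _ intP)) intP).
rewrite intE; split=> //.
exact: (log_mean_quad Hdot sT c0 cM spT PPE PTE symP hm).
Qed.
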